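(* Let $X$ be a finite set equipped with a virtual tribracket structure $([\,,,],\langle\,,,\rangle)$. Then the number of $X$-colorings of an oriented virtual link diagram is an integer-valued invariant of oriented virtual links; that is, if $D$ and $D'$ are oriented virtual link diagrams representing the same oriented virtual link, then the number of $X$-colorings of $D$ equals the number of $X$-colorings of $D'$.
   Context: **Virtual tribracket.** A virtual tribracket structure on a set $X$ is a pair of ternary operations $[\,,,]:X\times X\times X\to X$ and $\langle\,,,\rangle:X\times X\times X\to X$ such that: (i) in each of the equations $[a,b,c]=d$ and $\langle a,b,c\rangle=d$, any three of the four elements $a,b,c,d\in X$ determine the fourth (i.e. for any choice of values in $X$ for three of the variables there is exactly one value in $X$ of the remaining variable for which the equation holds); (ii) for all $a,b,c,d\in X$: - $\langle a,\langle a,b,c\rangle,c\rangle=b$; - $[a,b,[b,c,d]]=[a,[a,b,c],[[a,b,c],c,d]]$; - $[[a,b,c],c,d]=[[a,b,[b,c,d]],[b,c,d],d]$; - $\langle a,b,\langle b,c,d\rangle\rangle=\langle a,\langle a,b,c\rangle,\langle\langle a,b,c\rangle,c,d\rangle\rangle$; - $\langle\langle a,b,c\rangle,c,d\rangle=\langle\langle a,b,\langle b,c,d\rangle\rangle,\langle b,c,d\rangle,d\rangle$; - $[a,b,\langle b,c,d\rangle]=\langle a,\langle a,b,c\rangle,[\langle a,b,c\rangle,c,d]\rangle$; - $[\langle a,b,c\rangle,c,d]=\langle[a,b,\langle b,c,d\rangle],\langle b,c,d\rangle,d\rangle$. **Diagrams and regions.** An oriented virtual link diagram is a generic immersion of finitely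 many oriented circles in the plane, with finitely many transverse double points, each marked either as a classical crossing (with over/under information, hence a sign, positive or negative) or as a virtual crossing (no over/under information). Its regions are the connected components of the complement in the plane of the image of the immersion (double points of both kinds are regarded as vertices of the underlying plane graph). **Colorings.** Near any crossing, rotate so that both strands point in a common general direction of travel. The four local quadrants are then: the *incoming* quadrant (between the two incoming ends), the *outgoing* quadrant (between the two outgoing ends), and the *left* and *right* quadrants, as seen facing the direction of travel. Let $\ell,r,i,o$ be the colors of the regions containing the left, right, incoming and outgoing quadrants respectively. An $X$-coloring (virtual tribracket coloring) of a diagram is an assignment of an element of $X$ to each region such that - at every positive classical crossing, $[\ell,i,r]=o$; - at every negative classical crossing, $[\ell,o,r]=i$; - at every virtual crossing, $\langle \ell,i,r\rangle=o$ (equivalently, by $\langle a,\langle a,b,c\rangle,c\rangle=b$, $\langle \ell,o,r\rangle=i$). **Virtual links.** An oriented virtual link is an equivalence class of oriented virtual link diagrams under planar isotopy and the following local moves and their inverses, with all possible orientations of strands: - the classical Reidemeister moves I (adding/removing a kink with one classical crossing), II (adding/removing a bigon with two classical crossings in which one strand is over the other at both), III (moving a strand past a classical crossing of two other strands, where the three strands are respectively top, middle and bottom); - the virtual moves I, II, III, which are the analogous moves with all crossings involved virtual; - the mixed move, in which a strand crossing two other strands only at virtual crossings is moved past a classical crossing of those two strands. A diagram represents a virtual link if it belongs to that class. *)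

(* Defs.v *)
From mathcomp Require Import all_boot all_order all_algebra.
From mathcomp Require Import all_classical all_reals all_analysis.
From Stdlib Require Import Relation_Operators.

Set Implicit Arguments.
Unset Strict Implicit.
Unset Printing Implicit Defensive.

Import Order.TTheory GRing.Theory Num.Theory.
Import numFieldTopology.Exports numFieldNormedType.Exports.

Local Open Scope ring_scope.
Local Open Scope classical_set_scope.

Section Tribracket.
Variable X : Type.
Implicit Type op : X -> X -> X -> X.

(* In [op a b c = d], any three of a, b, c, d determine the fourth; d is
   determined by a, b, c because [op] is a function. *)
Definition three_determine_fourth op : Prop :=
  [/\ forall b c d, exists! a, op a b c = d,
      forall a c d, exists! b, op a b c = d &
      forall a b d, exists! c, op a b c = d].

Record virtual_tribracket (br vb : X -> X -> X -> X) : Prop := VirtualTribracket {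
  br_determine : three_determine_fourth br;
  vb_determine : three_determine_fourth vb;
  vb_involutive : forall a b c, vb a (vb a b c) c = b;
  br_left : forall a b c d,
    br a b (br b c d) = br a (br a b c) (br (br a b c) c d);
  br_right : forall a b c d,
    br (br a b c) c d = br (br a b (br b c d)) (br b c d) d;
  vb_left : forall a b c d,
    vb a b (vb b c d) = vb a (vb a b c) (vb (vb a b c) c d);
  vb_right : forall a b c d,
    vb (vb a b c) c d = vb (vb a b (vb b c d)) (vb b c d) d;
  mixed_left : forall a b c d,
    br a b (vb b c d) = vb a (vb a b c) (br (vb a b c) c d);
  mixed_right : forall a b c d,
    br (vb a b c) c d = vb (br a b (vb b c d)) (vb b c d) d
}.

End Tribracket.

(* What happens to a strand at a point it goes through: no crossing there, or
   it is the over-strand or the under-strand of a classical crossing, or it is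
   one of the two strands of a virtual crossing. *)
Inductive mark := Plain | Over | Under | Virt.

(* The mark of the other strand at the same point. *)
Definition flip (m : mark) : mark :=
  match m with Plain => Plain | Over => Under | Under => Over | Virt => Virt end.

Section Plane.
Variable R : realType.

(* Positive iff v points to the left of u. *)
Definition cross (u v : R * R) : R := u.1 * v.2 - u.2 * v.1.

Definition C1_curve (V : normedModType R) (g : R -> V) : Prop :=
  (forall t, derivable g t 1) /\ continuous (derive1 g).

Definition differential (h : R * R -> R * R) (p v : R * R) : R * R := 'd h p v.

Definition C1_map (h : R * R -> R * R) : Prop :=
  (forall p, differentiable h p) /\
  (forall v, continuous (fun p => differential h p v)).

Definition diffeo (h : R * R -> R * R) : Prop :=
  C1_map h /\ exists g, [/\ C1_map g, cancel h g & cancel g h].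

Definition orientation_preserving (h : R * R -> R * R) : Prop :=
  forall p, 0 < cross (differential h p (1, 0)) (differential h p (0, 1)).

(* A circle is R/Z; its maps are the 1-periodic functions on R. *)
Definition same_point (n : nat) (x y : 'I_n * R) : Prop :=
  x.1 = y.1 /\ exists k : int, x.2 - y.2 = k%:~R.

Definition double_point (n : nat) (curve : 'I_n -> R -> R * R)
    (x y : 'I_n * R) : Prop :=
  ~ same_point x y /\ curve x.1 x.2 = curve y.1 y.2.

Record diagram := Diagram {
  ncomp : nat;
  curve : 'I_ncomp -> R -> R * R;
  marking : 'I_ncomp -> R -> mark;
  curve_periodic : forall i t, curve i (t + 1) = curve i t;
  marking_periodic : forall i t, marking i (t + 1) = marking i t;
  curve_C1 : forall i, C1_curve (curve i);
  curve_immersion : forall i t, derive1 (curve i) t != 0;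
  curve_transverse : forall x y, double_point curve x y ->
    cross (derive1 (curve x.1) x.2) (derive1 (curve y.1) y.2) != 0;
  curve_no_triple : forall x y z,
    double_point curve x y -> double_point curve x z -> same_point y z;
  curve_finite : finite_set
    [set p | exists x y, double_point curve x y /\ p = curve x.1 x.2];
  marking_plain : forall x,
    marking x.1 x.2 = Plain <-> ~ (exists y, double_point curve x y);
  marking_flip : forall x y, double_point curve x y ->
    marking y.1 y.2 = flip (marking x.1 x.2)
}.

Definition support (D : diagram) : set (R * R) :=
  [set p | exists i t, p = curve (d := D) i t].

Definition regions (D : diagram) : set (set (R * R)) :=
  [set connected_component (~` support D) p | p in ~` support D].

(* [P p v m] reads: some strand goes through p, its forward tangent ray there
   is spanned by v, and its mark there is m.  The picture of a diagram records
   the diagram up to reparametrization and renumbering of its components. *)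
Definition picture := R * R -> R * R -> mark -> Prop.

Definition picture_of (D : diagram) : picture := fun p v m =>
  exists i t a, [/\ 0 < a, p = curve (d := D) i t,
    v = a *: derive1 (curve (d := D) i) t & m = marking i t].

Definition pull (h : R * R -> R * R) (P : picture) : picture :=
  fun p v m => P (h p) (differential h p v) m.

Definition same_picture_on (A : set (R * R)) (P Q : picture) : Prop :=
  forall p v m, A p -> (P p v m <-> Q p v m).

(* The points issuing from p in the direction w eventually lie in A. *)
Definition contains_germ (A : set (R * R)) (p w : R * R) : Prop :=
  \forall e \near (0 : R)^'+, A (p + e *: w).

(* At a crossing let u and v direct the two strands, v pointing to the left of
   u.  When both strands are seen going upwards, u goes up to the right and v
   up to the left, so the left, right, incoming and outgoing quadrants are those
   of v - u, u - v, - (u + v) and u + v.  A classical crossing is positive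
   exactly when u directs the over-strand. *)
Definition is_coloring (X : Type) (br vb : X -> X -> X -> X) (D : diagram)
    (c : regions D -> X) : Prop :=
  forall (p u v : R * R) (m : mark) (l r i o : regions D),
    picture_of D p u m -> picture_of D p v (flip m) -> 0 < cross u v ->
    contains_germ (val l) p (v - u) -> contains_germ (val r) p (u - v) ->
    contains_germ (val i) p (- (u + v)) -> contains_germ (val o) p (u + v) ->
    match m with
    | Over => br (c l) (c i) (c r) = c o
    | Under => br (c l) (c o) (c r) = c i
    | Virt => vb (c l) (c i) (c r) = c o
    | Plain => True
    end.

Definition colorings (X : Type) (br vb : X -> X -> X -> X) (D : diagram) :
    set (regions D -> X) :=
  [set c | is_coloring br vb c].

(* Ambient isotopy of the plane, C^1 in the space variable and jointly
   continuous together with its spatial differential. *)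
Definition planar_isotopic (D D' : diagram) : Prop :=
  exists H : R -> R * R -> R * R,
    [/\ H 0 = id,
        forall t : R, 0 <= t <= 1 -> diffeo (H t),
        {within `[0, 1] `*` setT, continuous (fun z : R * (R * R) => H z.1 z.2)},
        forall v : R * R, {within `[0, 1] `*` setT,
          continuous (fun z : R * (R * R) => differential (H z.1) z.2 v)} &
        same_picture_on setT (picture_of D) (pull (H 1) (picture_of D'))].

(* The model disc is the square [-1, 1]^2, of which [open_box] is the
   interior. *)
Definition open_box : set (R * R) :=
  [set q | -1 < q.1 < 1 /\ -1 < q.2 < 1].
Definition closed_box : set (R * R) :=
  [set q | -1 <= q.1 <= 1 /\ -1 <= q.2 <= 1].

(* In a suitable chart of the plane, D and D' agree outside the model disc and
   look like P and P', respectively, in it. *)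
Definition local_move (P P' : picture) (D D' : diagram) : Prop :=
  exists psi : R * R -> R * R,
    [/\ diffeo psi, orientation_preserving psi,
        same_picture_on (~` open_box)
          (pull psi (picture_of D)) (pull psi (picture_of D')),
        same_picture_on closed_box (pull psi (picture_of D)) P &
        same_picture_on closed_box (pull psi (picture_of D')) P'].

(* The ray of the curve g at parameter t, g being run backwards if s. *)
Definition on_arc (g : R -> R * R) (s : bool) (t : R) (q w : R * R) : Prop :=
  q = g t /\ exists2 a, 0 < a & w = ((-1) ^+ s * a) *: derive1 g t.

(* The strand i is the graph of f i, run from left to right or, if s i, from
   right to left; lab i j is the mark of the strand i where it meets the
   strand j. *)
Definition graphs_picture (n : nat) (f : 'I_n -> R -> R) (s : 'I_n -> bool)
    (lab : 'I_n -> 'I_n -> mark) : picture := fun q w m =>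
  exists i t, on_arc (fun x => (x, f i x)) (s i) t q w /\
    ((m = Plain /\ forall j, j != i -> f j t != f i t) \/
     (exists j, [/\ j != i, f j t = f i t & m = lab i j])).

Definition crossing_box (f : R -> R) : Prop :=
  C1_curve f /\ forall x, -1 <= x <= 1 -> -1 < f x < 1.

(* A nodal cubic: it crosses the model disc from left to right for t from -2 to
   2, and has a single double point, where t = -1 and t = 1. *)
Definition kink (t : R) : R * R := ((t ^+ 3 - t) / 6, (t ^+ 2 - 2) / 3).

(* The strand along the kink has mark k where t = 1 and flip k where
   t = -1. *)
Definition kink_picture (s : bool) (k : mark) : picture := fun q w m =>
  exists t, on_arc kink s t q w /\
    m = if t == 1 then k else if t == -1 then flip k else Plain.

(* With k ranging over the non-plain marks and s over both directions, these
   are all the oriented kinks. *)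
Definition move1 (k : mark) (D D' : diagram) : Prop :=
  exists (s : bool) (f : R -> R), crossing_box f /\
    local_move (kink_picture s k)
      (graphs_picture (n := 1) (fun=> f) (fun=> s) (fun _ _ => Plain)) D D'.

(* k is the mark of the strand 0 at both crossings.  Over [-1, 1], f 0 lies
   below f 1, while f' 0 and f' 1 meet exactly at x1 and x2, and f' 0 lies
   above f' 1 exactly between them. *)
Definition move2 (k : mark) (D D' : diagram) : Prop :=
  exists (s : 'I_2 -> bool) (f f' : 'I_2 -> R -> R) (x1 x2 : R),
    let lab (i j : 'I_2) := if i == ord0 then k else flip k in
    [/\ forall i, crossing_box (f i) /\ crossing_box (f' i),
        -1 < x1 /\ x1 < x2 /\ x2 < 1,
        forall x, -1 <= x <= 1 -> f ord0 x < f ord_max x,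
        forall x, -1 <= x <= 1 ->
          Num.sg (f' ord_max x - f' ord0 x) = Num.sg ((x - x1) * (x - x2)) &
        local_move (graphs_picture f s lab) (graphs_picture f' s lab) D D'].

(* Over [-1, 1], the graphs of f i and f j, with i < j, meet exactly at x i j,
   and f i lies below f j exactly to the left of it. *)
Definition pairwise_cross (f : 'I_3 -> R -> R) (x : 'I_3 -> 'I_3 -> R) : Prop :=
  forall i j : 'I_3, (i < j)%N ->
    -1 < x i j < 1 /\
    (forall t, -1 <= t <= 1 -> Num.sg (f j t - f i t) = Num.sg (x i j - t)).

(* Two pictures of three strands, each two of which cross once; each strand
   meets the other two in opposite orders in the two pictures. *)
Definition move3 (lab : 'I_3 -> 'I_3 -> mark) (D D' : diagram) : Prop :=
  exists (s : 'I_3 -> bool) (f f' : 'I_3 -> R -> R) (x x' : 'I_3 -> 'I_3 -> R),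
    let i0 : 'I_3 := inord 0 in
    let i1 : 'I_3 := inord 1 in
    let i2 : 'I_3 := inord 2 in
    [/\ forall i, crossing_box (f i) /\ crossing_box (f' i),
        pairwise_cross f x /\ pairwise_cross f' x',
        x i0 i1 < x i0 i2 /\ x i0 i2 < x i1 i2,
        x' i1 i2 < x' i0 i2 /\ x' i0 i2 < x' i0 i1 &
        local_move (graphs_picture f s lab) (graphs_picture f' s lab) D D'].

Definition classical (k : mark) : Prop := k = Over \/ k = Under.

(* The strands lie at different heights and the higher one is over. *)
Definition layered (lab : 'I_3 -> 'I_3 -> mark) : Prop :=
  exists2 height : 'I_3 -> nat, injective height &
    forall i j, i != j -> lab i j = if (height j < height i)%N then Over else Under.

Definition all_virtual (lab : 'I_3 -> 'I_3 -> mark) : Prop :=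
  forall i j, i != j -> lab i j = Virt.

(* The strand k crosses the other two virtually, and these cross
   classically. *)
Definition one_strand_virtual (lab : 'I_3 -> 'I_3 -> mark) : Prop :=
  exists k, forall i j, i != j ->
    if (i == k) || (j == k) then lab i j = Virt
    else classical (lab i j) /\ lab j i = flip (lab i j).

Inductive elementary (D D' : diagram) : Prop :=
  | Isotopy of planar_isotopic D D'
  | Reidemeister1 k of classical k & move1 k D D'
  | Reidemeister2 k of classical k & move2 k D D'
  | Reidemeister3 lab of layered lab & move3 lab D D'
  | Virtual1 of move1 Virt D D'
  | Virtual2 of move2 Virt D D'
  | Virtual3 lab of all_virtual lab & move3 lab D D'
  | Mixed lab of one_strand_virtual lab & move3 lab D D'.

Definition same_virtual_link : diagram -> diagram -> Prop :=
  clos_refl_sym_trans diagram elementary.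

End Plane.

Arguments colorings {R X} br vb D.
Arguments is_coloring {R X} br vb D c.

(* Main.v *)
Require Import Defs.
From mathcomp Require Import all_boot all_order all_algebra.
From mathcomp Require Import all_classical all_reals all_analysis.
From mathcomp Require Import zify ring lra.

(* A coloring of a diagram is a locally constant function on the complement of
   its curves.  A move changes the diagram only in a disc, so it suffices to
   show that the two pictures in the disc allow the same values on the boundary
   of the disc, and that these values determine the coloring inside.

   Index the regions by the sides of the strands on which they lie.  Three
   strands then give the vertices of a cube; the relations at the crossings are
   relations on its faces, opposite faces carrying the same relation, and the two
   pictures of a third move correspond to the triples of faces meeting at two
   opposite vertices.  The third moves thus all express that the relations are
   consistent around a cube, which is invariant under the symmetries of the cube;
   so the axioms, which state it for one orientation and one order of the strands,
   give it for all. *)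

Set Implicit Arguments.
Unset Strict Implicit.
Unset Printing Implicit Defensive.

Import Order.TTheory GRing.Theory Num.Theory.
Import numFieldTopology.Exports numFieldNormedType.Exports.

(** * Crossing relations and the three-dimensional consistency of tribrackets *)

(** The obstacle is that colorings live on the regions of a diagram, a type that changes with the
    diagram and from which no disc can be cut out. They are therefore traded for functions on the
    plane with a fixed value [x0] on the curves, which can be glued. For each direction of a move,
    extending the boundary values gives a map and uniqueness inside the disc makes it injective; two
    inequalities of cardinals replace a proof that the two maps are inverse to each other. A second
    mismatch is between rays and charts: the definition of a coloring tests the quadrants along
    rays, which a diffeomorphism bends, so here they are tested on thin open cones. The two tests
    agree because near a double point each strand is a Lipschitz graph with constant 1/2, which
    misses the cones around the four quadrant directions. The same graphs show that only finitely
    many regions come near the curves, whence the number of colorings is finite. The moves do not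
    ask the graphs in the model disc to cross transversally; this is inherited from the diagrams. *)

Section CubeConsistency.
Variables (X : Type) (br vb : X -> X -> X -> X).
Hypothesis hX : virtual_tribracket br vb.

Definition crossing_rel (m : mark) (l i r o : X) : Prop :=
  match m with
  | Over => br l i r = o
  | Under => br l o r = i
  | Virt => vb l i r = o
  | Plain => True
  end.

(** For classical marks the two relations are the same equation; the virtual mark calls on the
    involutivity axiom. Hence it does not matter which strand is named first. *)
Lemma crossing_rel_flip m l i r o :
  crossing_rel m l i r o -> crossing_rel (flip m) l o r i.
Proof. by case: m => //= <-; apply: (vb_involutive hX). Qed.

Lemma crossing_rel_l m i r o : m <> Plain -> exists! l, crossing_rel m l i r o.
Proof.
have [h1 h2 h3] := br_determine hX; have [h4 h5 h6] := vb_determine hX.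
by case: m => [[]//|_|_|_] /=; [apply: h1|apply: h1|apply: h4].
Qed.

Lemma crossing_rel_r m l i o : m <> Plain -> exists! r, crossing_rel m l i r o.
Proof.
have [h1 h2 h3] := br_determine hX; have [h4 h5 h6] := vb_determine hX.
by case: m => [[]//|_|_|_] /=; [apply: h3|apply: h3|apply: h6].
Qed.

Lemma crossing_rel_o m l i r : m <> Plain -> exists! o, crossing_rel m l i r o.
Proof.
case: m => [[]//|_|_|_] /=.
- by exists (br l i r).
- by case: (br_determine hX) => _ h _; apply: h.
- by exists (vb l i r).
Qed.

Lemma crossing_rel_i m l r o : m <> Plain -> exists! i, crossing_rel m l i r o.
Proof.
case: m => [[]//|_|_|_] /=.
- by case: (br_determine hX) => _ h _; apply: h.
- by exists (br l o r).
- by case: (vb_determine hX) => _ h _; apply: h.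
Qed.

(* The four regions around a crossing are indexed by the sides of the two
   strands on which they lie, [true] being the left-hand side; [m] is the mark
   of the strand that gives the first index. *)
Definition face (m : mark) (x : bool -> bool -> X) : Prop :=
  crossing_rel m (x true true) (x false true) (x false false) (x true false).

Lemma face_flip m x : face m x -> face (flip m) (fun a b => x b a).
Proof. exact: crossing_rel_flip. Qed.

Definition update2 (x : bool -> bool -> X) a b z a' b' :=
  if (a' == a) && (b' == b) then z else x a' b'.

Lemma face_solve m x a b : m <> Plain -> exists z, face m (update2 x a b z).
Proof.
move=> hm; case: a; case: b.
- by have [z [hz _]] := crossing_rel_l (x false true) (x false false) (x true false) hm; exists z.
- by have [z [hz _]] := crossing_rel_o (x true true) (x false true) (x false false) hm; exists z.
- by have [z [hz _]] := crossing_rel_i (x true true) (x false false) (x true false) hm; exists z.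
- by have [z [hz _]] := crossing_rel_r (x true true) (x false true) (x true false) hm; exists z.
Qed.

Lemma face_inj m x y a b : m <> Plain -> face m x -> face m y ->
  (forall a' b', (a', b') <> (a, b) -> x a' b' = y a' b') -> x a b = y a b.
Proof.
move=> hm + + e; rewrite /face; case: a b e => -[] e.
- rewrite -(e true false) // -(e false true) // -(e false false) // => h1 h2.
  by have [z [_ hz]] := crossing_rel_l (x false true) (x false false) (x true false) hm;
     rewrite -(hz _ h1) -(hz _ h2).
- rewrite -(e true true) // -(e false true) // -(e false false) // => h1 h2.
  by have [z [_ hz]] := crossing_rel_o (x true true) (x false true) (x false false) hm;
     rewrite -(hz _ h1) -(hz _ h2).
- rewrite -(e true true) // -(e true false) // -(e false false) // => h1 h2.
  by have [z [_ hz]] := crossing_rel_i (x true true) (x false false) (x true false) hm;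
     rewrite -(hz _ h1) -(hz _ h2).
- rewrite -(e true true) // -(e true false) // -(e false true) // => h1 h2.
  by have [z [_ hz]] := crossing_rel_r (x true true) (x false true) (x true false) hm;
     rewrite -(hz _ h1) -(hz _ h2).
Qed.

Definition update3 (x : bool -> bool -> bool -> X) a b c z a' b' c' :=
  if [&& a' == a, b' == b & c' == c] then z else x a' b' c'.

Definition faces m01 m02 m12 (x : bool -> bool -> bool -> X) v0 v1 v2 : Prop :=
  [/\ face m01 (fun a b => x a b v2), face m02 (fun a b => x a v1 b)
    & face m12 (fun a b => x v0 a b)].

(* Three faces of a cube that share a vertex determine the color of the opposite
   vertex through each of the other three faces: all three must agree. *)
Definition consistent_at m01 m02 m12 v0 v1 v2 : Prop := forall x,
  faces m01 m02 m12 x v0 v1 v2 -> exists z,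
    faces m01 m02 m12 (update3 x (~~ v0) (~~ v1) (~~ v2) z) (~~ v0) (~~ v1) (~~ v2).

(** The base vertex moves along an edge. The color [z] of the new opposite vertex is found by
    solving the [m01] face through it and the old base vertex; consistency at the old base vertex
    then supplies the remaining faces. *)
Lemma consistent_at2 m01 m02 m12 v0 v1 v2 : m01 <> Plain ->
  consistent_at m01 m02 m12 v0 v1 v2 -> consistent_at m01 m02 m12 v0 v1 (~~ v2).
Proof.
move=> hm hv x [f01 f02 f12].
have [z hz] := face_solve (fun a b => x a b v2) (~~ v0) (~~ v1) hm.
exists z; rewrite negbK.
have [|z' [g01 g02 g12]] := hv (update3 x (~~ v0) (~~ v1) v2 z).
  by move: f01 f02 f12 hz; case: v0 v1 v2 {hv} => -[] [].
(* The color recomputed from the old base vertex is the given one, since the other three corners of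
   its [m01] face are unchanged and determine it. *)
have e : z' = x (~~ v0) (~~ v1) (~~ v2).
  have := face_inj (a := ~~ v0) (b := ~~ v1) hm g01 f01.
  rewrite /update3 !eqxx /=; apply => a b + //.
  by clear; case: a; case: b; case: v0; case: v1; case: v2 => //= -[].
rewrite {}e in g01 g02 g12.
by move: f01 f02 f12 hz g01 g02 g12; case: v0 v1 v2 {hv} => -[] [].
Qed.

Lemma consistent_at1 m01 m02 m12 v0 v1 v2 : m02 <> Plain ->
  consistent_at m01 m02 m12 v0 v1 v2 -> consistent_at m01 m02 m12 v0 (~~ v1) v2.
Proof.
move=> hm hv x [f01 f02 f12].
have [z hz] := face_solve (fun a b => x a v1 b) (~~ v0) (~~ v2) hm.
exists z; rewrite negbK.
have [|z' [g01 g02 g12]] := hv (update3 x (~~ v0) v1 (~~ v2) z).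
  by move: f01 f02 f12 hz; case: v0 v1 v2 {hv} => -[] [].
have e : z' = x (~~ v0) (~~ v1) (~~ v2).
  have := face_inj (a := ~~ v0) (b := ~~ v2) hm g02 f02.
  rewrite /update3 !eqxx /=; apply => a b + //.
  by clear; case: a; case: b; case: v0; case: v1; case: v2 => //= -[].
rewrite {}e in g01 g02 g12.
by move: f01 f02 f12 hz g01 g02 g12; case: v0 v1 v2 {hv} => -[] [].
Qed.

Lemma consistent_at0 m01 m02 m12 v0 v1 v2 : m12 <> Plain ->
  consistent_at m01 m02 m12 v0 v1 v2 -> consistent_at m01 m02 m12 (~~ v0) v1 v2.
Proof.
move=> hm hv x [f01 f02 f12].
have [z hz] := face_solve (fun a b => x v0 a b) (~~ v1) (~~ v2) hm.
exists z; rewrite negbK.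
have [|z' [g01 g02 g12]] := hv (update3 x v0 (~~ v1) (~~ v2) z).
  by move: f01 f02 f12 hz; case: v0 v1 v2 {hv} => -[] [].
have e : z' = x (~~ v0) (~~ v1) (~~ v2).
  have := face_inj (a := ~~ v1) (b := ~~ v2) hm g12 f12.
  rewrite /update3 !eqxx /=; apply => a b + //.
  by clear; case: a; case: b; case: v0; case: v1; case: v2 => //= -[].
rewrite {}e in g01 g02 g12.
by move: f01 f02 f12 hz g01 g02 g12; case: v0 v1 v2 {hv} => -[] [].
Qed.

Definition consistent m01 m02 m12 : Prop :=
  forall v0 v1 v2, consistent_at m01 m02 m12 v0 v1 v2.

(** Moves of the base vertex along the three edge directions connect any two vertices of the
    cube. *)
Lemma consistentW m01 m02 m12 v0 v1 v2 :
  m01 <> Plain -> m02 <> Plain -> m12 <> Plain ->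
  consistent_at m01 m02 m12 v0 v1 v2 -> consistent m01 m02 m12.
Proof.
move=> h01 h02 h12 h w0 w1 w2.
have /= h2 : consistent_at m01 m02 m12 v0 v1 w2.
  by have [->//|/negPf] := eqVneq w2 v2; have := consistent_at2 h01 h; case: w2 v2 {h} => -[].
have /= h1 : consistent_at m01 m02 m12 v0 w1 w2.
  by have [->//|/negPf] := eqVneq w1 v1; have := consistent_at1 h02 h2; case: w1 v1 {h h2} => -[].
by have [->//|/negPf] := eqVneq w0 v0; have := consistent_at0 h12 h1; case: w0 v0 {h h1 h2} => -[].
Qed.

(** Exchanging strands 0 and 1 transposes the face that they span, hence the [flip], and exchanges
    the other two faces. Together with [consistent_swap12] this generates all orders of the
    strands. *)
Lemma consistent_swap01 m01 m02 m12 :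
  consistent m01 m02 m12 -> consistent (flip m01) m12 m02.
Proof.
move=> h v0 v1 v2 x [f01 f02 f12].
have [|z [g01 g02 g12]] := h v1 v0 v2 (fun a b c => x b a c).
  by split=> //; have := face_flip f01; case: (m01).
exists z; split; last 2 first.
- by move: g12; case: v0 v1 v2 {f01 f02 f12 g01 g02} => -[] [].
- by move: g02; case: v0 v1 v2 {f01 f02 f12 g01 g12} => -[] [].
by move: (face_flip g01); case: v0 v1 v2 {f01 f02 f12 g01 g12 g02} => -[] [].
Qed.

Lemma consistent_swap12 m01 m02 m12 :
  consistent m01 m02 m12 -> consistent m02 m01 (flip m12).
Proof.
move=> h v0 v1 v2 x [f01 f02 f12].
have [|z [g01 g02 g12]] := h v0 v2 v1 (fun a b c => x a c b).
  by split=> //; have := face_flip f12; case: (m12).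
exists z; split.
- by move: g02; case: v0 v1 v2 {f01 f02 f12 g01 g12} => -[] [].
- by move: g01; case: v0 v1 v2 {f01 f02 f12 g02 g12} => -[] [].
by move: (face_flip g12); case: v0 v1 v2 {f01 f02 f12 g01 g12 g02} => -[] [].
Qed.

(* The paper's axioms are the instances of the consistency at the vertex
   [(false, true, false)] with [a], [b], [c], [d] at the vertices [111], [110],
   [100], [000]. *)
Lemma consistent_classical : consistent Under Under Under.
Proof.
apply: (@consistentW _ _ _ false true false) => // x [].
rewrite /face /= => e1 e2 e3.
exists (br (x true true true) (x true true false) (x true false false)).
rewrite /faces /face /update3 /=.
(* The color of the new vertex was read off its [m12] face. This equation is the [m02] face;
   [br_left] then yields the [m01] face. *)
have e4 : br (br (x true true true) (x true true false) (x true false false))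
    (x true false false) (x false false false) = x false false true.
  by rewrite -e3 -e2 -e1 (br_right hX).
by rewrite e4; split=> //; rewrite -e4 -(br_left hX) e1.
Qed.

(** Solves a virtual relation for the incoming color, the form in which [Under] is stated, so that
    the classical argument can be repeated. *)
Lemma virt_sym a b c d : vb a b c = d <-> vb a d c = b.
Proof. by split=> <-; rewrite (vb_involutive hX). Qed.

Lemma consistent_virt : consistent Virt Virt Virt.
Proof.
apply: (@consistentW _ _ _ false true false) => // x [].
rewrite /face /= => /virt_sym e1 /virt_sym e2 /virt_sym e3.
exists (vb (x true true true) (x true true false) (x true false false)).
rewrite /faces /face /update3 /=.
have e4 : vb (vb (x true true true) (x true true false) (x true false false))
    (x true false false) (x false false false) = x false false true.
  by rewrite -e3 -e2 -e1 (vb_right hX).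
split; apply/virt_sym => //.
by rewrite -e4 -(vb_left hX) e1.
Qed.

(** Strand 1 is the virtual one; strands 0 and 2 cross classically. *)
Lemma consistent_mixed : consistent Virt Under Virt.
Proof.
apply: (@consistentW _ _ _ false true false) => // x [].
rewrite /face /= => /virt_sym e1 e2 /virt_sym e3.
exists (vb (x true true true) (x true true false) (x true false false)).
rewrite /faces /face /update3 /=.
have e4 : br (vb (x true true true) (x true true false) (x true false false))
    (x true false false) (x false false false) = x false false true.
  by rewrite -e3 -e2 -e1 (mixed_right hX).
split=> //; apply/virt_sym => //.
by rewrite -e4 -(mixed_left hX) e1.
Qed.

End CubeConsistency.

(** The six orders of the heights are the six images of [Under Under Under] under renumbering. The
    two other patterns of marks are cyclic, which heights exclude. *)
Lemma consistent_layered (X : Type) (br vb : X -> X -> X -> X) (lab : 'I_3 -> 'I_3 -> mark)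
    (i j k : 'I_3) : virtual_tribracket br vb ->
  i != j -> i != k -> j != k -> layered lab ->
  consistent br vb (lab i j) (lab i k) (lab j k).
Proof.
move=> hX ij ik jk [height hinj hlab].
rewrite !hlab //.
have c := consistent_classical hX.
have c01 := consistent_swap01 hX c.
have c12 := consistent_swap12 hX c.
have c0112 := consistent_swap12 hX c01.
have c1201 := consistent_swap01 hX c12.
have c3 := consistent_swap01 hX c0112.
move: c c01 c12 c0112 c1201 c3 => /=.
have nij : height i <> height j by move/hinj; apply/eqP.
have nik : height i <> height k by move/hinj; apply/eqP.
have njk : height j <> height k by move/hinj; apply/eqP.
case: (ltnP (height j) (height i)) => h1; case: (ltnP (height k) (height i)) => h2;
  case: (ltnP (height k) (height j)) => h3 //; exfalso; lia.
Qed.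

Lemma consistent_all_virtual (X : Type) (br vb : X -> X -> X -> X) (lab : 'I_3 -> 'I_3 -> mark)
    (i j k : 'I_3) : virtual_tribracket br vb ->
  i != j -> i != k -> j != k -> all_virtual lab ->
  consistent br vb (lab i j) (lab i k) (lab j k).
Proof. by move=> hX ij ik jk hlab; rewrite !hlab //; exact: consistent_virt. Qed.

(** Three choices of the virtual strand and two marks for the classical crossing give six patterns,
    which are the six renumberings of [consistent_mixed]. *)
Lemma consistent_one_virtual (X : Type) (br vb : X -> X -> X -> X) (lab : 'I_3 -> 'I_3 -> mark)
    (i j k : 'I_3) : virtual_tribracket br vb ->
  i != j -> i != k -> j != k -> one_strand_virtual lab ->
  consistent br vb (lab i j) (lab i k) (lab j k).
Proof.
move=> hX ij ik jk [l hlab].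
have c := consistent_mixed hX.
have c01 := consistent_swap01 hX c.
have c12 := consistent_swap12 hX c.
have c0112 := consistent_swap12 hX c01.
have c1201 := consistent_swap01 hX c12.
have c3 := consistent_swap01 hX c0112.
move: c c01 c12 c0112 c1201 c3 => /=.
move: (hlab _ _ ij) (hlab _ _ ik) (hlab _ _ jk).
have : [|| i == l, j == l | k == l].
  case: i j k l ij ik jk {hlab} => [[|[|[|//]]] ?] [[|[|[|//]]] ?] [[|[|[|//]]] ?] [[|[|[|//]]] ?] //.
have [<-|il] := eqVneq i l.
  by rewrite !(eq_sym _ i) (negPf ij) (negPf ik) /= => _ -> -> [[] -> _].
have [<-|jl] := eqVneq j l.
  by rewrite !(eq_sym _ j) (negPf jk) /= => _ -> [[] -> _] ->.
by rewrite /= => -> [[] -> _] -> ->.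
Qed.

(** * Germs of cones and locally constant functions *)

Local Open Scope ring_scope.
Local Open Scope classical_set_scope.

(** [X] has no topology, so the level sets are shown to be clopen by hand: [U Y] is an open set
    whose trace on [A] consists of the points with value in [Y]. *)
Lemma connected_constant (T : topologicalType) (X : Type) (A : set T) (c : T -> X) :
  connected A ->
  (forall q, A q -> \forall q' \near q, A q' -> c q' = c q) ->
  forall p q, A p -> A q -> c p = c q.
Proof.
move=> cA loc p q Ap Aq.
pose U (Y : set X) := \bigcup_(q in [set q | A q /\ Y (c q)])
  interior [set q' | A q' -> c q' = c q].
have oU Y : open (U Y) by apply: bigcup_open => ? _; exact: open_interior.
have UY Y z : A z -> U Y z <-> Y (c z).
  move=> Az; split=> [[y [Ay Yy] /interior_subset/= /(_ Az) -> //]|Yz].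
  by exists z => //; exact: loc.
have AE : A `&` U [set c p] = A.
  apply: cA.
  - by exists p; split => //; exact/(UY _ _ Ap).
  - by exists (U [set c p]).
  - exists (~` (U (~` [set c p]))); first exact: open_closedC.
    apply/seteqP; split=> z [Az Uz]; split=> //.
      by move=> /(UY _ _ Az); apply; exact/(UY _ _ Az).
    by apply/(UY _ _ Az); apply: contrapT => ncz; apply: Uz; exact/(UY _ _ Az).
by move: Aq; rewrite -{1}AE => -[Aq /(UY _ _ Aq) ->].
Qed.

Section Slope.
Context {R : realType} {U V : normedModType R}.

(* Generated by the truncated open cones with apex p around w, without p. *)
Definition dir (p w : U) : set_system U :=
  (fun z : R * U => p + z.1 *: z.2) @ filter_prod (0 : R)^'+ (nbhs w).

Global Instance dir_proper p w : ProperFilter (dir p w).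
Proof. exact: fmap_proper_filter. Qed.

Lemma dir_nbhs p w : dir p w --> p.
Proof.
have -> : nbhs p = nbhs (p + 0 *: w) by rewrite scale0r addr0.
apply: cvgD; first exact: cvg_cst.
apply: cvgZ; last exact: cvg_snd.
by apply: cvg_trans cvg_fst _; exact: cvg_within.
Qed.

Lemma right_gt0 (w : U) :
  \forall z \near filter_prod (0 : R)^'+ (nbhs w), 0 < z.1.
Proof.
exists ([set e : R | 0 < e], setT); last by move=> -[a b] [].
by split; [exact: nbhs_right_gt|exact: filterT].
Qed.

(** Differentiability is used uniformly in the direction: the error is o of the length of
    [z.1 *: z.2], and [z.2] stays bounded near [w]. *)
Lemma slope_cvg (h : U -> V) (p w : U) : differentiable h p ->
  (fun z : R * U => z.1^-1 *: (h (p + z.1 *: z.2) - h p)) @ 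
     filter_prod (0 : R)^'+ (nbhs w) --> ('d h p w : V).
Proof.
move=> dh.
have E eps : 0 < eps -> \forall x \near (0 : U),
    `|h (p + x) - (h p + 'd h p x)| <= eps * `|x|.
  move=> eps0; have := diff_locally dh.
  move=> /eqaddoP /(_ _ eps0); apply: filterS => x /=.
  by rewrite [p + x]addrC.
have ev (eps : R) : 0 < eps -> \forall z \near filter_prod (0 : R)^'+ (nbhs w),
    `|h (p + z.1 *: z.2) - (h p + 'd h p (z.1 *: z.2))| <= eps * `|z.1 *: z.2|.
  move=> /E; rewrite -(scale0r w).
  have : (fun z : R * U => z.1 *: z.2) @ filter_prod (0 : R)^'+ (nbhs w) --> 0 *: w.
    apply: cvgZ; last exact: cvg_snd.
    by apply: cvg_trans cvg_fst _; exact: cvg_within.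
  by move=> /[apply].
have -> : nbhs ('d h p w : V) = nbhs ('d h p w + 0 : V) by rewrite addr0.
apply: (@cvg_trans _ ((fun z : R * U => 'd h p z.2 +
    z.1^-1 *: (h (p + z.1 *: z.2) - (h p + 'd h p (z.1 *: z.2)))) @
     filter_prod (0 : R)^'+ (nbhs w))).
  apply: near_eq_cvg; near=> z.
  have z0 : z.1 != 0.
    rewrite gt_eqF //; near: z.
    exact: right_gt0.
  have -> : ('d h p (z.1 *: z.2) : V) = z.1 *: ('d h p z.2 : V) by rewrite linearZ.
  by rewrite opprD addrA scalerBr scalerA mulVf// scale1r addrCA subrr addr0.
apply: cvgD.
  have := @diff_continuous _ _ _ (nbhs p) h dh w; apply: cvg_trans.
  by apply: cvg_comp; [exact: cvg_snd|].
apply/cvgr0Pnorm_le => eps eps0.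
have M0 : 0 < `|w| + 1 by rewrite ltr_wpDl.
near=> z.
have z0 : 0 < z.1 by near: z; exact: right_gt0.
rewrite normrZ gtr0_norm ?invr_gt0 // ler_pdivrMl //.
apply: (@le_trans _ _ (eps / (`|w| + 1) * `|z.1 *: z.2|)).
  by near: z; apply: ev; rewrite divr_gt0.
rewrite normrZ (gtr0_norm z0) mulrCA ler_pM2l // -mulrA ler_piMr ?(ltW eps0) //.
rewrite ler_pdivrMl // mulr1.
near: z.
have : (fun z : R * U => `|z.2|) @ filter_prod (0 : R)^'+ (nbhs w) --> `|w|.
  by apply: cvg_norm; exact: cvg_snd.
by move=> /cvgr_le; apply; rewrite ltrDl.
Unshelve. all: by end_near. Qed.

(** The reason for working with cones: a differentiable map sends thin cones into thin cones around
    the image direction, whereas a ray only goes to a curve tangent to the image ray. *)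
Lemma dir_diff (h : U -> V) (p w : U) : differentiable h p ->
  h @ dir p w --> (fun z : R * V => h p + z.1 *: z.2) @ filter_prod (0:R)^'+ (nbhs ('d h p w : V)).
Proof.
move=> dh A; rewrite !nbhs_simpl /= => -[[B C] [/= B0 Cw] BCA].
have := slope_cvg dh Cw.
move=> H.
change (\forall z \near filter_prod (0 : R)^'+ (nbhs w), A (h (p + z.1 *: z.2))).
near=> z.
have z0 : 0 < z.1 by near: z; exact: right_gt0.
have -> : h (p + z.1 *: z.2) = h p + z.1 *: (z.1^-1 *: (h (p + z.1 *: z.2) - h p)).
  by rewrite scalerA mulfV ?gt_eqF // scale1r addrCA subrr addr0.
apply: (BCA (z.1, z.1^-1 *: (h (p + z.1 *: z.2) - h p))); split => /=; near: z.
  exists (B, setT); last by move=> -[a b] [].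
  by split; [|exact: filterT].
exact: H.
Unshelve. all: by end_near. Qed.

End Slope.

Lemma dir_diff_dir (R : realType) (U V : normedModType R) (h : U -> V) (p w : U) :
  differentiable h p -> h @ dir p w --> dir (h p) ('d h p w).
Proof. exact: dir_diff. Qed.

Lemma dir_gt0 (R : realType) (U : normedModType R) (h : U -> R) (p w : U) :
  differentiable h p -> h p = 0 -> 0 < 'd h p w -> \forall q \near dir p w, 0 < h q.
Proof.
move=> dh h0 hw; have /= := @dir_diff _ _ _ h p w dh [set y | 0 < y]; apply; rewrite h0.
exists ([set e : R | 0 < e], [set e : R | 0 < e]); last first.
  by move=> [a b] [/= a0 b0]; rewrite add0r mulr_gt0.
split; first exact: nbhs_right_gt.
by apply: lt_nbhsr => //.
Qed.

(** * Colorings of pictures by functions on the plane *)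

Lemma card_le_inj (T U : Type) (A : set T) (B : set U) (f : T -> U) :
  (forall a, A a -> B (f a)) ->
  (forall a a', A a -> A a' -> f a = f a' -> a = a') -> (A #<= B)%card.
Proof.
move=> AB finj.
have e : (f @` A #= A)%card.
  by apply: inj_card_eq => a a' /set_mem Aa /set_mem Aa'; exact: finj.
rewrite -(card_le_eql e).
by apply: subset_card_le => _ [a Aa <-]; exact: AB.
Qed.

Lemma card_eq_cancel (T U : Type) (A : set T) (B : set U) (f : T -> U) (g : U -> T) :
  (forall a, A a -> B (f a)) -> (forall b, B b -> A (g b)) ->
  (forall a, A a -> g (f a) = a) -> (forall b, B b -> f (g b) = b) -> (A #= B)%card.
Proof.
move=> AB BA fK gK; rewrite card_eq_le; apply/andP; split.
  by apply: (card_le_inj AB) => a a' Aa Aa' e; rewrite -(fK a) // e fK.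
by apply: (card_le_inj BA) => b b' Bb Bb' e; rewrite -(gK b) // e gK.
Qed.

Lemma diff_idE (R : numFieldType) (V : normedModType R) (p : V) : 'd (id : V -> V) p = id :> (V -> V).
Proof. by case: (is_diff_id p). Qed.
Lemma diffK (R : numFieldType) (V W : normedModType R) (h : V -> W) (g : W -> V) p :
  differentiable h p -> differentiable g (h p) -> cancel h g ->
  cancel ('d h p) ('d g (h p)).
Proof.
move=> dh dg hK v.
have E := diff_comp dh dg.
have F : g \o h = id by apply/funext => x /=; rewrite hK.
have <- : 'd (g \o h) p v = 'd g (h p) ('d h p v) by rewrite E.
by rewrite F diff_idE.
Qed.

Section Pictures.
Variable R : realType.
Implicit Types (P Q : picture R) (p q u v w : R * R).

Definition carrier P : set (R * R) := [set p | exists v m, P p v m].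

Lemma carrier_picture_of (D : diagram R) : carrier (picture_of D) = Defs.support D.
Proof.
apply/seteqP; split=> p.
  by move=> [v [m [i [t [a [_ -> _ _]]]]]]; exists i, t.
move=> [i [t ->]]; exists (derive1 (curve (d := D) i) t), (marking i t).
by exists i, t, 1; rewrite scale1r ltr01.
Qed.

Lemma crossDl u u' v : cross (u + u') v = cross u v + cross u' v.
Proof. by rewrite /cross /=; ring. Qed.
Lemma crossDr u v v' : cross u (v + v') = cross u v + cross u v'.
Proof. by rewrite /cross /=; ring. Qed.
Lemma crossZl a u v : cross (a *: u) v = a * cross u v.
Proof. by rewrite /cross /= /GRing.scale /=; ring. Qed.
Lemma crossZr a u v : cross u (a *: v) = a * cross u v.
Proof. by rewrite /cross /= /GRing.scale /=; ring. Qed.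
Lemma crossNr u v : cross u (- v) = - cross u v.
Proof. by rewrite /cross /=; ring. Qed.
Lemma crossvv v : cross v v = 0.
Proof. by rewrite /cross mulrC subrr. Qed.
Lemma crossC u v : cross u v = - cross v u.
Proof. by rewrite /cross; ring. Qed.

(** Multiplicativity of the 2 by 2 determinant. *)
Lemma cross_linear (L : {linear (R * R)%type -> (R * R)%type}) u v :
  cross (L u) (L v) = cross (L (1, 0)) (L (0, 1)) * cross u v.
Proof.
have e z : z = z.1 *: (1, 0) + z.2 *: (0, 1) :> R * R.
  by apply: injective_projections; rewrite /= /GRing.scale /=; ring.
rewrite (e u) (e v) !linearD !linearZ /=.
by rewrite !(crossDl, crossDr, crossZl, crossZr) !crossvv (crossC (L (0, 1))) /cross /=; ring.
Qed.

Section Colorings.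
Variables (X : Type) (br vb : X -> X -> X -> X).
Implicit Types c : R * R -> X.

Definition locally_constant P c : Prop :=
  forall p, ~ carrier P p -> \forall q \near p, c q = c p.

(** A cone filter instead of the ray germ of [contains_germ], so that the notion is invariant under
    diffeomorphisms. *)
Definition color_along P c p w x : Prop :=
  \forall q \near dir p w, ~ carrier P q /\ c q = x.

Definition crossing_ok P c p : Prop :=
  forall u v m l i r o, P p u m -> P p v (flip m) -> 0 < cross u v ->
    color_along P c p (v - u) l -> color_along P c p (u - v) r ->
    color_along P c p (- (u + v)) i -> color_along P c p (u + v) o ->
    crossing_rel br vb m l i r o.

Definition plane_coloring P c : Prop :=
  locally_constant P c /\ forall p, crossing_ok P c p.

Lemma diff_cancel (h g : R * R -> R * R) p v : 
  (forall p, differentiable h p) -> (forall p, differentiable g p) -> cancel h g ->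
  differential g (h p) (differential h p v) = v.
Proof.
by move=> dh dg hK; exact: (diffK (dh p) (dg _) hK).
Qed.

Lemma cross_differential (h : R * R -> R * R) p u v :
  cross (differential h p u) (differential h p v) =
  cross (differential h p (1, 0)) (differential h p (0, 1)) * cross u v.
Proof. exact: cross_linear. Qed.

Lemma carrier_pull (h g : R * R -> R * R) P p :
  (forall p, differentiable h p) -> (forall p, differentiable g p) ->
  cancel h g -> cancel g h -> carrier (pull h P) p <-> carrier P (h p).
Proof.
move=> dh dg hK gK; split=> [[v [m Pv]]|[v [m Pv]]].
  by exists (differential h p v), m.
exists (differential g (h p) v), m; rewrite /pull.
have := @diff_cancel g h (h p) v dg dh gK.
by rewrite hK => ->.
Qed.

(** [h] maps cones to cones, which gives one implication; the other is the same fact for the inverse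
    [g]. *)
Lemma color_along_pull (h g : R * R -> R * R) P c p w x :
  (forall p, differentiable h p) -> (forall p, differentiable g p) ->
  cancel h g -> cancel g h ->
  color_along P c (h p) (differential h p w) x <->
  color_along (pull h P) (c \o h) p w x.
Proof.
move=> dh dg hK gK; split.
  move=> /(@dir_diff_dir _ _ _ h p w (dh p)).
  apply: (@filterS _ (dir p w) _) => q [nq <-]; split=> //.
  by move/(carrier_pull _ _ dh dg hK gK).
move=> H.
have {}H : color_along (pull h P) (c \o h) (g (h p)) (differential g (h p) (differential h p w)) x.
  by rewrite hK (@diff_cancel h g p w dh dg hK).
move: H => /(@dir_diff_dir _ _ _ g (h p) (differential h p w) (dg (h p))).
apply: (@filterS _ (dir (h p) (differential h p w)) _) => q /= [nq <-]; split.
  by move=> Pq; apply: nq; apply/(carrier_pull _ _ dh dg hK gK); rewrite gK.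
by rewrite gK.
Qed.

Lemma pull_coloring (h g : R * R -> R * R) P c :
  (forall p, differentiable h p) -> (forall p, differentiable g p) ->
  cancel h g -> cancel g h -> orientation_preserving h ->
  plane_coloring P c -> plane_coloring (pull h P) (c \o h).
Proof.
move=> dh dg hK gK oh [lc cr]; split.
  move=> p np.
  have : \forall q \near h p, c q = c (h p).
    by apply: lc => Php; apply: np; exact/(carrier_pull _ _ dh dg hK gK).
  exact: (differentiable_continuous (dh p)).
move=> p u v m l i r o Pu Pv uv hl hr hi ho.
have along w x : color_along (pull h P) (c \o h) p w x ->
    color_along P c (h p) (differential h p w) x.
  by move/(color_along_pull _ _ _ _ _ dh dg hK gK).
apply: (cr (h p) (differential h p u) (differential h p v)) => //.
- by rewrite cross_differential mulr_gt0.
- by rewrite /differential -linearB; exact: along.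
- by rewrite /differential -linearB; exact: along.
- by rewrite /differential -linearD -linearN; exact: along.
- by rewrite /differential -linearD; exact: along.
Qed.

(** Freezing the value on the curves makes the correspondence with colorings of regions
    bijective. *)
Definition colorings_off P (x0 : X) : set (R * R -> X) :=
  [set c | plane_coloring P c /\ forall p, carrier P p -> c p = x0].

Lemma orientation_preserving_inv (h g : R * R -> R * R) :
  (forall p, differentiable h p) -> (forall p, differentiable g p) ->
  cancel h g -> cancel g h -> orientation_preserving h -> orientation_preserving g.
Proof.
move=> dh dg hK gK oh p.
have := cross_differential h (g p) (differential g p (1, 0)) (differential g p (0, 1)).
rewrite !diff_cancel // => e.
have c1 : cross ((1, 0) : R * R) (0, 1) = 1 by rewrite /cross /= mulr1 mulr0 subr0.
rewrite c1 in e.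
by rewrite -(pmulr_rgt0 _ (oh (g p))) -e ltr01.
Qed.


Lemma card_pull (h : R * R -> R * R) P x0 : diffeo h -> orientation_preserving h ->
  (colorings_off P x0 #= colorings_off (pull h P) x0)%card.
Proof.
move=> [[dh _] [g [[dg _] hK gK]]] oh.
apply: (@card_eq_cancel _ _ _ _ (fun c => c \o h) (fun c => c \o g)).
- move=> c [pc c0]; split; first exact: (pull_coloring dh dg hK gK oh pc).
  by move=> p /(carrier_pull _ _ dh dg hK gK) /c0.
- move=> c [pc c0]; split.
    have -> : P = pull g (pull h P).
      by apply/funext => p; apply/funext => v; apply/funext => m;
        rewrite /pull diff_cancel // gK.
    exact: (pull_coloring dg dh gK hK (orientation_preserving_inv dh dg hK gK oh) pc).
  by move=> p Pp; apply: c0; apply/(carrier_pull _ _ dh dg hK gK); rewrite gK.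
- by move=> c _; apply/funext => p /=; rewrite gK.
- by move=> c _; apply/funext => p /=; rewrite hK.
Qed.

End Colorings.
End Pictures.

(** * Local replacement in a box *)

Section Glue.
Variables (R : realType) (X : Type) (br vb : X -> X -> X -> X).
Implicit Types (P Q M : picture R) (p q u v w : R * R) (c g : R * R -> X).

Local Notation obox := (@open_box R).
Local Notation cbox := (@closed_box R).
Local Notation crossing_ok := (crossing_ok br vb).
Local Notation plane_coloring := (plane_coloring br vb).
Local Notation colorings_off := (colorings_off br vb).

Lemma open_open_box : open obox.
Proof.
have -> : obox = fst @^-1` `]-1, 1[ `&` snd @^-1` `]-1, 1[.
  by apply/seteqP; split=> -[x y] /=; rewrite /open_box /= !in_itv /=.
apply: openI; apply: open_comp => [p _|].
- exact: cvg_fst.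
- exact: interval_open.
- exact: cvg_snd.
- exact: interval_open.
Qed.

Lemma closed_closed_box : closed cbox.
Proof.
have -> : cbox = fst @^-1` `[-1, 1] `&` snd @^-1` `[-1, 1].
  by apply/seteqP; split=> -[x y] /=; rewrite /closed_box /= !in_itv /=.
apply: closedI; apply: closed_comp => [p _|].
- exact: cvg_fst.
- exact: interval_closed.
- exact: cvg_snd.
- exact: interval_closed.
Qed.

Lemma open_boxW p : obox p -> cbox p.
Proof. by move=> [/andP[? ?] /andP[? ?]]; split; rewrite !ltW. Qed.

Lemma near_open_box p : obox p -> \forall q \near p, obox q.
Proof. by move=> pb; apply: open_nbhs_nbhs; split=> //; exact: open_open_box. Qed.

Lemma near_off_box p : ~ cbox p -> \forall q \near p, ~ cbox q.
Proof.
move=> pb; apply: (@open_nbhs_nbhs _ p (~` cbox)); split=> //.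
exact/closed_openC/closed_closed_box.
Qed.

Lemma crossing_ok_near P P' c c' p :
  (\forall q \near p, (forall v m, P q v m <-> P' q v m) /\ c q = c' q) ->
  crossing_ok P c p -> crossing_ok P' c' p.
Proof.
move=> H ok u v m l r i o Pu Pv uv.
have HP := proj1 (nbhs_singleton H).
have along w x : color_along P' c' p w x -> color_along P c p w x.
  move=> A; near=> q.
  have [Hq Hc] : (forall v m, P q v m <-> P' q v m) /\ c q = c' q.
    near: q; exact: (@dir_nbhs _ _ p w).
  have [nq <-] : ~ carrier P' q /\ c' q = x by near: q.
  by split=> // -[v' [m' /Hq Pq]]; apply: nq; exists v', m'.
by move=> /along hl /along hr /along hi /along ho; apply: (ok u v) => //; exact/HP.
Unshelve. all: by end_near. Qed.

Lemma plane_coloring_off P c c' : closed (carrier P) ->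
  (forall q, ~ carrier P q -> c q = c' q) -> plane_coloring P c -> plane_coloring P c'.
Proof.
move=> cP cc' [lc ok].
have near_off p : ~ carrier P p -> \forall q \near p, ~ carrier P q.
  move=> np; apply: (@open_nbhs_nbhs _ p (~` carrier P)); split=> //.
  exact: closed_openC.
split=> p.
  move=> np; near=> q.
  have nq : ~ carrier P q by near: q; exact: near_off.
  by rewrite -!cc' //; near: q; exact: lc.
move=> u v m l r i o Pu Pv uv.
have along w x : color_along P c' p w x -> color_along P c p w x.
  by apply: filterS => q [nq <-]; split=> //; rewrite cc'.
by move=> /along hl /along hr /along hi /along ho; apply: (ok p u v).
Unshelve. all: by end_near. Qed.

(** Local constancy is asked relative to the closed box, so that nothing is imposed on [g] outside
    it; crossings are tested where a full neighborhood lies in the box. *)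
Definition box_coloring M g : Prop :=
  (forall p, cbox p -> ~ carrier M p -> \forall q \near p, cbox q -> g q = g p) /\
  (forall p, obox p -> crossing_ok M g p).

Lemma plane_box_coloring P c : plane_coloring P c -> box_coloring P c.
Proof.
move=> [lc ok]; split=> p; last by move=> _; exact: ok.
by move=> _ /lc; apply: filterS.
Qed.

Lemma same_carrier (A : set (R * R)) P P' p : same_picture_on A P P' -> A p ->
  carrier P p <-> carrier P' p.
Proof. by move=> e Ap; split=> -[v [m /(e _ _ _ Ap) Pp]]; exists v, m. Qed.

Lemma same_pictureC (A : set (R * R)) P P' :
  same_picture_on A P P' -> same_picture_on A P' P.
Proof. by move=> e p v m Ap; split=> /(e _ _ _ Ap). Qed.

Lemma box_coloring_same P M g : same_picture_on cbox P M ->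
  box_coloring P g -> box_coloring M g.
Proof.
move=> e [lc ok]; split=> p pb.
  by move=> nM; apply: lc => // /(same_carrier e pb).
apply: crossing_ok_near (ok p pb).
near=> q; split=> // v m; apply: e; apply: open_boxW.
by near: q; exact: near_open_box.
Unshelve. all: by end_near. Qed.

(** Ensures that no crossing relation has to be checked on the frame, where the two glued functions
    meet. *)
Definition crossings_inside M : Prop := forall p u v m, cbox p ->
  M p u m -> M p v (flip m) -> 0 < cross u v -> obox p.

Lemma glue P P' c g :
  same_picture_on (~` obox) P P' -> plane_coloring P c -> box_coloring P' g ->
  crossings_inside P' ->
  (forall p, cbox p -> ~ obox p -> ~ carrier P' p -> g p = c p) ->
  plane_coloring P' (fun q => if q \in obox then g q else c q).
Proof.
move=> PP' [lc ok] [lg okg] inside gc; split=> p.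
- move=> np; have [po|po] := pselect (obox p).
    rewrite (mem_set po); near=> q.
    have qo : obox q by near: q; exact: near_open_box.
    rewrite (mem_set qo); have := open_boxW qo.
    by near: q; apply: lg => //; exact: open_boxW.
  have np' : ~ carrier P p by move/(same_carrier PP' po).
  rewrite (memNset po); have [pc|pc] := pselect (cbox p).
    (* At a point of the frame the neighborhood is shared between [g] and [c]; each is constant on
       its part, and they agree at [p]. *)
    near=> q; case: ifPn => [/set_mem qo|_]; last by near: q; exact: lc.
    rewrite -gc //; have := open_boxW qo.
    by near: q; exact: lg.
  near=> q; rewrite memNset; first by near: q; exact: lc.
  apply: contra_not (@open_boxW q) _.
  by near: q; exact: near_off_box.
- have [pc|pc] := pselect (cbox p).
    move=> u v m l r i o Pu Pv uv.
    have po := inside _ _ _ _ pc Pu Pv uv.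
    suff : crossing_ok P' (fun q => if q \in obox then g q else c q) p by apply.
    apply: crossing_ok_near (okg p po).
    near=> q; split=> //; rewrite mem_set //.
    by near: q; exact: near_open_box.
  apply: crossing_ok_near (ok p).
  near=> q.
  have qo : ~ obox q.
    apply: contra_not (@open_boxW q) _.
    by near: q; exact: near_off_box.
  by split=> [v m|]; [exact: PP'|rewrite memNset].
Unshelve. all: by end_near. Qed.

(** Existence half of the local statement; [box_rigid] is the uniqueness half. *)
Definition box_transfer M M' : Prop := forall c, box_coloring M c ->
  exists g, box_coloring M' g /\
    forall p, cbox p -> ~ obox p -> ~ carrier M p -> g p = c p.

Definition box_rigid M : Prop := forall c c', box_coloring M c -> box_coloring M c' ->
  (forall p, cbox p -> ~ obox p -> ~ carrier M p -> c p = c' p) ->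
  forall p, cbox p -> ~ carrier M p -> c p = c' p.

(** Transfer defines the map and rigidity makes it injective. Only an inequality is claimed, because
    the hypotheses will also be met with the two pictures exchanged. *)
Lemma local_card_le P P' M M' x0 :
  closed (carrier P) -> closed (carrier P') ->
  same_picture_on (~` obox) P P' ->
  same_picture_on cbox P M -> same_picture_on cbox P' M' ->
  box_transfer M M' -> box_rigid M -> crossings_inside M' ->
  (colorings_off P x0 #<= colorings_off P' x0)%card.
Proof.
move=> cP cP' PP' PM PM' tr rig inside.
have inside' : crossings_inside P'.
  move=> p u v m pc /(PM' _ _ _ pc) Pu /(PM' _ _ _ pc) Pv; exact: (inside _ _ _ _ pc Pu Pv).
(* The condition on [c] stands under the quantifier so that choice yields a replacement defined for
   all functions. *)
have ex (c : R * R -> X) : exists g, plane_coloring P c -> box_coloring P' g /\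
    forall p, cbox p -> ~ obox p -> ~ carrier P' p -> g p = c p.
  have [pc|] := pselect (plane_coloring P c); last by exists c.
  have [g [bg gc]] := tr c (box_coloring_same PM (plane_box_coloring pc)).
  exists g => _; split; first exact: box_coloring_same (same_pictureC PM') bg.
  move=> p pb po np; apply: gc => //.
  by move/(same_carrier PM pb)/(same_carrier PP' po).
have [G GP] := choice ex.
pose F c q := if q \in carrier P' then x0 else if q \in obox then G c q else c q.
apply: (@card_le_inj _ _ _ _ F).
  move=> c [pc _]; have [bg gc] := GP c pc; split; last first.
    by move=> p pP'; rewrite /F mem_set.
  apply: plane_coloring_off (glue PP' pc bg inside' gc) => //.
  by move=> q nq; rewrite /F (memNset nq).
move=> c c' [pc c0] [pc' c0'] FF.
(* Outside the open box the replacement keeps the coloring, so equal images agree there; rigidity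
   carries the equality into the box. *)
have eo p : ~ obox p -> ~ carrier P p -> c p = c' p.
  move=> po np; move/(congr1 (fun f => f p)): FF; rewrite /F !(memNset po) memNset //.
  by move/(same_carrier PP' po).
apply/funext => p; have [Pp|np] := pselect (carrier P p); first by rewrite c0 ?c0'.
have [po|] := pselect (obox p); last by move=> po; exact: eo.
have pb := open_boxW po.
apply: (rig c c').
- exact: box_coloring_same PM (plane_box_coloring pc).
- exact: box_coloring_same PM (plane_box_coloring pc').
- move=> q qb qo nq; apply: eo => //.
  by move/(same_carrier PM qb).
- exact: pb.
- by move/(same_carrier PM pb).
Qed.

End Glue.

(** * Pictures made of graphs *)

Lemma derive1_pair (R : realType) (U V : normedModType R) (f : R -> U) (g : R -> V) (t : R) :
  derivable f t 1 -> derivable g t 1 ->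
  derive1 (fun x => (f x, g x)) t = (derive1 f t, derive1 g t).
Proof.
move=> /derivable1_diffP df /derivable1_diffP dg.
by rewrite derive1E' ?diff_pair ?derive1E' //; exact: differentiable_pair.
Qed.
Lemma derive1_graph (R : realType) (f : R -> R) (t : R) : derivable f t 1 ->
  derive1 (fun x => (x, f x)) t = (1, derive1 f t).
Proof.
by move=> df; rewrite derive1_pair // [X in (X, _)]derive1E derive_id.
Qed.

Lemma is_diff_fst (R : numFieldType) (U V : normedModType R) (p : U * V) :
  is_diff p (fst : U * V -> U) fst.
Proof.
have cfst : continuous (fst : U * V -> U) by move=> q; exact: cvg_fst.
apply: DiffDef.
  exact: (@linear_differentiable _ _ _ (fst : {linear (U * V)%type -> U})).
by rewrite (@diff_lin _ _ _ (fst : {linear (U * V)%type -> U})).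
Qed.
Lemma is_diff_snd (R : numFieldType) (U V : normedModType R) (p : U * V) :
  is_diff p (snd : U * V -> V) snd.
Proof.
have csnd : continuous (snd : U * V -> V) by move=> q; exact: cvg_snd.
apply: DiffDef.
  exact: (@linear_differentiable _ _ _ (snd : {linear (U * V)%type -> V})).
by rewrite (@diff_lin _ _ _ (snd : {linear (U * V)%type -> V})).
Qed.

Lemma is_diff_above (R : realType) (f : R -> R) (p : R * R) : derivable f p.1 1 ->
  is_diff p (fun q : R * R => q.2 - f q.1) (fun w : R * R => w.2 - derive1 f p.1 * w.1).
Proof.
move=> df.
have d : differentiable f p.1 by apply/derivable1_diffP.
have H1 := @is_diff_comp _ _ _ _ _ _ _ _ _ (is_diff_fst p) (differentiableP d).
have [H2 H3] := is_diffB (is_diff_snd p) H1.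
apply: DiffDef; first exact: H2.
apply/funext => w; have := congr1 (fun f => f w) H3.
rewrite /= => e; apply: (etrans e).
congr (_ - _).
have e1 : 'd f (p.1) (w.1 *: (1 : R)) = w.1 *: 'd f (p.1) 1 by rewrite linearZ.
rewrite derive1E' // mulrC -[RHS]e1 /=; congr ('d f (p.1) _).
by rewrite /GRing.scale /= mulr1.
Qed.

Lemma dir_above (R : realType) (f : R -> R) (p w : R * R) : derivable f p.1 1 ->
  f p.1 = p.2 -> 0 < w.2 - derive1 f p.1 * w.1 -> \forall q \near dir p w, f q.1 < q.2.
Proof.
move=> df fp hw; have [d1 d2] := is_diff_above df.
have H : \forall q \near dir p w, 0 < q.2 - f q.1.
  apply: (dir_gt0 d1) => /=; [by rewrite fp subrr|by have := congr1 (fun g => g w) d2 => /= ->].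
by apply: filterS H => q; rewrite subr_gt0.
Qed.

Lemma dir_below (R : realType) (f : R -> R) (p w : R * R) : derivable f p.1 1 ->
  f p.1 = p.2 -> w.2 - derive1 f p.1 * w.1 < 0 -> \forall q \near dir p w, q.2 < f q.1.
Proof.
move=> df fp hw; have [d1 d2] := is_diffN (is_diff_above df).
have H : \forall q \near dir p w, 0 < - (q.2 - f q.1).
  apply: (dir_gt0 d1).
    by change (- (p.2 - f p.1) = 0); rewrite fp subrr oppr0.
  rewrite d2; change (0 < - (w.2 - derive1 f p.1 * w.1)).
  by rewrite oppr_gt0.
by apply: filterS H => q; rewrite opprB subr_gt0.
Qed.

Lemma near_forall (T : Type) (I : finType) (F : set_system T) (A : I -> T -> Prop) :
  Filter F -> (forall i, \forall x \near F, A i x) -> \forall x \near F, forall i, A i x.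
Proof. by move=> FF H; exact: (@filter_forall _ _ (fun i => [set x | A i x])). Qed.

Section Graph.
Variables (R : realType) (X : Type) (br vb : X -> X -> X -> X).
Hypothesis hX : virtual_tribracket br vb.
Variables (n : nat) (f : 'I_n -> R -> R) (s : 'I_n -> bool) (lab : 'I_n -> 'I_n -> mark).
Hypothesis hf : forall i, crossing_box (f i).
Implicit Types (p q u v w : R * R) (c g : R * R -> X) (tau : 'I_n -> bool)
  (C : ('I_n -> bool) -> X) (i j k : 'I_n).

Local Notation obox := (@open_box R).
Local Notation cbox := (@closed_box R).
Local Notation M := (graphs_picture f s lab).
Local Notation face := (face br vb).

Definition above p i : bool := f i p.1 < p.2.

Lemma graph_derivable i t : derivable (f i) t 1.
Proof. by have [[+ _] _] := hf i; apply. Qed.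

Lemma graph_continuous i : continuous (f i).
Proof.
move=> t; apply: differentiable_continuous.
by apply/derivable1_diffP; exact: graph_derivable.
Qed.

Lemma carrier_graph p : carrier M p <-> exists i, f i p.1 = p.2.
Proof.
split.
  by move=> [v [m [i [t [[-> _] _]]]]]; exists i.
move=> [i fi]; exists (((-1) ^+ s i * 1) *: derive1 (fun x => (x, f i x)) p.1).
have [[j /andP[ji /eqP fj]]|nex] := pselect (exists j, (j != i) && (f j p.1 == f i p.1)).
  exists (lab i j), i, p.1; split; last by right; exists j.
  by split; [rewrite /= fi -surjective_pairing|exists 1].
exists Plain, i, p.1; split.
  by split; [rewrite /= fi -surjective_pairing|exists 1].
by left; split=> // j ji; apply/negP => fj; apply: nex; exists j; rewrite ji.
Qed.

Lemma off_graph p i : ~ carrier M p -> f i p.1 != p.2.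
Proof. by move=> np; apply/eqP => fi; apply: np; apply/carrier_graph; exists i. Qed.

Lemma near_above p i : f i p.1 != p.2 ->
  \forall q \near p, f i q.1 != q.2 /\ above q i = above p i.
Proof.
move=> fp; rewrite /above.
have c1 : (fun q : R * R => q.2 - f i q.1) @ p --> p.2 - f i p.1.
  apply: cvgB; first exact: cvg_snd.
  apply: continuous_comp; first exact: cvg_fst.
  exact: graph_continuous.
have [lt|gt|/eqP] := ltgtP (f i p.1) p.2; last by rewrite (negPf fp).
  have : \forall q \near p, 0 < q.2 - f i q.1 by apply: (cvgr_gt _ c1); rewrite subr_gt0.
  by apply: filterS => q; rewrite subr_gt0 => h; rewrite h lt_eqF.
have : \forall q \near p, q.2 - f i q.1 < 0 by apply: (cvgr_lt _ c1); rewrite subr_lt0.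
by apply: filterS => q; rewrite subr_lt0 => h; rewrite gt_eqF // ltNge ltW.
Qed.

Lemma near_cell p : ~ carrier M p ->
  \forall q \near p, ~ carrier M q /\ above q = above p.
Proof.
move=> np.
have H : \forall q \near p, forall i, f i q.1 != q.2 /\ above q i = above p i.
  apply: (@near_forall _ _ (nbhs p) (fun i q => f i q.1 != q.2 /\ above q i = above p i)) => i.
  by apply: near_above; exact: off_graph.
apply: filterS H => q Hq; split; last by apply/funext => i; have [] := Hq i.
by move=> /carrier_graph [i /eqP]; have [/negPf ->] := Hq i.
Qed.

Definition tangent i (a t : R) : R * R := ((-1) ^+ s i * a) *: (1, derive1 (f i) t).

Lemma graphs_pictureP p v m : M p v m <-> exists i a, [/\ 0 < a, f i p.1 = p.2,
  v = tangent i a p.1 & (m = Plain /\ forall j, j != i -> f j p.1 != p.2) \/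
     (exists j, [/\ j != i, f j p.1 = p.2 & m = lab i j])].
Proof.
split.
  move=> [i [t [[-> [a a0 ->]] H]]]; exists i, a; split=> //.
  by rewrite derive1_graph //; exact: graph_derivable.
move=> [i [a [a0 fi -> H]]]; exists i, p.1; split; last first.
  by case: H => [H|[j [ji fj ->]]]; [left; rewrite fi|right; exists j; rewrite fi].
split; first by rewrite /= fi -surjective_pairing.
by exists a => //; rewrite derive1_graph //; exact: graph_derivable.
Qed.

Lemma cross_tangent i a t w : cross (tangent i a t) w =
  (-1) ^+ s i * a * (w.2 - derive1 (f i) t * w.1).
Proof. by rewrite crossZl /cross /= mul1r. Qed.

Lemma cross_tangents i j a b t : cross (tangent i a t) (tangent j b t) =
  (-1) ^+ s i * (-1) ^+ s j * a * b * (derive1 (f j) t - derive1 (f i) t).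
Proof. by rewrite cross_tangent /tangent /= /GRing.scale /=; ring. Qed.

(** Left means above for a strand run from left to right and below for one run backwards; this is
    the origin of every [(+) s i] that follows. *)
Lemma left_of_tangent i a t w : 0 < a -> cross (tangent i a t) w != 0 ->
  (0 < w.2 - derive1 (f i) t * w.1) = (0 < cross (tangent i a t) w) (+) s i.
Proof.
move=> a0; rewrite cross_tangent; set z := w.2 - _.
case: (s i); rewrite ?expr1 ?expr0 ?mulN1r ?mul1r; last first.
  by rewrite addbF pmulr_rgt0.
rewrite mulNr oppr_eq0 mulf_eq0 gt_eqF //= => z0.
by rewrite addbT oppr_gt0 pmulr_rlt0 // -leNgt le_eqVlt eq_sym (negPf z0).
Qed.

(* The cell near p on the left of strand i iff a and on the left of strand j
   iff b. *)
Definition corner p i j (a b : bool) k : bool :=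
  if k == i then a (+) s i else if k == j then b (+) s j else above p k.

Lemma corner_sym p i j a b : i != j -> corner p i j a b = corner p j i b a.
Proof.
move=> ij; apply/funext => k; rewrite /corner.
by have [->|//] := eqVneq k i; rewrite (negPf ij).
Qed.

Definition crossing_at p i j : Prop :=
  [/\ i != j, f i p.1 = p.2, f j p.1 = p.2
    & forall k, k != i -> k != j -> f k p.1 != p.2].

Lemma crossing_atC p i j : crossing_at p i j -> crossing_at p j i.
Proof. by move=> [ij fi fj fk]; split=> // [|k kj ki]; [rewrite eq_sym|exact: fk]. Qed.

(** The sides of the two strands through [p] are decided by the slopes, those of the other strands
    by continuity. *)
Lemma dir_corner p i j a b w : crossing_at p i j -> 0 < a -> 0 < b ->
  cross (tangent i a p.1) w != 0 -> cross (tangent j b p.1) w != 0 ->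
  \forall q \near dir p w, ~ carrier M q /\
    above q = corner p i j (0 < cross (tangent i a p.1) w) (0 < cross (tangent j b p.1) w).
Proof.
move=> [ij fi fj fk] a0 b0 ci cj.
set A := 0 < cross _ _; set B := 0 < cross _ _.
have side k d : 0 < d -> f k p.1 = p.2 -> cross (tangent k d p.1) w != 0 ->
    \forall q \near dir p w, f k q.1 != q.2 /\
      above q k = (0 < cross (tangent k d p.1) w) (+) s k.
  move=> d0 fkp ck; rewrite -left_of_tangent //.
  have [pos|neg|/eqP z] := ltrgtP 0 (w.2 - derive1 (f k) p.1 * w.1).
  - have : \forall q \near dir p w, f k q.1 < q.2.
      by apply: dir_above => //; exact: graph_derivable.
    by apply: filterS => q h; rewrite lt_eqF // /above h.
  - have : \forall q \near dir p w, q.2 < f k q.1.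
      by apply: dir_below => //; exact: graph_derivable.
    by apply: filterS => q h; rewrite gt_eqF // /above ltNge ltW.
  - by move: ck; rewrite cross_tangent -(eqP z) mulr0 eqxx.
have H : \forall q \near dir p w, forall k, f k q.1 != q.2 /\ above q k = corner p i j A B k.
  apply: (@near_forall _ _ (dir p w) (fun k q => f k q.1 != q.2 /\ above q k = corner p i j A B k)) => k; rewrite /corner.
  have [->|ki] := eqVneq k i; first exact: side.
  have [->|kj] := eqVneq k j; first exact: side.
  by apply: dir_nbhs; apply: near_above; exact: fk.
apply: filterS H => q Hq; split; last by apply/funext => k; have [] := Hq k.
by move=> /carrier_graph [k /eqP]; have [/negPf ->] := Hq k.
Qed.

Lemma color_along_corner c C p i j a b w : crossing_at p i j -> 0 < a -> 0 < b ->
  cross (tangent i a p.1) w != 0 -> cross (tangent j b p.1) w != 0 ->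
  (\forall q \near p, ~ carrier M q -> c q = C (above q)) ->
  color_along M c p w
    (C (corner p i j (0 < cross (tangent i a p.1) w) (0 < cross (tangent j b p.1) w))).
Proof.
move=> cij a0 b0 ci cj cC; near=> q.
have [nq e] : ~ carrier M q /\ above q = corner p i j (0 < cross (tangent i a p.1) w)
    (0 < cross (tangent j b p.1) w) by near: q; exact: dir_corner.
split=> //; rewrite -e.
have : ~ carrier M q -> c q = C (above q) by near: q; exact: (@dir_nbhs _ _ p w).
exact.
Unshelve. all: by end_near. Qed.

Lemma color_along_inj P c p w x y : color_along P c p w x -> color_along P c p w y -> x = y.
Proof.
move=> hx hy; apply: (@filter_const _ (dir p w)).
by apply: filterS2 hx hy => q [_ <-] [_ <-].
Qed.

Hypothesis labP : forall i j, i != j -> lab i j <> Plain /\ lab j i = flip (lab i j).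

(** Matches the four quadrant directions with pairs of sides: left of both strands, right of both,
    and the two mixed pairs. *)
Lemma four_sides u v : 0 < cross u v ->
  [/\ 0 < cross u (v - u), 0 < cross v (v - u),
      cross u (u - v) < 0 & cross v (u - v) < 0] /\
  [/\ cross u (- (u + v)) < 0, 0 < cross v (- (u + v)),
      0 < cross u (u + v) & cross v (u + v) < 0].
Proof.
move=> uv.
rewrite !(crossNr, crossDr, crossvv) (crossC v u).
by split; split; lra.
Qed.

Lemma corner_along c C p i j a b : crossing_at p i j -> 0 < a -> 0 < b ->
  0 < cross (tangent i a p.1) (tangent j b p.1) ->
  (\forall q \near p, ~ carrier M q -> c q = C (above q)) ->
  let u := tangent i a p.1 in let v := tangent j b p.1 in
  [/\ color_along M c p (v - u) (C (corner p i j true true)),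
      color_along M c p (u - v) (C (corner p i j false false)),
      color_along M c p (- (u + v)) (C (corner p i j false true)) &
      color_along M c p (u + v) (C (corner p i j true false))].
Proof.
move=> cij a0 b0 uv cC u v.
have [[h1 h2 h3 h4] [h5 h6 h7 h8]] := four_sides uv.
have along w := @color_along_corner c C p i j a b w cij a0 b0.
split.
- by have := along (v - u); rewrite h1 h2 !gt_eqF //; exact.
- by have := along (u - v); rewrite !(ltNge 0) !ltW // !lt_eqF //; exact.
- by have := along (- (u + v)); rewrite (ltNge 0 (cross (tangent i _ _) _)) h6 ltW //
    lt_eqF // gt_eqF //; exact.
- by have := along (u + v); rewrite h7 (ltNge 0 (cross (tangent j _ _) _)) ltW //
    gt_eqF // lt_eqF //; exact.
Qed.

(** A coloring constrains the pair of tangents in positive order; when the strands are named in the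
    other order, [face_flip] turns the relation around. Distinct slopes exclude the degenerate
    case. *)
Lemma crossing_face c C p i j : crossing_at p i j ->
  derive1 (f i) p.1 != derive1 (f j) p.1 ->
  (\forall q \near p, ~ carrier M q -> c q = C (above q)) ->
  crossing_ok br vb M c p -> face (lab i j) (fun a b => C (corner p i j a b)).
Proof.
wlog : i j / 0 < cross (tangent i 1 p.1) (tangent j 1 p.1).
  move=> H cij dij cC ok.
  have [ij _ _ _] := cij.
  have [pos|neg|z] := ltrgtP 0 (cross (tangent i 1 p.1) (tangent j 1 p.1)).
  - exact: H.
  - have : face (lab j i) (fun a b => C (corner p j i a b)).
      apply: H => //; last by rewrite eq_sym.
        by rewrite crossC oppr_gt0.
      exact: crossing_atC.
    move/(face_flip hX); rewrite -(proj2 (labP _)); last by rewrite eq_sym.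
    congr (face _ _); apply/funext => a; apply/funext => b.
    by rewrite corner_sym // eq_sym.
  - exfalso; move/esym/eqP: z; rewrite cross_tangents !mulr1.
    by rewrite !mulf_eq0 !signr_eq0 /= subr_eq0 eq_sym (negPf dij).
move=> uv cij dij cC ok.
have [h1 h2 h3 h4] := corner_along cij ltr01 ltr01 uv cC.
have [ij fi fj _] := cij.
have Mi : M p (tangent i 1 p.1) (lab i j).
  by apply/graphs_pictureP; exists i, 1; split=> //; right; exists j; rewrite eq_sym.
have Mj : M p (tangent j 1 p.1) (flip (lab i j)).
  apply/graphs_pictureP; exists j, 1; split=> //; right; exists i; split=> //.
  by have [_ ->] := labP ij.
exact: ok Mi Mj uv h1 h2 h3 h4.
Qed.

(** If two strands were tangent where they meet, the crossing condition there would be void and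
    would determine no color. *)
Definition transverse_in_box : Prop := forall p u m, cbox p -> M p u m -> m <> Plain ->
  exists v, M p v (flip m) /\ cross u v != 0.

Lemma crossing_slopes p i j : transverse_in_box -> cbox p -> crossing_at p i j ->
  derive1 (f i) p.1 != derive1 (f j) p.1.
Proof.
move=> tr pb [ij fi fj fk].
have Mi : M p (tangent i 1 p.1) (lab i j).
  by apply/graphs_pictureP; exists i, 1; split=> //; right; exists j; rewrite eq_sym.
have [v [/graphs_pictureP[k [b [b0 fkp -> _]]]]] := tr _ _ _ pb Mi (proj1 (labP ij)).
rewrite cross_tangents; have [->|ki] := eqVneq k i; first by rewrite subrr mulr0 eqxx.
have [->|kj] := eqVneq k j; last by move: (fk k ki kj); rewrite fkp eqxx.
by rewrite mulf_eq0 negb_or subr_eq0 => /andP[_]; rewrite eq_sym.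
Qed.

Lemma crossing_ok_graph C p :
  (forall i j, i != j -> f i p.1 = p.2 -> f j p.1 = p.2 -> crossing_at p i j) ->
  (forall i j, crossing_at p i j -> face (lab i j) (fun a b => C (corner p i j a b))) ->
  crossing_ok br vb M (fun q => C (above q)) p.
Proof.
move=> nt H u v m l r i o.
move=> /graphs_pictureP[k [a [a0 fk -> Hm]]] /graphs_pictureP[k' [b [b0 fk' -> _]]] uv.
have kk' : k != k'.
  by apply: contraTneq uv => ->; rewrite cross_tangents subrr mulr0 ltxx.
have ck := nt _ _ kk' fk fk'.
have -> : m = lab k k'.
  case: Hm => [[_ /(_ k')]|[j [jk fj ->]]]; first by rewrite eq_sym fk' eqxx => /(_ kk').
  have [->//|jk'] := eqVneq j k'.
  by have [_ _ _ /(_ j jk jk')] := ck; rewrite fj eqxx.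
have [|h1 h2 h3 h4] := @corner_along (fun q => C (above q)) C p k k' a b ck a0 b0 uv.
  by near=> q.
move=> /(color_along_inj h1) <- /(color_along_inj h2) <-.
move=> /(color_along_inj h3) <- /(color_along_inj h4) <-.
exact: H.
Unshelve. all: by end_near. Qed.

Lemma box_coloring_graph C :
  (forall p i j, cbox p -> i != j -> f i p.1 = p.2 -> f j p.1 = p.2 -> crossing_at p i j) ->
  (forall p i j, obox p -> crossing_at p i j ->
     face (lab i j) (fun a b => C (corner p i j a b))) ->
  box_coloring br vb M (fun q => C (above q)).
Proof.
move=> nt H; split=> p pb.
  by move=> /near_cell; apply: filterS => q [_ ->].
apply: crossing_ok_graph => [i j|i j cij]; last exact: H.
by apply: nt; exact: open_boxW.
Qed.

(** The strands have distinct ends on the vertical edges and avoid the horizontal ones. *)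
Lemma crossings_inside_graph :
  (forall i j, i != j -> f i (-1) != f j (-1) /\ f i 1 != f j 1) ->
  crossings_inside M.
Proof.
move=> H p u v m pb.
move=> /graphs_pictureP[k [a [a0 fk -> _]]] /graphs_pictureP[k' [b [b0 fk' -> _]]] uv.
have kk' : k != k'.
  by apply: contraTneq uv => ->; rewrite cross_tangents subrr mulr0 ltxx.
have [pb1 pb2] := pb; split.
  have [h1 h2] := H _ _ kk'; case/andP: pb1; rewrite !le_eqVlt.
  move=> /orP[/eqP e|->]; first by move: h1; rewrite e fk fk' eqxx.
  by move=> /orP[/eqP e|->//]; move: h2; rewrite -e fk fk' eqxx.
by have [_ /(_ _ pb1)] := hf k; rewrite fk.
Qed.

Definition cell (J : set R) tau : set (R * R) :=
  [set q | [/\ J q.1, cbox q, ~ carrier M q & above q = tau]].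

(* Over x, the cell tau is the interval between the strands below and the
   strands above it. *)
Lemma cell_fiber (J : set R) tau x : J x -> -1 <= x <= 1 ->
  (forall i j, tau i -> ~~ tau j -> f i x < f j x) -> exists y, cell J tau (x, y).
Proof.
move=> Jx xb lt.
pose a := \big[Order.max/-1]_(i | tau i) f i x.
pose b := \big[Order.min/1]_(i | ~~ tau i) f i x.
have fb i := proj2 (hf i) x xb.
have ab : a < b.
  apply/bigmax_ltP; split=> [|i ti].
    apply/lt_bigmin => [|j _]; first by lra.
    by have /andP[] := fb j.
  apply/lt_bigmin => [|j tj]; first by have /andP[] := fb i.
  exact: lt.
have a1 : -1 <= a by exact: bigmax_ge_id.
have b1 : b <= 1 by exact: bigmin_le_id.
have fa i : tau i -> f i x <= a by move=> ti; exact: le_bigmax_cond.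
have fb' i : ~~ tau i -> b <= f i x by move=> ti; exact: bigmin_le_cond.
exists ((a + b) / 2); split=> //=.
- by split=> //=; lra.
- move/carrier_graph => [i /= e]; have [/fa|/fb'] := boolP (tau i); lra.
- apply/funext => i; rewrite /above /=; have [/fa|/fb'] := boolP (tau i).
    by move=> h; apply/idP; lra.
  by move=> h; apply/negbTE; rewrite -leNgt; lra.
Qed.

(** Makes the projection of each cell to the horizontal axis an interval. *)
Definition pairwise_convex (J : set R) : Prop :=
  forall i j x y z, J x -> J z -> x <= y <= z -> f i x < f j x -> f i z < f j z ->
    f i y < f j y.

(** A cell is fibered in intervals over an interval. The color is constant on each vertical fiber,
    hence descends to the base, where it is locally constant. *)
Lemma cell_constant (J : set R) tau c p q :
  J `<=` [set x | -1 <= x <= 1] -> is_interval J -> pairwise_convex J ->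
  (forall p, cbox p -> ~ carrier M p -> \forall q \near p, cbox q -> c q = c p) ->
  cell J tau p -> cell J tau q -> c p = c q.
Proof.
move=> Jb Ji Jc lc.
have fib x y y' : cell J tau (x, y) -> cell J tau (x, y') -> c (x, y) = c (x, y').
  move=> h h'.
  apply: (@connected_constant _ _ [set y | cell J tau (x, y)] (fun y => c (x, y))) => //.
    apply/connected_intervalP => y1 y2 [Jx [/= xb y1b] n1 t1] [_ [/= _ y2b] n2 t2] z yz.
    have zb : cbox (x, z) by split=> //=; lra.
    have side i : f i x != z /\ above (x, z) i = tau i.
      move: (congr1 (fun F => F i) t1) (congr1 (fun F => F i) t2) (off_graph i n1) (off_graph i n2).
      rewrite /above /=; case: (tau i) => [h1 _ _ _|_ h2 _ f2].
        by have lt : f i x < z; [lra|rewrite lt lt_eqF].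
      have lt : z < f i x.
        have : y2 < f i x by rewrite lt_neqAle eq_sym f2 leNgt h2.
        by move=> ?; lra.
      by rewrite gt_eqF // ltNge ltW.
    split=> //; last by apply/funext => i; have [] := side i.
    by move/carrier_graph => [i /= /eqP]; have [/negPf ->] := side i.
  move=> y1 [/= J1 b1 n1 _].
  have cv : (fun z : R => (x, z)) @ y1 --> (x, y1).
    by apply: (@cvg_pair _ _ _ _ (nbhs x) (nbhs y1) _ _ _ (fun=> x) id); [exact: cvg_cst|exact: cvg_id].
  have H : \forall z \near y1, cbox (x, z) -> c (x, z) = c (x, y1) := cv _ (lc _ b1 n1).
  by apply: filterS H => z H [_ bz _ _]; exact: H.
pose I := [set x | exists y, cell J tau (x, y)].
(* Any choice of a point in each fiber will do; it need not be continuous. *)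
have [Y HY] : exists Y : R -> R, forall x, I x -> cell J tau (x, Y x).
  have /choice [Y HY] : forall x, exists y, I x -> cell J tau (x, y).
    by move=> x; have [[y h]|nI] := pselect (I x); [exists y|exists 0].
  by exists Y.
have base p' : cell J tau p' -> I p'.1 /\ c p' = c (p'.1, Y p'.1).
  move=> h; have hI : I p'.1 by exists p'.2; rewrite -surjective_pairing.
  split=> //; rewrite {1}[p']surjective_pairing; apply: fib; last exact: HY.
  by rewrite -surjective_pairing.
move=> /base [Ip ->] /base [Iq ->].
apply: (@connected_constant _ _ I (fun x => c (x, Y x))) => //.
  apply/connected_intervalP => x1 x2 [y1 [/= J1 b1 n1 t1]] [y2 [/= J2 b2 n2 t2]] x xx.
  have Jx : J x by apply: (Ji x1 x2).
  apply: cell_fiber => //; first exact: Jb.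
  move=> i j ti tj; apply: (Jc i j x1 x x2) => //.
    move: (congr1 (fun F => F i) t1) (congr1 (fun F => F j) t1) (off_graph j n1).
    by rewrite /above ti (negPf tj) /= => h /negbT; rewrite -leNgt => h' _; lra.
  move: (congr1 (fun F => F i) t2) (congr1 (fun F => F j) t2) (off_graph j n2).
  by rewrite /above ti (negPf tj) /= => h /negbT; rewrite -leNgt => h' _; lra.
move=> x Ix; have [/= Jx bx nx tx] := HY _ Ix.
have cv : (fun z : R => (z, Y x)) @ x --> (x, Y x).
  by apply: (@cvg_pair _ _ _ _ (nbhs x) (nbhs (Y x)) _ _ _ id (fun=> Y x)); [exact: cvg_id|exact: cvg_cst].
have H1 : \forall z \near x, cbox (z, Y x) -> c (z, Y x) = c (x, Y x) := cv _ (lc _ bx nx).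
have H2 : \forall z \near x, ~ carrier M (z, Y x) /\ above (z, Y x) = above (x, Y x) :=
  cv _ (near_cell nx).
apply: filterS2 H1 H2 => z H1 [H2 H3] Iz.
have [Jz bz _ _] := HY _ Iz.
have bz' : cbox (z, Y x) by split; [case: bz|case: bx].
(* From [(x, Y x)] one moves horizontally to [(z, Y x)], still in the cell, then inside the fiber to
   [(z, Y z)]. *)
rewrite -H1 //; apply: fib; first exact: HY.
by split=> //; rewrite H3.
Qed.

Lemma cell_colors (J : set R) c :
  J `<=` [set x | -1 <= x <= 1] -> is_interval J -> pairwise_convex J ->
  (forall p, cbox p -> ~ carrier M p -> \forall q \near p, cbox q -> c q = c p) ->
  exists C, forall q, J q.1 -> cbox q -> ~ carrier M q -> c q = C (above q).
Proof.
move=> Jb Ji Jc lc.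
have /choice [C HC] : forall tau, exists x, forall q, cell J tau q -> c q = x.
  move=> tau; have [[p hp]|ne] := pselect (exists p, cell J tau p).
    by exists (c p) => q hq; exact: (cell_constant Jb Ji Jc lc hq hp).
  (* Labels of empty cells receive an arbitrary color. *)
  by exists (c (0, 0)) => q hq; case: ne; exists q.
by exists C => q Jq qb nq; apply: HC.
Qed.

End Graph.

(** * The third moves *)

Lemma box_boundary (R : realType) (p : R * R) : closed_box p -> ~ open_box p ->
  [\/ p.1 = -1, p.1 = 1, p.2 = -1 | p.2 = 1].
Proof.
move=> [/andP[a b] /andP[c d]] np.
have [e1|n1] := eqVneq p.1 (-1); first exact: Or41.
have [e2|n2] := eqVneq p.1 1; first exact: Or42.
have [e3|n3] := eqVneq p.2 (-1); first exact: Or43.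
have [e4|n4] := eqVneq p.2 1; first exact: Or44.
by case: np; split; rewrite !lt_neqAle ?a ?b ?c ?d ?n2 ?n4 ?(eq_sym (-1)) ?n1 ?n3.
Qed.

Section Move3.
Variables (R : realType) (X : Type) (br vb : X -> X -> X -> X).
Hypothesis hX : virtual_tribracket br vb.
Variables (s : 'I_3 -> bool) (lab : 'I_3 -> 'I_3 -> mark).
Hypothesis labP : forall i j, i != j -> lab i j <> Plain /\ lab j i = flip (lab i j).
Implicit Types (p q : R * R) (c g : R * R -> X) (f : 'I_3 -> R -> R)
  (tau : 'I_3 -> bool) (C : ('I_3 -> bool) -> X).

Let i0 : 'I_3 := inord 0.
Let i1 : 'I_3 := inord 1.
Let i2 : 'I_3 := inord 2.

Hypothesis cons : consistent br vb (lab i0 i1) (lab i0 i2) (lab i1 i2).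

Local Notation obox := (@open_box R).
Local Notation cbox := (@closed_box R).
Local Notation M f := (graphs_picture f s lab).

Lemma ord3P (k : 'I_3) : [\/ k = i0, k = i1 | k = i2].
Proof.
case: k => -[|[|[|//]]] h; [apply: Or31|apply: Or32|apply: Or33];
  by apply: val_inj; rewrite /= inordK.
Qed.

Lemma ord3_neq : [/\ i0 != i1, i0 != i2 & i1 != i2].
Proof. by split; rewrite -val_eqE /= !inordK. Qed.

Definition vec (a b d : bool) (k : 'I_3) : bool :=
  if k == i0 then a else if k == i1 then b else d.

Lemma vecE tau : tau = vec (tau i0) (tau i1) (tau i2).
Proof.
have [n01 n02 n12] := ord3_neq.
apply/funext => k; rewrite /vec; case: (ord3P k) => ->; rewrite ?eqxx //.
  by rewrite eq_sym (negPf n01).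
by rewrite eq_sym (negPf n02) eq_sym (negPf n12).
Qed.

Lemma vec0 a b d : vec a b d i0 = a. Proof. by rewrite /vec eqxx. Qed.
Lemma vec1 a b d : vec a b d i1 = b.
Proof. by have [n01 _ _] := ord3_neq; rewrite /vec eq_sym (negPf n01) eqxx. Qed.
Lemma vec2 a b d : vec a b d i2 = d.
Proof. by have [_ n02 n12] := ord3_neq; rewrite /vec eq_sym (negPf n02) eq_sym (negPf n12). Qed.

(* [bb] tells whether the triangle bounded by the strands lies above the
   strand 0. *)
Record triangle f (bb : bool) : Prop := Triangle {
  tri_box : forall i, crossing_box (f i);
  tri_convex : pairwise_convex f [set x | -1 <= x <= 1];
  tri_left : f i0 (-1) < f i1 (-1) < f i2 (-1);
  tri_right : f i2 1 < f i1 1 < f i0 1;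
  tri_meet01 : exists p, [/\ obox p, f i0 p.1 = p.2 & f i1 p.1 = p.2];
  tri_meet02 : exists p, [/\ obox p, f i0 p.1 = p.2 & f i2 p.1 = p.2];
  tri_meet12 : exists p, [/\ obox p, f i1 p.1 = p.2 & f i2 p.1 = p.2];
  tri_01 : forall p, cbox p -> f i0 p.1 = p.2 -> f i1 p.1 = p.2 ->
    f i2 p.1 != p.2 /\ above f p i2 = bb;
  tri_02 : forall p, cbox p -> f i0 p.1 = p.2 -> f i2 p.1 = p.2 ->
    f i1 p.1 != p.2 /\ above f p i1 = ~~ bb;
  tri_12 : forall p, cbox p -> f i1 p.1 = p.2 -> f i2 p.1 = p.2 ->
    f i0 p.1 != p.2 /\ above f p i0 = bb;
  tri_empty : forall p, cbox p -> ~ carrier (M f) p ->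
    above f p <> vec (~~ bb) bb (~~ bb)
}.

Section Triangle.
Variables (f : 'I_3 -> R -> R) (bb : bool).
Hypothesis T : triangle f bb.

Let hf := tri_box T.

Lemma tri_crossing p i j : cbox p -> i != j -> f i p.1 = p.2 -> f j p.1 = p.2 ->
  crossing_at f p i j.
Proof.
move=> pb ij fi fj; split=> // k ki kj.
move: ij ki kj fi fj; case: (ord3P i) => ->; case: (ord3P j) => ->; rewrite ?eqxx // => _;
case: (ord3P k) => ->; rewrite ?eqxx // => _ _ fi fj;
first [by have [] := tri_01 T pb fi fj|by have [] := tri_01 T pb fj fi
 |by have [] := tri_02 T pb fi fj|by have [] := tri_02 T pb fj fi
 |by have [] := tri_12 T pb fi fj|by have [] := tri_12 T pb fj fi].
Qed.

Lemma tri_inside : crossings_inside (M f).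
Proof.
apply: crossings_inside_graph => // i j ij.
have /andP[l1 l2] := tri_left T; have /andP[r1 r2] := tri_right T.
move: ij; case: (ord3P i) => ->; case: (ord3P j) => ->; rewrite ?eqxx // => _;
  by split; apply/eqP; lra.
Qed.

(** Reindexes cells from above or below to left or right of each strand, which absorbs the
    directions of the strands. *)
Definition cube_of C (a b d : bool) : X := C (vec (a (+) s i0) (b (+) s i1) (d (+) s i2)).

Definition colored c C : Prop := forall q, cbox q -> ~ carrier (M f) q -> c q = C (above f q).

Lemma tri_corner01 p a b : cbox p -> f i0 p.1 = p.2 -> f i1 p.1 = p.2 ->
  corner f s p i0 i1 a b = vec (a (+) s i0) (b (+) s i1) bb.
Proof.
move=> pb f0 f1; have [_ e] := tri_01 T pb f0 f1; have [n01 n02 n12] := ord3_neq.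
rewrite [LHS]vecE /corner !eqxx (eq_sym i1) (negPf n01) (eq_sym i2) (negPf n02).
by rewrite (eq_sym i2) (negPf n12) e.
Qed.

Lemma tri_corner02 p a b : cbox p -> f i0 p.1 = p.2 -> f i2 p.1 = p.2 ->
  corner f s p i0 i2 a b = vec (a (+) s i0) (~~ bb) (b (+) s i2).
Proof.
move=> pb f0 f1; have [_ e] := tri_02 T pb f0 f1; have [n01 n02 n12] := ord3_neq.
rewrite [LHS]vecE /corner !eqxx (eq_sym i1) (negPf n01) (eq_sym i2) (negPf n02).
by rewrite (negPf n12) e.
Qed.

Lemma tri_corner12 p a b : cbox p -> f i1 p.1 = p.2 -> f i2 p.1 = p.2 ->
  corner f s p i1 i2 a b = vec bb (a (+) s i1) (b (+) s i2).
Proof.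
move=> pb f0 f1; have [_ e] := tri_12 T pb f0 f1; have [n01 n02 n12] := ord3_neq.
rewrite [LHS]vecE /corner !eqxx (negPf n01) (negPf n02) (eq_sym i2) (negPf n12).
by rewrite e.
Qed.

Lemma colored_near c C p : colored c C -> obox p ->
  \forall q \near p, ~ carrier (M f) q -> c q = C (above f q).
Proof.
move=> cC po; near=> q => nq; apply: cC => //; apply: open_boxW.
by near: q; exact: near_open_box.
Unshelve. all: by end_near. Qed.

(** Each crossing is a corner of the inner triangle, so its face contains the vertex of the cube
    that labels the triangle. *)
Lemma tri_faces c C : transverse_in_box f s lab -> box_coloring br vb (M f) c -> colored c C ->
  faces br vb (lab i0 i1) (lab i0 i2) (lab i1 i2) (cube_of C)
    (bb (+) s i0) (~~ bb (+) s i1) (bb (+) s i2).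
Proof.
move=> tr [_ ok] cC; have [n01 n02 n12] := ord3_neq.
have get i j p : i != j -> obox p -> f i p.1 = p.2 -> f j p.1 = p.2 ->
    face br vb (lab i j) (fun a b => C (corner f s p i j a b)).
  move=> ij po fi fj; have cij := tri_crossing (open_boxW po) ij fi fj.
  apply: (crossing_face hX hf labP cij _ (colored_near cC po) (ok p po)).
  exact: (crossing_slopes hf labP tr (open_boxW po) cij).
split.
- have [p [po f0 f1]] := tri_meet01 T.
  have := get _ _ _ n01 po f0 f1; congr (face _ _ _ _).
  apply/funext => a; apply/funext => b.
  by rewrite (tri_corner01 _ _ (open_boxW po)) // /cube_of addbK.
- have [p [po f0 f1]] := tri_meet02 T.
  have := get _ _ _ n02 po f0 f1; congr (face _ _ _ _).
  apply/funext => a; apply/funext => b.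
  by rewrite (tri_corner02 _ _ (open_boxW po)) // /cube_of addbK.
- have [p [po f0 f1]] := tri_meet12 T.
  have := get _ _ _ n12 po f0 f1; congr (face _ _ _ _).
  apply/funext => a; apply/funext => b.
  by rewrite (tri_corner12 _ _ (open_boxW po)) // /cube_of addbK.
Qed.

Lemma tri_coloring C :
  faces br vb (lab i0 i1) (lab i0 i2) (lab i1 i2) (cube_of C)
    (bb (+) s i0) (~~ bb (+) s i1) (bb (+) s i2) ->
  box_coloring br vb (M f) (fun q => C (above f q)).
Proof.
move=> [f01 f02 f12].
have H p (i j : 'I_3) : (i < j)%N -> obox p -> f i p.1 = p.2 -> f j p.1 = p.2 ->
    face br vb (lab i j) (fun a b => C (corner f s p i j a b)).
  move=> + po; have pb := open_boxW po.
  case: (ord3P i) => ->; case: (ord3P j) => ->; rewrite /i0 /i1 /i2 !inordK // => _ fi fj.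
  - move: f01; congr (face _ _ _ _); apply/funext => a; apply/funext => b.
    by rewrite tri_corner01 // /cube_of addbK.
  - move: f02; congr (face _ _ _ _); apply/funext => a; apply/funext => b.
    by rewrite tri_corner02 // /cube_of addbK.
  - move: f12; congr (face _ _ _ _); apply/funext => a; apply/funext => b.
    by rewrite tri_corner12 // /cube_of addbK.
apply: box_coloring_graph => //; first by move=> p i j pb; exact: tri_crossing.
move=> p i j po [ij fi fj _]; have [lt|le] := ltnP i j; first exact: H.
have ji : (j < i)%N by rewrite ltn_neqAle le andbT eq_sym.
rewrite (proj2 (labP (i := j) (j := i) _)); last by rewrite eq_sym.
have := face_flip hX (H _ _ _ ji po fj fi).
congr (face _ _ _ _); apply/funext => a; apply/funext => b.
by rewrite corner_sym // eq_sym.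
Qed.

(** Of the two alternating labels one is the inner triangle and the other is an empty cell; the two
    pictures of the move exchange these roles. The other six cells reach the frame. *)
Definition alternating tau : bool := (tau i0 != tau i1) && (tau i1 != tau i2).

Lemma boundary_not_alternating p : cbox p -> ~ obox p -> ~ carrier (M f) p ->
  ~~ alternating (above f p).
Proof.
move=> pb po np; rewrite /alternating /above.
have /andP[l1 l2] := tri_left T; have /andP[r1 r2] := tri_right T.
have bd i : -1 < f i p.1 < 1 by apply: (proj2 (hf i)); case: pb.
have := (bd i0, bd i1, bd i2) => -[[/andP[? ?] /andP[? ?]] /andP[? ?]].
case: (box_boundary pb po) => e; rewrite e.
- by case: (ltP (f i0 (-1))); case: (ltP (f i1 (-1))); case: (ltP (f i2 (-1))) => // *; lra.
- by case: (ltP (f i0 1)); case: (ltP (f i1 1)); case: (ltP (f i2 1)) => // *; lra.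
- by rewrite !ltNge !ltW.
- have t i : f i p.1 < 1 by have /andP[] := bd i.
  by rewrite !t.
Qed.

Lemma not_alternating_boundary tau : ~~ alternating tau ->
  exists p, [/\ cbox p, ~ obox p, ~ carrier (M f) p & above f p = tau].
Proof.
move=> nalt.
have /andP[l1 l2] := tri_left T; have /andP[r1 r2] := tri_right T.
(* Labels that decrease with the strand number occur on the left edge, where strand 0 is lowest, and
   those that increase on the right edge. *)
have [x [xb ex]] : exists x : R, (x = -1 \/ x = 1) /\
    forall i j, tau i -> ~~ tau j -> f i x < f j x.
  move: nalt; rewrite /alternating.
  case e0 : (tau i0); case e1 : (tau i1); case e2 : (tau i2) => // _;
  first [exists (-1); split; [by left|by move=> i j; case: (ord3P i) => ->;
    case: (ord3P j) => ->; rewrite ?e0 ?e1 ?e2 // => _ _; lra]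
  |exists 1; split; [by right|by move=> i j; case: (ord3P i) => ->;
    case: (ord3P j) => ->; rewrite ?e0 ?e1 ?e2 // => _ _; lra]].
have xb' : -1 <= x <= 1 by case: xb => ->; lra.
have [y [_ yb ny e]] := @cell_fiber _ 3 f s lab hf setT tau x I xb' ex.
exists (x, y); split=> //.
by move=> [/= /andP[h1 h2] _]; case: xb => e'; move: h1 h2; rewrite e' ltxx.
Qed.

Lemma tri_colored c : box_coloring br vb (M f) c -> exists C, colored c C.
Proof.
move=> [lc _].
have [||C HC] := @cell_colors R X 3 f s lab hf [set x | -1 <= x <= 1] c _ _ (tri_convex T) lc.
- by [].
- by move=> x y /= hx hy z hz; lra.
exists C => q qb nq; apply: HC => //; by case: qb.
Qed.

(** Six colors are visible on the frame. That of the triangle is determined at one of its corners by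
    the three other colors there. *)
Lemma tri_rigid : transverse_in_box f s lab -> box_rigid br vb (M f).
Proof.
move=> tr c c' bc bc' cc'.
have [C hC] := tri_colored bc; have [C' hC'] := tri_colored bc'.
have e tau : ~~ alternating tau -> C tau = C' tau.
  move=> /not_alternating_boundary [p [pb po np <-]].
  by rewrite -hC // -hC' // cc'.
have [F _ _] := tri_faces tr bc hC; have [F' _ _] := tri_faces tr bc' hC'.
have ec : C (vec bb (~~ bb) bb) = C' (vec bb (~~ bb) bb).
  have := face_inj hX (a := bb (+) s i0) (b := ~~ bb (+) s i1) (proj1 (labP _)) F F'.
  rewrite /cube_of !addbK; apply; first by have [] := ord3_neq.
  move=> a b ab; apply: e; rewrite /alternating vec0 vec1 vec2.
  apply/negP => /andP[h1 h2]; apply: ab.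
  have e2 : b (+) s i1 = ~~ bb by case: (b (+) _) h2; case: (bb).
  have e1 : a (+) s i0 = bb by move: h1; rewrite e2; case: (a (+) _); case: (bb).
  by rewrite -e2 -e1 !addbK.
move=> p pb np; rewrite hC // hC' //.
have [alt|] := boolP (alternating (above f p)); last exact: e.
suff -> : above f p = vec bb (~~ bb) bb by [].
have := tri_empty T pb np; move: alt; rewrite [above f p]vecE /alternating vec0 vec1 vec2.
case: (above f p i0); case: (above f p i1); case: (above f p i2); case: (bb) => // _ ne;
  by case: ne.
Qed.

End Triangle.

(** Agreement of two pictures on an edge only gives equal sets of heights; their order tells which
    strand is which. *)
Lemma sorted3_eq (a0 a1 a2 b0 b1 b2 : R) : a0 < a1 < a2 -> b0 < b1 < b2 ->
  (forall y, [\/ a0 = y, a1 = y | a2 = y] <-> [\/ b0 = y, b1 = y | b2 = y]) ->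
  [/\ a0 = b0, a1 = b1 & a2 = b2].
Proof.
move=> /andP[? ?] /andP[? ?] H.
have [H0 H1 H2] : [/\ [\/ b0 = a0, b1 = a0 | b2 = a0], [\/ b0 = a1, b1 = a1 | b2 = a1]
    & [\/ b0 = a2, b1 = a2 | b2 = a2]].
  by split; apply/H; [apply: Or31|apply: Or32|apply: Or33].
case: H0 => ?; case: H1 => ?; case: H2 => ?; split; lra.
Qed.

Lemma tri_boundary f f' bb bb' p : triangle f bb -> triangle f' bb' ->
  same_picture_on (cbox `\` obox) (M f) (M f') -> cbox p -> ~ obox p ->
  above f p = above f' p.
Proof.
move=> T T' same pb po; apply/funext => i.
have bd : -1 < f i p.1 < 1 by apply: (proj2 (tri_box T i)); case: pb.
have bd' : -1 < f' i p.1 < 1 by apply: (proj2 (tri_box T' i)); case: pb.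
have H x : x = -1 \/ x = 1 -> forall y,
    [\/ f i0 x = y, f i1 x = y | f i2 x = y] <-> [\/ f' i0 x = y, f' i1 x = y | f' i2 x = y].
  move=> ex y.
  have xb : -1 <= x <= 1 by case: ex => ->; lra.
  have no : ~ obox (x, y) by move=> [/= ? _]; case: ex => e; lra.
  have carr (g : 'I_3 -> R -> R) : 
      (carrier (M g) (x, y) <-> [\/ g i0 x = y, g i1 x = y | g i2 x = y]).
    split.
      move=> /(carrier_graph g s lab _) [k /=].
      by case: (ord3P k) => ->; [apply: Or31|apply: Or32|apply: Or33].
    by move=> [e|e|e]; apply/(carrier_graph g s lab _); [exists i0|exists i1|exists i2].
  have [yb|yb] := pselect (cbox (x, y)).
    apply: (iff_trans (iff_sym (carr f))).
    apply: (iff_trans _ (carr f')).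
    exact: (same_carrier same (p := (x, y))).
  have nog (g : 'I_3 -> R -> R) : (forall i, crossing_box (g i)) -> ~ [\/ g i0 x = y, g i1 x = y | g i2 x = y].
    move=> hg h; apply: yb; split=> //=.
    by case: h => <-; [have [_ /(_ _ xb)] := hg i0|have [_ /(_ _ xb)] := hg i1
      |have [_ /(_ _ xb)] := hg i2]; lra.
  by split=> h; [have := nog _ (tri_box T) h|have := nog _ (tri_box T') h].
have endl : forall k, f k (-1) = f' k (-1).
  have [e0 e1 e2] := sorted3_eq (tri_left T) (tri_left T') (H (-1) (or_introl erefl)).
  by move=> k; case: (ord3P k) => ->.
have endr : forall k, f k 1 = f' k 1.
  have [|e0 e1 e2] := @sorted3_eq (f i2 1) (f i1 1) (f i0 1) (f' i2 1) (f' i1 1) (f' i0 1) (tri_right T) (tri_right T').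
    move=> y; have h := H 1 (or_intror erefl) y.
    split=> h'.
      by have /h : [\/ f i0 1 = y, f i1 1 = y | f i2 1 = y];
        [case: h' => h'; [exact: Or33|exact: Or32|exact: Or31]
        |move=> [?|?|?]; [exact: Or33|exact: Or32|exact: Or31]].
    by have /h : [\/ f' i0 1 = y, f' i1 1 = y | f' i2 1 = y];
        [case: h' => h'; [exact: Or33|exact: Or32|exact: Or31]
        |move=> [?|?|?]; [exact: Or33|exact: Or32|exact: Or31]].
  by move=> k; case: (ord3P k) => ->.
rewrite /above; case: (box_boundary pb po) => e.
- by rewrite e endl.
- by rewrite e endr.
- by rewrite e !ltNge; congr (~~ _); transitivity true; [|symmetry]; lra.
- by rewrite e; transitivity true; [|symmetry]; lra.
Qed.

(** Only the color at the vertex opposite the old triangle changes. It labels the triangle of the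
    new picture, and the consistency of the cube provides a value that suits its three corners. *)
Lemma tri_transfer f f' bb : triangle f bb -> triangle f' (~~ bb) ->
  transverse_in_box f s lab -> same_picture_on (cbox `\` obox) (M f) (M f') ->
  box_transfer br vb (M f) (M f').
Proof.
move=> T T' tr same c bc.
have [C hC] := tri_colored T bc.
have [z hz] := cons (tri_faces T tr bc hC).
pose v0 := bb (+) s i0; pose v1 := ~~ bb (+) s i1; pose v2 := bb (+) s i2.
pose C' tau := update3 (cube_of C) (~~ v0) (~~ v1) (~~ v2) z
  (tau i0 (+) s i0) (tau i1 (+) s i1) (tau i2 (+) s i2).
have eC' : cube_of C' = update3 (cube_of C) (~~ v0) (~~ v1) (~~ v2) z.
  apply/funext => a; apply/funext => b; apply/funext => d.
  by rewrite /cube_of /C' vec0 vec1 vec2 !addbK.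
exists (fun q => C' (above f' q)); split.
  apply: (tri_coloring T'); rewrite eC'.
  by rewrite (addNb bb (s i0)) (addNb (~~ bb) (s i1)) (addNb bb (s i2)).
move=> p pb po np.
have nalt := boundary_not_alternating T pb po np.
rewrite -(tri_boundary T T' same pb po) hC // /C' /update3.
case: ifPn => [/and3P[/eqP e0 /eqP e1 /eqP e2]|_]; last by rewrite /cube_of !addbK -vecE.
exfalso; move/negP: nalt; apply; rewrite /alternating.
move: e0 e1 e2; rewrite /v0 /v1 /v2 -!addNb.
by move=> /addIb -> /addIb -> /addIb ->; case: (bb).
Qed.

End Move3.

(** * From the order of the crossings to the position of the triangle *)

Section PairwiseCross.
Variables (R : realType) (s : 'I_3 -> bool) (lab : 'I_3 -> 'I_3 -> mark).
Variables (f : 'I_3 -> R -> R) (x : 'I_3 -> 'I_3 -> R).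
Hypotheses (hf : forall i, crossing_box (f i)) (hx : pairwise_cross f x).

Lemma cross_lt (i j : 'I_3) t : (i < j)%N -> -1 <= t <= 1 -> (f i t < f j t) = (t < x i j).
Proof. by move=> ij tb; rewrite -subr_gt0 -sgr_gt0 (proj2 (hx ij) t tb) sgr_gt0 subr_gt0. Qed.

Lemma cross_gt (i j : 'I_3) t : (i < j)%N -> -1 <= t <= 1 -> (f j t < f i t) = (x i j < t).
Proof. by move=> ij tb; rewrite -subr_lt0 -sgr_lt0 (proj2 (hx ij) t tb) sgr_lt0 subr_lt0. Qed.

Lemma cross_eq (i j : 'I_3) t : (i < j)%N -> -1 <= t <= 1 -> f i t = f j t -> t = x i j.
Proof.
move=> ij tb e; have := cross_lt ij tb; have := cross_gt ij tb.
rewrite e ltxx => /esym/negbT h /esym/negbT h'; apply/eqP.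
by rewrite eq_le leNgt h leNgt h'.
Qed.

Lemma cross_at (i j : 'I_3) : (i < j)%N -> f i (x i j) = f j (x i j).
Proof.
move=> ij; have xb : -1 <= x i j <= 1 by have [/andP[? ?] _] := hx ij; rewrite !ltW.
by apply/eqP; rewrite eq_le leNgt (cross_gt ij xb) ltxx /= leNgt (cross_lt ij xb) ltxx.
Qed.

Let i0 : 'I_3 := inord 0.
Let i1 : 'I_3 := inord 1.
Let i2 : 'I_3 := inord 2.

Let l01 : (i0 < i1)%N. Proof. by rewrite !inordK. Qed.
Let l02 : (i0 < i2)%N. Proof. by rewrite !inordK. Qed.
Let l12 : (i1 < i2)%N. Proof. by rewrite !inordK. Qed.

Lemma cross_meet (i j : 'I_3) : (i < j)%N ->
  exists p, [/\ open_box p, f i p.1 = p.2 & f j p.1 = p.2].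
Proof.
move=> ij; exists (x i j, f i (x i j)); split=> //=; last by rewrite cross_at.
have [xb _] := hx ij; split=> //=; apply: (proj2 (hf i)).
by case/andP: xb => ? ?; rewrite !ltW.
Qed.

Lemma cross_convex : pairwise_convex f [set x | -1 <= x <= 1].
Proof.
move=> i j a b d /= ha hd hb.
have bb : -1 <= b <= 1 by lra.
have [lt|gt|e] := ltngtP i j.
- by rewrite !(cross_lt lt) //; lra.
- by rewrite !(cross_gt gt) //; lra.
- by rewrite (val_inj e) ltxx.
Qed.

Lemma triangle_cross (bb : bool) :
  (if bb then x i1 i2 < x i0 i2 < x i0 i1 else x i0 i1 < x i0 i2 < x i1 i2) ->
  triangle s lab f bb.
Proof.
move=> hb.
have [/andP[a01 b01] _] := hx l01; have [/andP[a02 b02] _] := hx l02.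
have [/andP[a12 b12] _] := hx l12.
have c1 : -1 <= (1 : R) <= 1 by lra.
have cN1 : -1 <= (-1 : R) <= 1 by lra.
split=> //.
- exact: cross_convex.
- by rewrite !cross_lt // a01.
- by rewrite !cross_gt // b12.
- exact: cross_meet.
- exact: cross_meet.
- exact: cross_meet.
- move=> p [pb _] f0 f1.
  have e : p.1 = x i0 i1 by apply: cross_eq => //; rewrite f0 f1.
  have g := cross_gt l02 pb; have l := cross_lt l02 pb; rewrite f0 e in g l.
  rewrite /above e; case: bb hb => /andP[h1 h2].
    by rewrite h2 in g; rewrite g lt_eqF.
  by rewrite h1 in l; rewrite gt_eqF // ltNge ltW.
- move=> p [pb _] f0 f1.
  have e : p.1 = x i0 i2 by apply: cross_eq => //; rewrite f0 f1.
  have g := cross_gt l01 pb; have l := cross_lt l01 pb; rewrite f0 e in g l.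
  rewrite /above e; case: bb hb => /andP[h1 h2] /=.
    by rewrite h2 in l; rewrite gt_eqF // ltNge ltW.
  by rewrite h1 in g; rewrite g lt_eqF.
- move=> p [pb _] f0 f1.
  have e : p.1 = x i1 i2 by apply: cross_eq => //; rewrite f0 f1.
  have g := cross_gt l01 pb; have l := cross_lt l01 pb; rewrite f0 e in g l.
  rewrite /above e; case: bb hb => /andP[h1 h2] /=.
    have h := lt_trans h1 h2; rewrite h in l.
    by rewrite l lt_eqF.
  have h := lt_trans h1 h2; rewrite h in g.
  by rewrite gt_eqF // ltNge ltW.
(* A point of the missing cell would lie beyond [x i0 i1] and short of [x i1 i2], or the reverse,
   against their order. *)
- move=> p [pb _] np e.
  have := congr1 (fun F => F i0) e; have := congr1 (fun F => F i1) e.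
  have := congr1 (fun F => F i2) e; rewrite vec0 vec1 vec2 /above.
  have g01 := cross_gt l01 pb; have l01' := cross_lt l01 pb.
  have g12 := cross_gt l12 pb; have l12' := cross_lt l12 pb.
  have n0 := off_graph i0 np; have n1 := off_graph i1 np; have n2 := off_graph i2 np.
  case: bb hb {e} => /andP[h1 h2] /=.
    move=> /negbT; rewrite -leNgt => h3 h4 /negbT; rewrite -leNgt => h5.
    have : x i0 i1 < p.1 by rewrite -g01; lra.
    have : p.1 < x i1 i2 by rewrite -l12'; lra.
    lra.
  move=> h3 /negbT; rewrite -leNgt => h4 h5.
  have : p.1 < x i0 i1 by rewrite -l01'; lra.
  have : x i1 i2 < p.1 by rewrite -g12; lra.
  lra.
Qed.
End PairwiseCross.

(** * The second moves *)

Section Move2.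
Variables (R : realType) (X : Type) (br vb : X -> X -> X -> X).
Hypothesis hX : virtual_tribracket br vb.
Variables (s : 'I_2 -> bool) (lab : 'I_2 -> 'I_2 -> mark).
Hypothesis labP : forall i j, i != j -> lab i j <> Plain /\ lab j i = flip (lab i j).
Implicit Types (p q : R * R) (c g : R * R -> X) (tau : 'I_2 -> bool) (C : ('I_2 -> bool) -> X).

Let i0 : 'I_2 := ord0.
Let i1 : 'I_2 := ord_max.

Local Notation obox := (@open_box R).
Local Notation cbox := (@closed_box R).
Local Notation M f := (graphs_picture f s lab).

Lemma ord2P (k : 'I_2) : k = i0 \/ k = i1.
Proof. by case: k => -[|[|//]] h; [left|right]; apply: val_inj. Qed.

Definition pair2 (a b : bool) (k : 'I_2) : bool := if k == i0 then a else b.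

Lemma pair2E tau : tau = pair2 (tau i0) (tau i1).
Proof. by apply/funext => k; case: (ord2P k) => ->. Qed.

Lemma corner2 (f : 'I_2 -> R -> R) p a b :
  corner f s p i0 i1 a b = pair2 (a (+) s i0) (b (+) s i1).
Proof. by rewrite [LHS]pair2E. Qed.

Definition square_of C (a b : bool) : X := C (pair2 (a (+) s i0) (b (+) s i1)).

Lemma crossing_at2 (f : 'I_2 -> R -> R) p i j :
  i != j -> f i p.1 = p.2 -> f j p.1 = p.2 -> crossing_at f p i j.
Proof.
move=> ij fi fj; split=> // k; move: ij.
by case: (ord2P i) => ->; case: (ord2P j) => ->; case: (ord2P k) => ->.
Qed.

(** * Two disjoint strands *)

Section Apart.
Variable f : 'I_2 -> R -> R.
Hypotheses (hf : forall i, crossing_box (f i))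
  (f01 : forall x : R, -1 <= x <= 1 -> f i0 x < f i1 x).

Lemma apart_inside : crossings_inside (M f).
Proof.
apply: crossings_inside_graph => // i j.
have c1 : -1 <= (1 : R) <= 1 by lra.
have cN1 : -1 <= (-1 : R) <= 1 by lra.
by case: (ord2P i) => ->; case: (ord2P j) => -> // _;
  rewrite ?(lt_eqF (f01 c1)) ?(lt_eqF (f01 cN1)) ?(gt_eqF (f01 c1)) ?(gt_eqF (f01 cN1)).
Qed.

Lemma apart_coloring C : box_coloring br vb (M f) (fun q => C (above f q)).
Proof.
apply: box_coloring_graph => //; first by move=> p i j _; exact: crossing_at2.
move=> p i j [pb _] [ij fi fj _]; exfalso.
have /f01 : -1 <= p.1 <= 1 by case/andP: pb => ? ?; rewrite !ltW.
by move: ij fi fj; case: (ord2P i) => ->; case: (ord2P j) => -> // _ -> ->; rewrite ltxx.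
Qed.

Lemma apart_colored c : box_coloring br vb (M f) c ->
  exists C, forall q, cbox q -> ~ carrier (M f) q -> c q = C (above f q).
Proof.
move=> [lc _].
have [|||C HC] := @cell_colors R X 2 f s lab hf [set x | -1 <= x <= 1] c _ _ _ lc.
- by [].
- by move=> x y /= hx hy z hz; lra.
- move=> i j x y z /= hx hz hy.
  have /f01 : -1 <= y <= 1 by lra.
  have := f01 hx; have := f01 hz.
  by case: (ord2P i) => ->; case: (ord2P j) => -> *; lra.
by exists C => q qb nq; apply: HC => //; case: qb.
Qed.

Lemma apart_boundary tau : (tau i1 -> tau i0) ->
  exists p, [/\ cbox p, ~ obox p, ~ carrier (M f) p & above f p = tau].
Proof.
move=> t10.
have cN1 : -1 <= (-1 : R) <= 1 by lra.
have [|y [_ yb ny e]] := @cell_fiber _ 2 f s lab hf setT tau (-1) I cN1.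
  move=> i j; case: (ord2P i) => ->; case: (ord2P j) => ->.
  - by move=> ->.
  - by move=> _ _; exact: f01.
  - by move=> /t10 ->.
  - by move=> ->.
exists (-1, y); split=> //.
by move=> [/= /andP[]]; rewrite ltxx.
Qed.

Lemma apart_rigid : box_rigid br vb (M f).
Proof.
move=> c c' bc bc' cc'.
have [C hC] := apart_colored bc; have [C' hC'] := apart_colored bc'.
move=> p pb np; rewrite hC // hC' //.
have [|q [qb qo nq <-]] := @apart_boundary (above f p).
  by rewrite /above => h; apply: lt_trans h; apply: f01; case: pb.
by rewrite -hC // -hC' // cc'.
Qed.

End Apart.

(** * Two strands bounding a bigon *)

Section Bigon.
Variables (f : 'I_2 -> R -> R) (x1 x2 : R).
Hypotheses (hf : forall i, crossing_box (f i)) (x1m : -1 < x1) (x12 : x1 < x2) (x2M : x2 < 1)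
  (hsg : forall x : R, -1 <= x <= 1 -> Num.sg (f i1 x - f i0 x) = Num.sg ((x - x1) * (x - x2))).

Lemma bigon_lt (x : R) : -1 <= x <= 1 -> (f i0 x < f i1 x) = (x < x1) || (x2 < x).
Proof.
have [h1m [h12 h2M]] := (x1m, (x12, x2M)).
move=> xb; rewrite -subr_gt0 -sgr_gt0 hsg // sgr_gt0.
apply/idP/orP => [h|[h|h]].
- have [|h1] := ltP x x1; first by left.
  have [|h2] := ltP x2 x; first by right.
  by exfalso; have : (x - x1) * (x2 - x) >= 0; [rewrite mulr_ge0 // subr_ge0; lra|lra].
- have a : x - x1 < 0 by lra.
  have b : x - x2 < 0 by lra.
  by rewrite nmulr_rgt0.
- have a : 0 < x - x1 by lra.
  have b : 0 < x - x2 by lra.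
  by rewrite pmulr_rgt0.
Qed.

Lemma bigon_gt (x : R) : -1 <= x <= 1 -> (f i1 x < f i0 x) = (x1 < x < x2).
Proof.
have [h1m [h12 h2M]] := (x1m, (x12, x2M)).
move=> xb; rewrite -subr_lt0 -sgr_lt0 hsg // sgr_lt0.
apply/idP/andP => [h|[h1 h2]]; last first.
  have a : 0 < x - x1 by lra.
  have b : x - x2 < 0 by lra.
  by rewrite pmulr_rlt0.
have [h1|h1] := ltP x1 x; have [h2|h2] := ltP x x2 => //; exfalso.
- by have : (x - x1) * (x - x2) >= 0; [rewrite mulr_ge0 // subr_ge0; lra|lra].
- by have : (x1 - x) * (x2 - x) >= 0; [rewrite mulr_ge0 // subr_ge0; lra|lra].
- lra.
Qed.

Lemma bigon_eq (x : R) : -1 <= x <= 1 -> x = x1 \/ x = x2 -> f i0 x = f i1 x.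
Proof.
have [h1m [h12 h2M]] := (x1m, (x12, x2M)).
move=> xb ex; apply/eqP; rewrite eq_le leNgt bigon_gt // leNgt bigon_lt //.
by apply/andP; split; apply/negP; case: ex => ->; lra.
Qed.

Lemma bigon_inside : crossings_inside (M f).
Proof.
have [h1m [h12 h2M]] := (x1m, (x12, x2M)).
apply: crossings_inside_graph => // i j.
have c1 : f i0 1 < f i1 1 by rewrite bigon_lt ?x2M ?orbT //; lra.
have cN1 : f i0 (-1) < f i1 (-1) by rewrite bigon_lt ?x1m //; lra.
by case: (ord2P i) => ->; case: (ord2P j) => -> // _;
  rewrite ?(lt_eqF c1) ?(lt_eqF cN1) ?(gt_eqF c1) ?(gt_eqF cN1).
Qed.

(** With two strands a face has no further index, so both crossings impose the same relation on
    [C]. *)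
Lemma bigon_coloring C : face br vb (lab i0 i1) (square_of C) ->
  box_coloring br vb (M f) (fun q => C (above f q)).
Proof.
move=> hC; apply: box_coloring_graph => //; first by move=> p i j _; exact: crossing_at2.
move=> p i j _ [ij _ _ _].
have sq : square_of C = fun a b => C (corner f s p i0 i1 a b).
  by apply/funext => a; apply/funext => b; rewrite corner2.
move: ij; case: (ord2P i) => ->; case: (ord2P j) => -> // _; first by rewrite -sq.
rewrite (proj2 (labP (i := i0) (j := i1) _)) //.
have := face_flip hX hC; congr (face _ _ _ _).
by rewrite sq; apply/funext => a; apply/funext => b; rewrite corner_sym.
Qed.

(** The cell above strand 0 and below strand 1 is disconnected by the bigon, so [cell_colors] does
    not apply to the whole box. That its two pieces have the same color is the content of the second
    move. *)
Lemma bigon_colored c : transverse_in_box f s lab -> box_coloring br vb (M f) c ->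
  exists C, (forall q, cbox q -> ~ carrier (M f) q -> c q = C (above f q)) /\
    face br vb (lab i0 i1) (square_of C).
Proof.
have [h1m [h12 h2M]] := (x1m, (x12, x2M)).
move=> tr [lc ok].
(* Each interval contains one crossing and one piece of the disconnected cell; they overlap over the
   bigon. *)
pose J1 := [set x : R | -1 <= x < x2]; pose J2 := [set x : R | x1 < x <= 1].
have [|||C1 HC1] := @cell_colors R X 2 f s lab hf J1 c _ _ _ lc.
- by move=> x; rewrite /J1 /= => hx; lra.
- by move=> x y; rewrite /J1 /= => hx hy z hz; lra.
- move=> i j x y z; rewrite /J1 /= => hx hz hy.
  have xb : -1 <= x <= 1 by lra.
  have yb : -1 <= y <= 1 by lra.
  have zb : -1 <= z <= 1 by lra.
  case: (ord2P i) => ->; case: (ord2P j) => ->; rewrite ?ltxx // ?bigon_lt ?bigon_gt //; lra.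
have [|||C2 HC2] := @cell_colors R X 2 f s lab hf J2 c _ _ _ lc.
- by move=> x; rewrite /J2 /= => hx; lra.
- by move=> x y; rewrite /J2 /= => hx hy z hz; lra.
- move=> i j x y z; rewrite /J2 /= => hx hz hy.
  have xb : -1 <= x <= 1 by lra.
  have yb : -1 <= y <= 1 by lra.
  have zb : -1 <= z <= 1 by lra.
  case: (ord2P i) => ->; case: (ord2P j) => ->; rewrite ?ltxx // ?bigon_lt ?bigon_gt //; lra.
have get x C (J : set R) : -1 < x < 1 -> f i0 x = f i1 x ->
    (\forall y \near x, J y) ->
    (forall q, J q.1 -> cbox q -> ~ carrier (M f) q -> c q = C (above f q)) ->
    face br vb (lab i0 i1) (square_of C).
  move=> xb e nJ HC; pose p := (x, f i0 x).
  have xb' : -1 <= x <= 1 by lra.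
  have po : obox p by split=> //; exact: (proj2 (hf i0) x xb').
  have cp : crossing_at f p i0 i1 by apply: crossing_at2; rewrite //= -e.
  have -> : square_of C = fun a b => C (corner f s p i0 i1 a b).
    by apply/funext => a; apply/funext => b; rewrite corner2.
  apply: (crossing_face hX hf labP cp _ _ (ok p po)).
    exact: (crossing_slopes hf labP tr (open_boxW po) cp).
  have nJ' : \forall q \near p, J q.1 by apply: (@cvg_fst _ _ (nbhs x) (nbhs (f i0 x))).
  have nb := near_open_box po.
  by apply: filterS2 nJ' nb => q Jq qb nq; apply: HC => //; exact: open_boxW.
have F1 : face br vb (lab i0 i1) (square_of C1).
  apply: (get x1 C1 J1) => //; [lra|by apply: bigon_eq; [lra|left]|].
  have h1 : \forall y \near x1, -1 < y by exact: lt_nbhsr.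
  have h2 : \forall y \near x1, y < x2 by exact: lt_nbhsl.
  by apply: filterS2 h1 h2 => y ? ?; rewrite /J1 /=; lra.
have F2 : face br vb (lab i0 i1) (square_of C2).
  apply: (get x2 C2 J2) => //; [lra|by apply: bigon_eq; [lra|right]|].
  have h1 : \forall y \near x2, x1 < y by exact: lt_nbhsr.
  have h2 : \forall y \near x2, y < 1 by exact: lt_nbhsl.
  by apply: filterS2 h1 h2 => y ? ?; rewrite /J2 /=; lra.
(* The three cells present over the bigon are compared on its middle vertical line. *)
have mid tau : (tau i0 -> tau i1) -> C1 tau = C2 tau.
  move=> t01; pose x := (x1 + x2) / 2.
  have xb : -1 <= x <= 1 by rewrite /x; lra.
  have lt10 : f i1 x < f i0 x by rewrite bigon_gt // /x; lra.
  have [|y [_ yb ny <-]] := @cell_fiber _ 2 f s lab hf setT tau x I xb.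
    move=> i j; case: (ord2P i) => ->; case: (ord2P j) => -> //.
    - by move=> ->.
    - by move=> /t01 ->.
    - by move=> ->.
  by rewrite -HC1 -?HC2 // /J1 /J2 /= /x; lra.
have C12 : C1 = C2.
  apply/funext => tau; have [|] := boolP (tau i0 ==> tau i1).
    by move/implyP; exact: mid.
  rewrite negb_imply => /andP[t0 t1].
  (* The relations at the two crossings agree in three colors, hence in the fourth, that of the two
     pieces. *)
  have := face_inj hX (a := ~~ s i0) (b := s i1) (proj1 (labP _)) F1 F2.
  rewrite /square_of addNb !addbb => H.
  rewrite [tau]pair2E t0 (negPf t1); apply: H => // a b ab.
  apply: mid; rewrite /pair2 /= => h; apply/negPn/negP => h'; apply: ab.
  by move: h h'; case: (a); case: (b); case: (s i0); case: (s i1).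
exists C1; split=> // q qb nq.
have [h|h] := ltP q.1 x2; first by apply: HC1 => //; case: qb => qb1 _; rewrite /J1 /=; lra.
by rewrite C12; apply: HC2 => //; case: qb => qb1 _; rewrite /J2 /=; lra.
Qed.

Lemma bigon_boundary tau : (tau i1 -> tau i0) ->
  exists p, [/\ cbox p, ~ obox p, ~ carrier (M f) p & above f p = tau].
Proof.
have [h1m [h12 h2M]] := (x1m, (x12, x2M)).
move=> t10.
have cN1 : -1 <= (-1 : R) <= 1 by lra.
have lt01 : f i0 (-1) < f i1 (-1) by rewrite bigon_lt // x1m.
have [|y [_ yb ny e]] := @cell_fiber _ 2 f s lab hf setT tau (-1) I cN1.
  move=> i j; case: (ord2P i) => ->; case: (ord2P j) => ->.
  - by move=> ->.
  - by move=> _ _; exact: lt01.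
  - by move=> /t10 ->.
  - by move=> ->.
exists (-1, y); split=> //.
by move=> [/= /andP[]]; rewrite ltxx.
Qed.

(** The bigon is the only cell that misses the frame, and a crossing determines its color. *)
Lemma bigon_rigid : transverse_in_box f s lab -> box_rigid br vb (M f).
Proof.
have [h1m [h12 h2M]] := (x1m, (x12, x2M)).
move=> tr c c' bc bc' cc'.
have [C [hC F]] := bigon_colored tr bc; have [C' [hC' F']] := bigon_colored tr bc'.
have e tau : (tau i1 -> tau i0) -> C tau = C' tau.
  by move=> /bigon_boundary [p [pb po np <-]]; rewrite -hC // -hC' // cc'.
move=> p pb np; rewrite hC // hC' //; move: (above f p) => tau.
have [|] := boolP (tau i1 ==> tau i0); first by move/implyP; exact: e.
rewrite negb_imply => /andP[t1 t0].
have := face_inj hX (a := s i0) (b := ~~ s i1) (proj1 (labP _)) F F'.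
rewrite /square_of addNb !addbb => H.
rewrite [tau]pair2E t1 (negPf t0); apply: H => // a b ab.
apply: e; rewrite /pair2 /= => h; apply/negPn/negP => h'; apply: ab.
by move: h h'; case: (a); case: (b); case: (s i0); case: (s i1).
Qed.

End Bigon.

Section Transfer.
Variables (f f' : 'I_2 -> R -> R) (x1 x2 : R).
Hypotheses (hf : forall i, crossing_box (f i)) (hf' : forall i, crossing_box (f' i))
  (f01 : forall x : R, -1 <= x <= 1 -> f i0 x < f i1 x)
  (x1m : -1 < x1) (x12 : x1 < x2) (x2M : x2 < 1)
  (hsg : forall x : R, -1 <= x <= 1 -> Num.sg (f' i1 x - f' i0 x) = Num.sg ((x - x1) * (x - x2)))
  (same : same_picture_on (cbox `\` obox) (M f) (M f')).

Lemma sorted2_eq (a0 a1 b0 b1 : R) : a0 < a1 -> b0 < b1 ->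
  (forall y, (a0 = y \/ a1 = y) <-> (b0 = y \/ b1 = y)) -> a0 = b0 /\ a1 = b1.
Proof.
move=> ? ? H.
have /H H0 : a0 = a0 \/ a1 = a0 by left.
have /H H1 : a0 = a1 \/ a1 = a1 by right.
by case: H0 => ?; case: H1 => ?; split; lra.
Qed.

Lemma ends2 (x : R) : x = -1 \/ x = 1 -> forall i, f i x = f' i x.
Proof.
move=> ex.
have xb : -1 <= x <= 1 by case: ex => ->; lra.
have carr (g : 'I_2 -> R -> R) y : carrier (M g) (x, y) <-> (g i0 x = y \/ g i1 x = y).
  split.
    by move=> /(carrier_graph g s lab _) [k /=]; case: (ord2P k) => ->; [left|right].
  by move=> [e|e]; apply/(carrier_graph g s lab _); [exists i0|exists i1].
have [e0 e1] : f i0 x = f' i0 x /\ f i1 x = f' i1 x.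
  apply: sorted2_eq; first exact: f01.
    by rewrite (bigon_lt x1m x12 x2M hsg) //; case: ex => ->; rewrite ?x1m ?x2M ?orbT.
  move=> y.
  have no : ~ obox (x, y) by move=> [/= ? _]; case: ex => e; lra.
  have [yb|yb] := pselect (cbox (x, y)).
    apply: (iff_trans (iff_sym (carr f _))); apply: (iff_trans _ (carr f' _)).
    exact: (same_carrier same (p := (x, y))).
  have nog (g : 'I_2 -> R -> R) : (forall i, crossing_box (g i)) -> ~ (g i0 x = y \/ g i1 x = y).
    move=> hg h; apply: yb; split=> //=.
    by case: h => <-; [have [_ /(_ _ xb)] := hg i0|have [_ /(_ _ xb)] := hg i1]; lra.
  by split=> h; [have := nog _ hf h|have := nog _ hf' h].
by move=> k; case: (ord2P k) => ->.
Qed.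

Lemma boundary2 p : cbox p -> ~ obox p -> above f p = above f' p.
Proof.
move=> pb po; apply/funext => i.
have bd : -1 < f i p.1 < 1 by apply: (proj2 (hf i)); case: pb.
have bd' : -1 < f' i p.1 < 1 by apply: (proj2 (hf' i)); case: pb.
rewrite /above; case: (box_boundary pb po) => e.
- by rewrite e ends2 //; left.
- by rewrite e ends2 //; right.
- by rewrite e !ltNge; congr (~~ _); transitivity true; [|symmetry]; lra.
- by rewrite e; transitivity true; [|symmetry]; lra.
Qed.

Lemma boundary2_above p : cbox p -> ~ obox p -> above f p i1 -> above f p i0.
Proof. by move=> [pb _] po; rewrite /above => h; apply: lt_trans h; exact: f01. Qed.

(** The label of the bigon is empty for disjoint strands, so its color is free to be chosen as the
    solution of the crossing relation. *)
Lemma apart_transfer : box_transfer br vb (M f) (M f').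
Proof.
move=> c bc; have [C hC] := apart_colored hf f01 bc.
have [z hz] := face_solve hX (square_of C) (s i0) (~~ s i1) (proj1 (labP (i := i0) (j := i1) isT)).
pose C' tau := update2 (square_of C) (s i0) (~~ s i1) z (tau i0 (+) s i0) (tau i1 (+) s i1).
have eC' : square_of C' = update2 (square_of C) (s i0) (~~ s i1) z.
  by apply/funext => a; apply/funext => b; rewrite /square_of /C' /= !addbK.
exists (fun q => C' (above f' q)); split.
  by rewrite -eC' in hz; exact: (@bigon_coloring f' hf' C' hz).
move=> p pb po np.
rewrite -boundary2 // hC // /C' /update2.
case: ifPn => [/andP[/eqP e0 /eqP e1]|_]; last by rewrite /square_of !addbK -pair2E.
exfalso; have := boundary2_above pb po; move: e0 e1.
by case: (above f p i0); case: (above f p i1); case: (s i0); case: (s i1) => // _ _ /(_ isT).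
Qed.

(** The color of the bigon is forgotten; one [C] serves both ends of the box by [bigon_colored]. *)
Lemma bigon_transfer : transverse_in_box f' s lab -> box_transfer br vb (M f') (M f).
Proof.
move=> tr c bc; have [C [hC F]] := bigon_colored hf' x1m x12 x2M hsg tr bc.
exists (fun q => C (above f q)); split; first exact: apart_coloring.
by move=> p pb po np; rewrite boundary2 // hC.
Qed.

End Transfer.
End Move2.

(** * The first moves *)

Section Strand.
Variables (R : realType) (X : Type) (br vb : X -> X -> X -> X).
Variables (s : bool) (f : R -> R).
Hypothesis hf : crossing_box f.
Implicit Types (p q : R * R) (c g : R * R -> X).

Local Notation obox := (@open_box R).
Local Notation cbox := (@closed_box R).
Local Notation M := (graphs_picture (n := 1) (fun=> f) (fun=> s) (fun _ _ => Plain)).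

Definition two_colors (x y : X) : R * R -> X := fun q => if f q.1 < q.2 then x else y.

Lemma strand_inside : crossings_inside M.
Proof. by apply: crossings_inside_graph => // i j; rewrite !ord1. Qed.

Lemma strand_coloring x y : box_coloring br vb M (two_colors x y).
Proof.
have := @box_coloring_graph R X br vb 1 (fun=> f) (fun=> s) (fun _ _ => Plain) (fun=> hf)
  (fun tau => if tau ord0 then x else y).
by apply=> [p i j _|p i j _ []]; rewrite !ord1.
Qed.

Lemma strand_colored c : box_coloring br vb M c ->
  exists x y, forall q, cbox q -> ~ carrier M q -> c q = two_colors x y q.
Proof.
move=> [lc _].
have [|||C HC] := @cell_colors R X 1 (fun=> f) (fun=> s) (fun _ _ => Plain) (fun=> hf)
  [set x | -1 <= x <= 1] c _ _ _ lc.
- by [].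
- by move=> x y /= hx hy z hz; lra.
- by move=> i j x y z _ _ _; rewrite ltxx.
exists (C (fun=> true)), (C (fun=> false)) => q qb nq.
rewrite HC //; last by case: qb.
rewrite /two_colors; have -> : above (fun=> f) q = (fun _ : 'I_1 => f q.1 < q.2) by [].
by case: ifP.
Qed.

Lemma carrier_strand p : carrier M p <-> f p.1 = p.2.
Proof.
by split=> [/carrier_graph[]//|e]; apply/carrier_graph; exists ord0.
Qed.

Lemma strand_rigid : box_rigid br vb M.
Proof.
move=> c c' bc bc' cc'.
have [x [y hc]] := strand_colored bc; have [x' [y' hc']] := strand_colored bc'.
have [_ /(_ (-1))] := hf; rewrite lexx /= => /(_ _)/andP[]; first lra.
move=> f1 f2.
have ex : x = x'.
  have pb : cbox (-1, 1) by split=> /=; lra.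
  have po : ~ obox (-1, 1) by move=> [] /=; lra.
  have np : ~ carrier M (-1, 1) by move/carrier_strand => /=; lra.
  by have := cc' _ pb po np; rewrite hc // hc' // /two_colors /= f2.
have ey : y = y'.
  have pb : cbox (-1, -1) by split=> /=; lra.
  have po : ~ obox (-1, -1) by move=> [] /=; lra.
  have np : ~ carrier M (-1, -1) by move/carrier_strand => /=; lra.
  by have := cc' _ pb po np; rewrite hc // hc' // /two_colors /= ltNge ltW.
by move=> p pb np; rewrite hc // hc' // ex ey.
Qed.

End Strand.

Section Kink.
Variables (R : realType) (X : Type) (br vb : X -> X -> X -> X).
Hypothesis hX : virtual_tribracket br vb.
Variables (s : bool) (k : mark).
Hypothesis hk : k <> Plain.
Implicit Types (p q u v w : R * R) (c g : R * R -> X).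

Local Notation obox := (@open_box R).
Local Notation cbox := (@closed_box R).
Local Notation M := (@kink_picture R s k).

(* The trace of the kink is the nodal cubic x^2 = nodal y. *)
Definition nodal (y : R) : R := (3 * y + 2) * (3 * y + 1) ^+ 2 / 36.

Lemma derive1_kink t : derive1 (@kink R) t = ((3 * t ^+ 2 - 1) / 6, 2 * t / 3).
Proof.
have d1 : is_derive t 1 (fun t : R => (t ^+ 3 - t) / 6) ((3 * t ^+ 2 - 1) / 6).
  have -> : (fun t : R => (t ^+ 3 - t) / 6) = ((@GRing.exp R ^~ 3%N) - id) * cst (6^-1).
    by apply/funext.
  apply: is_derive_eq; rewrite /cst /= /GRing.scale /=; ring.
have d2 : is_derive t 1 (fun t : R => (t ^+ 2 - 2) / 3) (2 * t / 3).
  have -> : (fun t : R => (t ^+ 2 - 2) / 3) = ((@GRing.exp R ^~ 2%N) - cst 2) * cst (3^-1).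
    by apply/funext.
  apply: is_derive_eq; rewrite /cst /= /GRing.scale /=; ring.
rewrite /kink derive1_pair //.
by rewrite !derive1E; congr pair; apply: derive_val.
Qed.

Lemma nodal_kink t : (kink t).1 ^+ 2 = nodal (kink t).2.
Proof. by rewrite /nodal /kink /=; field. Qed.

Lemma kink_nodal p : p.1 ^+ 2 = nodal p.2 -> exists t, p = kink t.
Proof.
case: p => x y /= e.
have s0 : 0 <= 3 * y + 2.
  rewrite leNgt; apply/negP => lt; have : 0 <= nodal y by rewrite -e sqr_ge0.
  have : 0 < (3 * y + 1) ^+ 2 by rewrite exprn_even_gt0 //; lra.
  by rewrite /nodal; nra.
(* The height of [kink t] is [(t ^+ 2 - 2) / 3], so the parameter is a square root of [3 * y + 2];
   the sign of the abscissa selects which. *)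
have e2 := sqr_sqrtr s0; set t := Num.sqrt _ in e2.
have : x ^+ 2 = ((t ^+ 3 - t) / 6) ^+ 2.
  rewrite e /nodal; have -> : t ^+ 3 - t = t * (t ^+ 2 - 1) by ring.
  rewrite e2 -e2 /=; have -> : 3 * y + 1 = t ^+ 2 - 1 by rewrite e2; ring.
  by field.
move/eqP; rewrite eqf_sqr => /orP[/eqP ->|/eqP ->].
  exists t; rewrite /kink e2; congr pair; by field.
exists (- t); rewrite /kink sqrrN e2; congr pair; by field.
Qed.

Lemma carrier_kink p : carrier M p <-> p.1 ^+ 2 = nodal p.2.
Proof.
split=> [[v [m [t [[-> _] _]]]]|/kink_nodal [t ->]]; first exact: nodal_kink.
exists (((-1) ^+ s * 1) *: derive1 (@kink R) t), (if t == 1 then k else if t == -1 then flip k else Plain).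
by exists t; split=> //; split=> //; exists 1.
Qed.

(** The height -1/3 is that of the node: inside the cubic, the loop ([inn]) lies below it and the
    region between the two arms ([top]) above it. *)
Definition three_colors (top out inn : X) : R * R -> X := fun q =>
  if nodal q.2 < q.1 ^+ 2 then out else if -1 / 3 < q.2 then top else inn.

Lemma nodal_gt0 (y : R) : 0 < nodal y -> 0 < 3 * y + 2 /\ 3 * y + 1 != 0.
Proof.
rewrite /nodal => h; split.
  rewrite ltNge; apply/negP => le; have := sqr_ge0 (3 * y + 1); nra.
by apply/eqP => e; move: h; rewrite e expr0n /= mulr0 mul0r ltxx.
Qed.

Lemma nodal_pos (y : R) : 0 < 3 * y + 2 -> 3 * y + 1 != 0 -> 0 < nodal y.
Proof. by move=> h1 h2; rewrite /nodal divr_gt0 // mulr_gt0 // exprn_even_gt0. Qed.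

Lemma nodal_continuous : continuous nodal.
Proof.
move=> y; rewrite /nodal.
apply: cvgMl; apply: cvgM.
  by apply: cvgD; [apply: cvgMr; exact: cvg_id|exact: cvg_cst].
apply: (@cvg_comp _ _ _ (fun y : R => 3 * y + 1) (fun z => z ^+ 2) _ (nbhs (3 * y + 1))).
  by apply: cvgD; [apply: cvgMr; exact: cvg_id|exact: cvg_cst].
exact: exprn_continuous.
Qed.

Lemma three_colors_near top out inn p : ~ carrier M p ->
  \forall q \near p, three_colors top out inn q = three_colors top out inn p.
Proof.
move=> np; rewrite /three_colors.
have c1 : (fun q : R * R => nodal q.2 - q.1 ^+ 2) @ p --> nodal p.2 - p.1 ^+ 2.
  apply: cvgB.
    by apply: (@cvg_comp _ _ _ snd nodal _ (nbhs p.2)); [exact: cvg_snd|exact: nodal_continuous].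
  by apply: (@cvg_comp _ _ _ fst (fun z => z ^+ 2) _ (nbhs p.1)); [exact: cvg_fst|exact: exprn_continuous].
have [lt|gt|e] := ltgtP (nodal p.2) (p.1 ^+ 2); last by case: np; apply/carrier_kink.
  have : \forall q \near p, nodal q.2 - q.1 ^+ 2 < 0 by apply: (cvgr_lt _ c1); rewrite subr_lt0.
  by apply: filterS => q; rewrite subr_lt0 => ->.
have H : \forall q \near p, 0 < nodal q.2 - q.1 ^+ 2 by apply: (cvgr_gt _ c1); rewrite subr_gt0.
have y0 : p.2 != -1 / 3.
  apply/eqP => e; move: gt; rewrite e /nodal; have := sqr_ge0 p.1; nra.
have c2 : (fun q : R * R => q.2) @ p --> p.2 by exact: cvg_snd.
have H2 : \forall q \near p, (-1 / 3 < q.2) = (-1 / 3 < p.2).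
  have [lt|ge] := ltP (-1 / 3) p.2.
    exact: (cvgr_gt _ c2).
  have lt : p.2 < -1 / 3 by rewrite lt_neqAle y0.
  have : \forall q \near p, q.2 < -1 / 3.
    exact: (cvgr_lt _ c2).
  by apply: filterS => q h; rewrite ltNge ltW.
apply: filterS2 H H2 => q; rewrite subr_gt0 => h ->.
by rewrite ltNge ltW.
Qed.

Definition node : R * R := (0, -1 / 3).

(* At the node the tangent cone of the nodal cubic is 4 x^2 = y^2. *)
Lemma dir_node w : 
  (w.2 ^+ 2 < 4 * w.1 ^+ 2 -> \forall q \near dir node w, nodal q.2 < q.1 ^+ 2) /\
  (4 * w.1 ^+ 2 < w.2 ^+ 2 -> \forall q \near dir node w, q.1 ^+ 2 < nodal q.2 /\
     (-1 / 3 < q.2) = (0 < w.2)).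
Proof.
pose F := filter_prod (0 : R)^'+ (nbhs w).
(* The cubic has a critical point at the node, so first-order arguments fail; [G] is the defining
   equation divided by the square of the distance parameter. *)
pose G (z : R * (R * R)) := z.2.1 ^+ 2 - z.2.2 ^+ 2 * (1 + 3 * (z.1 * z.2.2)) / 4.
have GE (z : R * (R * R)) :
    (node + z.1 *: z.2).1 ^+ 2 - nodal (node + z.1 *: z.2).2 = z.1 ^+ 2 * G z.
  by rewrite /G /nodal /node /= /GRing.scale /=; field.
have c1 : (fun z : R * (R * R) => z.1) @ F --> (0 : R).
  by apply: cvg_trans cvg_fst _; exact: cvg_within.
have c21 : (fun z : R * (R * R) => z.2.1) @ F --> w.1.
  by apply: (@cvg_comp _ _ _ snd fst _ (nbhs w)); [exact: cvg_snd|exact: cvg_fst].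
have c22 : (fun z : R * (R * R) => z.2.2) @ F --> w.2.
  by apply: (@cvg_comp _ _ _ snd snd _ (nbhs w)); [exact: cvg_snd|exact: cvg_snd].
have sq (h : R * (R * R) -> R) (a : R) : h @ F --> a -> (fun z => h z ^+ 2) @ F --> a ^+ 2.
  by move=> H; apply: (@cvg_comp _ _ _ h (fun z => z ^+ 2) _ (nbhs a)) => //; exact: exprn_continuous.
have cG : G @ F --> w.1 ^+ 2 - w.2 ^+ 2 * (1 + 3 * (0 * w.2)) / 4.
  apply: cvgB; first exact: sq.
  apply: cvgMl; apply: cvgM; first exact: sq.
  apply: cvgD; first exact: cvg_cst.
  by apply: cvgMr; apply: cvgM.
have pos := @right_gt0 R _ w.
rewrite mul0r mulr0 addr0 mulr1 in cG.
split=> lt.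
  have : \forall z \near F, 0 < G z by apply: (cvgr_gt _ cG); lra.
  apply: filterS2 pos => z z0 Gz /=.
  by rewrite -subr_gt0 GE mulr_gt0 // exprn_gt0.
have H : \forall z \near F, G z < 0 by apply: (cvgr_lt _ cG); lra.
have w0 : w.2 != 0 by apply/eqP => e; move: lt; rewrite e expr0n /=; have := sqr_ge0 w.1; lra.
have H2 : \forall z \near F, (0 < z.2.2) = (0 < w.2).
  have [gt|le] := ltP 0 w.2; first exact: (cvgr_gt _ c22).
  have lt' : w.2 < 0 by rewrite lt_neqAle w0.
  have : \forall z \near F, z.2.2 < 0 by exact: (cvgr_lt _ c22).
  by apply: filterS => z h; rewrite ltNge ltW.
apply: (@filterS3 _ F _ _ _ _ _ _ pos H H2) => z z0 Gz ez /=; split.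
  by rewrite -subr_lt0 GE pmulr_rlt0 // exprn_gt0.
by rewrite -ez /node /= ltrDl /GRing.scale /= pmulr_rgt0.
Qed.

Definition branch (t a : R) : R * R := ((-1) ^+ s * a) *: derive1 (@kink R) t.

(** Equal heights give opposite parameters, and equal abscissas then give 0, 1 or -1. Positivity
    fixes the order of the branches; the direction [s] reverses both and cancels. *)
Lemma kink_crossing p u v m : M p u m -> M p v (flip m) -> 0 < cross u v ->
  p = node /\ m = flip k /\ exists a b, [/\ 0 < a, 0 < b, u = branch (-1) a & v = branch 1 b].
Proof.
move=> [t [[-> [a a0 ->]] em]] [t' [[e' [b b0 ->]] em']].
rewrite crossZl crossZr !derive1_kink /cross /=.
have s2 : ((-1) ^+ s * a) * ((-1) ^+ s * b) = a * b.
  have : (-1) ^+ s * (-1) ^+ s = 1 :> R by rewrite -expr2 sqrr_sign.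
  by move=> h; rewrite mulrACA h mul1r.
rewrite mulrA s2 pmulr_rgt0; last exact: mulr_gt0.
move: e'; rewrite /kink => -[e1 e2] lt.
have [t1 t'1] : t = -1 /\ t' = 1.
  clear em em' s2.
  have e3 : t ^+ 2 = t' ^+ 2 by lra.
  move/eqP: e3; rewrite eqf_sqr => /orP[/eqP tt|/eqP tt].
    by move: lt; rewrite tt; nra.
  have e4 : t' = - t by rewrite tt opprK.
  have : t * (t - 1) * (t + 1) = 0.
    have -> : t * (t - 1) * (t + 1) = t ^+ 3 - t by ring.
    have h : t' ^+ 3 = - t ^+ 3 by rewrite e4; ring.
    by move: e1; rewrite h e4; lra.
  move/eqP; rewrite !mulf_eq0 => /orP[/orP[/eqP t0|]|].
  - by move: lt; rewrite e4 t0; lra.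
  - by rewrite subr_eq0 => /eqP t1; move: lt; rewrite e4 t1; lra.
  by rewrite addr_eq0 => /eqP t1; split=> //; rewrite e4 t1 opprK.
split; first by rewrite t1 /node; congr pair; field.
split; last by exists a, b; rewrite /branch !derive1_kink t1 t'1.
have n1 : (-1 : R) == 1 = false by rewrite lt_eqF // ltrN10 ?ltr01 //; apply: lt_trans ltr01; rewrite ltrN10.
by rewrite em t1 n1 eqxx.
Qed.

Lemma kink_inside : crossings_inside M.
Proof.
move=> p u v m _ Mu Mv uv; have [-> _] := kink_crossing Mu Mv uv.
by rewrite /node; split=> /=; lra.
Qed.

Lemma node_along top out inn (a b : R) c : 0 < a -> 0 < b ->
  (\forall q \near node, ~ carrier M q -> c q = three_colors top out inn q) ->
  let u := branch (-1) a in let v := branch 1 b in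
  [/\ color_along M c node (v - u) (if s then inn else top),
      color_along M c node (u - v) (if s then top else inn),
      color_along M c node (- (u + v)) out &
      color_along M c node (u + v) out].
Proof.
move=> a0 b0 cC u v.
have along w x : (\forall q \near dir node w, q.1 ^+ 2 != nodal q.2 /\ three_colors top out inn q = x) ->
    color_along M c node w x.
  move=> H; have H' : \forall q \near dir node w, ~ carrier M q -> c q = three_colors top out inn q.
    exact: (@dir_nbhs _ _ node w).
  apply: filterS2 H H' => q [/eqP ne <-] h.
  have nc : ~ carrier M q by move/carrier_kink.
  by split=> //; exact: h.
have outw w : w.2 ^+ 2 < 4 * w.1 ^+ 2 -> color_along M c node w out.
  move=> /(proj1 (dir_node w)) H; apply: along; apply: filterS H => q h.
  by rewrite gt_eqF // /three_colors h.
have inw w : 4 * w.1 ^+ 2 < w.2 ^+ 2 -> color_along M c node w (if 0 < w.2 then top else inn).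
  move=> /(proj2 (dir_node w)) H; apply: along; apply: filterS H => q [h e].
  by rewrite lt_eqF // /three_colors ltNge ltW //= e.
have s2 : (-1) ^+ s * (-1) ^+ s = 1 :> R by rewrite -expr2 sqrr_sign.
have ab : 0 < a * b by exact: mulr_gt0.
have uE : u = (((-1) ^+ s) * (a / 3), ((-1) ^+ s) * (- 2 * a / 3)).
  by rewrite /u /branch derive1_kink; apply: injective_projections; rewrite /= /GRing.scale /=; field.
have vE : v = (((-1) ^+ s) * (b / 3), ((-1) ^+ s) * (2 * b / 3)).
  by rewrite /v /branch derive1_kink; apply: injective_projections; rewrite /= /GRing.scale /=; field.
split.
- have := inw (v - u); rewrite uE vE /=.
  have -> : 0 < (-1) ^+ s * (2 * b / 3) - (-1) ^+ s * (-2 * a / 3) = ~~ s.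
    by case: (s); rewrite /= ?expr1 ?expr0; [apply/negbTE; rewrite -leNgt|]; lra.
  rewrite if_neg; apply.
  by move: s2; generalize ((-1) ^+ s : R) => e s2; nra.
- have := inw (u - v); rewrite uE vE /=.
  have -> : 0 < (-1) ^+ s * (-2 * a / 3) - (-1) ^+ s * (2 * b / 3) = s.
    by case: (s); rewrite /= ?expr1 ?expr0; [|apply/negbTE; rewrite -leNgt]; lra.
  apply.
  by move: s2; generalize ((-1) ^+ s : R) => e s2; nra.
- apply: outw; rewrite uE vE /=.
  by move: s2; generalize ((-1) ^+ s : R) => e s2; nra.
- apply: outw; rewrite uE vE /=.
  by move: s2; generalize ((-1) ^+ s : R) => e s2; nra.
Qed.

(** The outer region is both the incoming and the outgoing quadrant, and the direction decides which
    of the other two is on the left. The mark is that of the branch at parameter -1, which comes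
    first in the positive order. *)
Definition kink_rel top out inn := crossing_rel br vb (flip k)
  (if s then inn else top) out (if s then top else inn) out.

Lemma kink_coloring top out inn : kink_rel top out inn ->
  box_coloring br vb M (three_colors top out inn).
Proof.
move=> h; split=> p pb.
  by move=> /(three_colors_near top out inn); apply: filterS.
move=> u v m l r i o Mu Mv uv.
have [e [-> [a [b [a0 b0 -> ->]]]]] := kink_crossing Mu Mv uv; rewrite e.
have [|h1 h2 h3 h4] := @node_along top out inn a b (three_colors top out inn) a0 b0.
  by near=> q.
move=> /(color_along_inj h1) <- /(color_along_inj h2) <-.
by move=> /(color_along_inj h3) <- /(color_along_inj h4) <-.
Unshelve. all: by end_near. Qed.

Section Segments.
Variable c : R * R -> X.
Hypothesis lc : forall p, cbox p -> ~ carrier M p -> \forall q \near p, cbox q -> c q = c p.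

Lemma horizontal (y a b : R) : -1 <= y <= 1 -> -1 <= a <= 1 -> -1 <= b <= 1 ->
  (forall x, Num.min a b <= x <= Num.max a b -> x ^+ 2 != nodal y) -> c (a, y) = c (b, y).
Proof.
move=> yb ab bb H.
apply: (@connected_constant _ _ [set x | Num.min a b <= x <= Num.max a b] (fun x => c (x, y))).
- by apply/connected_intervalP => x1 x2 /= h1 h2 z hz; lra.
- move=> x /= hx.
  have xb : -1 <= x <= 1 by move: hx; rewrite /Num.min /Num.max; case: ifP; lra.
  have nx : ~ carrier M (x, y) by move/carrier_kink => /= /eqP; rewrite (negPf (H _ hx)).
  have cv : (fun z : R => (z, y)) @ x --> (x, y).
    by apply: (@cvg_pair _ _ _ _ (nbhs x) (nbhs y) _ _ _ id (fun=> y)); [exact: cvg_id|exact: cvg_cst].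
  have H' : \forall z \near x, cbox (z, y) -> c (z, y) = c (x, y) := cv _ (lc (p := (x, y)) (conj xb yb) nx).
  apply: filterS H' => z h hz; apply: h; split=> //=.
  by move: hz; rewrite /Num.min /Num.max; case: ifP; lra.
- by rewrite /= /Num.min /Num.max; case: ifP; lra.
- by rewrite /= /Num.min /Num.max; case: ifP; lra.
Qed.

Lemma vertical (x a b : R) : -1 <= x <= 1 -> -1 <= a <= 1 -> -1 <= b <= 1 ->
  (forall y, Num.min a b <= y <= Num.max a b -> x ^+ 2 != nodal y) -> c (x, a) = c (x, b).
Proof.
move=> xb ab bb H.
apply: (@connected_constant _ _ [set y | Num.min a b <= y <= Num.max a b] (fun y => c (x, y))).
- by apply/connected_intervalP => x1 x2 /= h1 h2 z hz; lra.
- move=> y /= hy.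
  have yb : -1 <= y <= 1 by move: hy; rewrite /Num.min /Num.max; case: ifP; lra.
  have nx : ~ carrier M (x, y) by move/carrier_kink => /= /eqP; rewrite (negPf (H _ hy)).
  have cv : (fun z : R => (x, z)) @ y --> (x, y).
    by apply: (@cvg_pair _ _ _ _ (nbhs x) (nbhs y) _ _ _ (fun=> x) id); [exact: cvg_cst|exact: cvg_id].
  have H' : \forall z \near y, cbox (x, z) -> c (x, z) = c (x, y) := cv _ (lc (p := (x, y)) (conj xb yb) nx).
  apply: filterS H' => z h hz; apply: h; split=> //=.
  by move: hz; rewrite /Num.min /Num.max; case: ifP; lra.
- by rewrite /= /Num.min /Num.max; case: ifP; lra.
- by rewrite /= /Num.min /Num.max; case: ifP; lra.
Qed.

End Segments.

(** The kink leaves the box at parameters -2 and 2, at height 2/3; below that height the vertical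
    edges lie in the outer region. *)
Lemma nodal_lt1 (y : R) : -1 <= y -> y < 2 / 3 -> nodal y < 1.
Proof.
move=> h1 h2; rewrite /nodal.
have h3 : (3 * y + 1) ^+ 2 <= 9 by nra.
have h4 := sqr_ge0 (3 * y + 1).
nra.
Qed.

Lemma nodal_ge1 (y : R) : 2 / 3 <= y -> 1 <= nodal y.
Proof.
move=> h; rewrite /nodal.
have h3 : 9 <= (3 * y + 1) ^+ 2 by nra.
nra.
Qed.

Lemma nodal_bottom : nodal (-1) < 0.
Proof. by rewrite /nodal; lra. Qed.

(** Each region is contracted to a base point by broken lines: inside the cubic horizontally to the
    axis and then along it, outside horizontally to a vertical edge, then down and along the bottom
    edge. *)
Lemma kink_colored c : box_coloring br vb M c -> exists top out inn,
  (forall q, cbox q -> ~ carrier M q -> c q = three_colors top out inn q) /\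
  kink_rel top out inn.
Proof.
move=> [lc ok].
have c0 : -1 <= (0 : R) <= 1 by lra.
have c1 : -1 <= (1 : R) <= 1 by lra.
have cN1 : -1 <= (-1 : R) <= 1 by lra.
have ch : -1 <= (- 1 / 2 : R) <= 1 by lra.
exists (c (0, 1)), (c (-1, -1)), (c (0, - 1 / 2)).
have bottom : c (1, -1) = c (-1, -1).
  apply: (horizontal lc) => // x _.
  by rewrite gt_eqF //; apply: lt_le_trans nodal_bottom (sqr_ge0 _).
have side x y : x = -1 \/ x = 1 -> -1 <= y -> y < 2 / 3 -> c (x, y) = c (-1, -1).
  move=> ex y1 y2.
  have xb : -1 <= x <= 1 by case: ex => ->.
  have yb : -1 <= y <= 1 by lra.
  have x2 : x ^+ 2 = 1 by case: ex => ->; rewrite ?sqrrN expr1n.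
  have -> : c (x, y) = c (x, -1).
    apply: (vertical lc) => // z; rewrite min_r ?max_l // => hz.
    by rewrite x2 gt_eqF // nodal_lt1 //; lra.
  by case: ex => ->.
have H q : cbox q -> ~ carrier M q ->
    c q = three_colors (c (0, 1)) (c (-1, -1)) (c (0, - 1 / 2)) q.
  case: q => x y [/= xb yb] np; rewrite /three_colors /=.
  have [lt|gt|e] := ltgtP (nodal y) (x ^+ 2); last by case: np; apply/carrier_kink.
    have x21 : x ^+ 2 <= 1 by nra.
    have y23 : y < 2 / 3 by rewrite ltNge; apply/negP => /nodal_ge1; lra.
    have [x0|x0] := lerP 0 x.
      have -> : c (x, y) = c (1, y).
        apply: (horizontal lc) => // z; rewrite min_l ?max_r; try lra; move=> hz.
        by rewrite gt_eqF //; apply: lt_le_trans lt _; nra.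
      by apply: side; [right|lra|].
    have -> : c (x, y) = c (-1, y).
      apply: (horizontal lc) => // z; rewrite min_r ?max_l; try lra; move=> hz.
      by rewrite gt_eqF //; apply: lt_le_trans lt _; nra.
    by apply: side; [left|lra|].
  have [y2 y3] : 0 < 3 * y + 2 /\ 3 * y + 1 != 0.
    by apply: nodal_gt0; apply: le_lt_trans gt; exact: sqr_ge0.
  have -> : c (x, y) = c (0, y).
    apply: (horizontal lc) => // z hz.
    rewrite lt_eqF //; apply: le_lt_trans gt.
    by move: hz; rewrite /Num.min /Num.max; case: ifP => _ hz; nra.
  have [h|h] := ltP (-1 / 3) y.
    apply: (vertical lc) => // z; rewrite min_l ?max_r; try lra; move=> hz.
    rewrite expr0n lt_eqF //; apply: nodal_pos; [lra|].
    by rewrite gt_eqF //; lra.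
  have h' : y < - 1 / 3.
    by rewrite lt_neqAle h andbT; apply: contra y3 => /eqP ->; apply/eqP; field.
  apply: (vertical lc) => // z hz.
  have z1 : z < - 1 / 3 by move: hz; rewrite /Num.min /Num.max; case: ifP => _ hz; lra.
  have z2 : -2 / 3 < z by move: hz; rewrite /Num.min /Num.max; case: ifP => _ hz; lra.
  rewrite expr0n lt_eqF //; apply: nodal_pos; [lra|].
  by rewrite lt_eqF //; lra.
split=> //.
have no : obox node by rewrite /node; split=> /=; lra.
have near_c : \forall q \near node, ~ carrier M q ->
    c q = three_colors (c (0, 1)) (c (-1, -1)) (c (0, - 1 / 2)) q.
  by apply: filterS (near_open_box no) => q qo; apply: H; exact: open_boxW.
have [h1 h2 h3 h4] := node_along ltr01 ltr01 near_c.
have n1 : (-1 : R) == 1 = false by rewrite lt_eqF //; apply: lt_trans ltr01; rewrite ltrN10.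
apply: (ok node no (branch (-1) 1) (branch 1 1) (flip k)) => //.
- exists (-1); split; last by rewrite n1 eqxx.
  by split; [rewrite /node /kink; congr pair; field|exists 1].
- exists 1; split; last by rewrite eqxx; case: (k).
  by split; [rewrite /node /kink; congr pair; field|exists 1].
rewrite /branch crossZl crossZr !derive1_kink /cross /=.
have s2 : (-1) ^+ s * (-1) ^+ s = 1 :> R by rewrite -expr2 sqrr_sign.
by rewrite !mulr1 mulrA s2; lra.
Qed.

Lemma flipk : flip k <> Plain. Proof. by case: (k) hk. Qed.

(** The colors [top] and [out] are visible on the frame, and the crossing relation determines
    [inn]. *)
Lemma kink_rigid : box_rigid br vb M.
Proof.
move=> c c' bc bc' cc'.
have [x [y [z [hc hz]]]] := kink_colored bc; have [x' [y' [z' [hc' hz']]]] := kink_colored bc'.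
have ex : x = x'.
  have pb : cbox (0, 1) by split=> /=; lra.
  have po : ~ obox (0, 1) by move=> [] /=; lra.
  have h : (0 : R) ^+ 2 < nodal 1 by rewrite expr0n /nodal /=; lra.
  have np : ~ carrier M (0, 1) by move/carrier_kink => /= e; move: h; rewrite e ltxx.
  have h3 : -1 / 3 < (1 : R) by lra.
  by have := cc' _ pb po np; rewrite hc // hc' // /three_colors /= ltNge ltW //= h3.
have ey : y = y'.
  have pb : cbox (-1, -1) by split=> /=; lra.
  have po : ~ obox (-1, -1) by move=> [] /=; lra.
  have h : nodal (-1) < (-1 : R) ^+ 2 by apply: lt_le_trans nodal_bottom (sqr_ge0 _).
  have np : ~ carrier M (-1, -1) by move/carrier_kink => /= e; move: h; rewrite e ltxx.
  by have := cc' _ pb po np; rewrite hc // hc' // /three_colors /= h.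
have ez : z = z'.
  move: hz hz'; rewrite -ex -ey /kink_rel; case: (s) => hz hz'.
    have [l [_ hl]] := crossing_rel_l hX y x y flipk.
    by rewrite -(hl _ hz) -(hl _ hz').
  have [l [_ hl]] := crossing_rel_r hX x y y flipk.
  by rewrite -(hl _ hz) -(hl _ hz').
by move=> p pb np; rewrite hc // hc' // ex ey ez.
Qed.

Section Transfer.
Variable f : R -> R.
Hypothesis hf : crossing_box f.
Local Notation M' := (graphs_picture (n := 1) (fun=> f) (fun=> s) (fun _ _ => Plain)).
Hypothesis same : same_picture_on (cbox `\` obox) M M'.

(** The cubic meets the vertical edges of the box only at height 2/3, and the two pictures agree
    there. *)
Lemma kink_ends x : x = -1 \/ x = 1 -> f x = 2 / 3.
Proof.
move=> ex.
have xb : -1 <= x <= 1 by case: ex => ->; lra.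
have [_ /(_ _ xb) fx] := hf.
have pb : cbox (x, f x) by split=> //=; lra.
have po : ~ obox (x, f x) by move=> [/= ? _]; case: ex => e; lra.
have : carrier M (x, f x) by apply/(same_carrier same (conj pb po))/carrier_strand.
move/carrier_kink => /=; have -> : x ^+ 2 = 1 by case: ex => ->; rewrite ?sqrrN expr1n.
move=> e; have [h|h|//] := ltgtP (f x) (2 / 3); exfalso.
  have fx1 : -1 <= f x by lra.
  by have := nodal_lt1 fx1 h; rewrite -e ltxx.
move: e; rewrite /nodal.
have h3 : 9 < (3 * f x + 1) ^+ 2 by nra.
nra.
Qed.

Lemma kink_strand top out inn p : cbox p -> ~ obox p -> ~ carrier M p ->
  three_colors top out inn p = two_colors f top out p.
Proof.
move=> pb po np; rewrite /three_colors /two_colors.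
have nn : p.1 ^+ 2 != nodal p.2 by apply/eqP => /carrier_kink.
have ends x : x = -1 \/ x = 1 -> p.1 = x ->
    (if nodal p.2 < p.1 ^+ 2 then out else if -1 / 3 < p.2 then top else inn) =
    (if f p.1 < p.2 then top else out).
  move=> ex e; rewrite e kink_ends //.
  have x2 : x ^+ 2 = 1 by case: ex => ->; rewrite ?sqrrN expr1n.
  move: nn; rewrite e x2 => nn.
  have [h|h] := ltP (2 / 3) p.2.
    have h3 : -1 / 3 < p.2 by lra.
    by rewrite ltNge (nodal_ge1 (ltW h)) /= h3.
  have h' : p.2 < 2 / 3.
    rewrite lt_neqAle h andbT; apply: contra nn => /eqP ->; rewrite /nodal.
    by apply/eqP; field.
  by rewrite nodal_lt1 //; case: pb => _ /andP[].
have bd : -1 < f p.1 < 1 by apply: (proj2 hf); case: pb.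
have x21 : p.1 ^+ 2 <= 1 by case: pb => hp _; nra.
case: (box_boundary pb po) => e.
- by apply: (ends (-1)) => //; left.
- by apply: (ends 1) => //; right.
- have h3 : -1 < f p.1 by lra.
  by rewrite e (lt_le_trans nodal_bottom (sqr_ge0 _)) ltNge ltW.
- have h3 : -1 / 3 < (1 : R) by lra.
  have h4 : f p.1 < 1 by lra.
  have h5 : p.1 ^+ 2 <= nodal 1 by rewrite /nodal; lra.
  by rewrite e ltNge h5 /= h3 h4.
Qed.

Lemma kink_transfer : box_transfer br vb M M'.
Proof.
move=> c bc; have [x [y [z [hc hz]]]] := kink_colored bc.
exists (two_colors f x y); split; first exact: strand_coloring.
by move=> p pb po np; rewrite hc // kink_strand.
Qed.

(** The loop is a new region, colored by solving the crossing relation for it. *)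
Lemma strand_transfer : box_transfer br vb M' M.
Proof.
move=> c bc; have [x [y hc]] := strand_colored hf bc.
have [z hz] : exists z, kink_rel x y z.
  rewrite /kink_rel; case: (s).
    by have [z [hz _]] := crossing_rel_l hX y x y flipk; exists z.
  by have [z [hz _]] := crossing_rel_r hX x y y flipk; exists z.
exists (three_colors x y z); split; first exact: kink_coloring.
move=> p pb po np; rewrite hc // kink_strand //.
by move/(same_carrier same (conj pb po)).
Qed.

End Transfer.
End Kink.

(** * Local structure of a diagram *)

(** Here [a] and [b] are the coordinates of a curve whose velocity at [t0] is horizontal.
    Monotonicity of [a] and the intermediate value theorem give the graph; any Lipschitz constant
    below 1 would keep it off the diagonals, and 1/2 leaves room for cones. *)
Lemma local_graph (R : realType) (a b a' b' : R -> R) (t0 e0 : R) :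
  (forall t : R, is_derive t (1 : R) a (a' t)) -> (forall t : R, is_derive t (1 : R) b (b' t)) ->
  {for t0, continuous a'} -> {for t0, continuous b'} ->
  a t0 = 0 -> b t0 = 0 -> 0 < a' t0 -> b' t0 = 0 -> 0 < e0 ->
  exists (F : R -> R) (e d : R), [/\ 0 < e <= e0, 0 < d, F 0 = 0,
    forall x x', `|x| < d -> `|x'| < d -> `|F x - F x'| <= `|x - x'| / 2 &
    (forall t, `|t - t0| < e -> b t = F (a t)) /\
    (forall x, `|x| < d -> exists t, `|t - t0| < e /\ a t = x)].
Proof.
move=> da db ca cb a0 b0 pa zb e00.
have n1 : \forall t \near t0, 0 < a' t by apply: (cvgr_gt _ ca).
have n2 : \forall t \near t0, 0 < a' t / 2 + b' t.
  have c : (fun t => a' t / 2 + b' t) @ t0 --> a' t0 / 2 + b' t0.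
    by apply: cvgD => //; apply: cvgMl.
  by apply: (cvgr_gt _ c); rewrite zb; lra.
have n3 : \forall t \near t0, 0 < a' t / 2 - b' t.
  have c : (fun t => a' t / 2 - b' t) @ t0 --> a' t0 / 2 - b' t0.
    by apply: cvgB => //; apply: cvgMl.
  by apply: (cvgr_gt _ c); rewrite zb; lra.
have [e1 /= e10 He1] : exists2 e1 : R, 0 < e1 & forall t, `|t - t0| < e1 ->
    [/\ 0 < a' t, 0 < a' t / 2 + b' t & 0 < a' t / 2 - b' t].
  have : \forall t \near t0, [/\ 0 < a' t, 0 < a' t / 2 + b' t & 0 < a' t / 2 - b' t].
    by apply: filterS3 n1 n2 n3.
  move=> /nbhs_ballP [e1 /= e10 H]; exists e1 => // t ht.
  by apply: H; rewrite /ball /= distrC.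
(* Halved so that the closed interval of radius [e] stays where the derivative bounds hold. *)
pose e := Num.min e0 e1 / 2.
have em : 0 < Num.min e0 e1 by rewrite lt_min e00.
have e_gt0 : 0 < e by rewrite divr_gt0.
have e_le : Num.min e0 e1 <= e0 by rewrite ge_min lexx.
have e_le1 : Num.min e0 e1 <= e1 by rewrite ge_min lexx orbT.
have ee0 : e <= e0 by rewrite /e; lra.
have ee1 : e < e1 by rewrite /e; lra.
(* Near t0 the functions a/2 + b and a/2 - b increase, hence the Lipschitz bound. *)
have inc (g g' : R -> R) : (forall t : R, is_derive t (1 : R) g (g' t)) ->
    (forall t, `|t - t0| < e1 -> 0 < g' t) ->
    forall x y, t0 - e <= x -> x < y -> y <= t0 + e -> g x < g y.
  move=> dg pg; apply: gtr0_derive1_incr.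
  - by move=> x _; have [] := dg x.
  - move=> x; rewrite in_itv /= => /andP[h1 h2].
    have [_] := dg x; rewrite -derive1E => ->; apply: pg.
    by rewrite ltr_norml; apply/andP; split; lra.
  - apply: continuous_subspaceT => x; apply: differentiable_continuous.
    by apply/derivable1_diffP; have [] := dg x.
have inca := inc a a' da (fun t ht => let: And3 h _ _ := He1 t ht in h).
have incp : forall x y, t0 - e <= x -> x < y -> y <= t0 + e -> a x / 2 + b x < a y / 2 + b y.
  apply: (inc (fun t => a t / 2 + b t) (fun t => a' t / 2 + b' t)).
    move=> t; have -> : (fun t => a t / 2 + b t) = a * cst (2^-1) + b by apply/funext.
    by apply: is_derive_eq; rewrite /cst /= /GRing.scale /=; ring.
  by move=> t /He1 [].
have incm : forall x y, t0 - e <= x -> x < y -> y <= t0 + e -> a x / 2 - b x < a y / 2 - b y.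
  apply: (inc (fun t => a t / 2 - b t) (fun t => a' t / 2 - b' t)).
    move=> t; have -> : (fun t => a t / 2 - b t) = a * cst (2^-1) - b by apply/funext.
    by apply: is_derive_eq; rewrite /cst /= /GRing.scale /=; ring.
  by move=> t /He1 [].
have lip t t' : `|t - t0| <= e -> `|t' - t0| <= e -> `|b t - b t'| <= `|a t - a t'| / 2.
  wlog tt : t t' / t' <= t.
    move=> H ht ht'; have [le|le] := leP t' t; first exact: H.
    by rewrite distrC [in leRHS]distrC; apply: H => //; exact: ltW.
  move=> ht ht'.
  have /andP[h1 h2] : - e <= t - t0 <= e by rewrite -ler_norml.
  have /andP[h3 h4] : - e <= t' - t0 <= e by rewrite -ler_norml.
  move: tt; rewrite le_eqVlt => /orP[/eqP ->|lt]; first by rewrite !subrr normr0 mul0r.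
  have ha : a t' < a t by apply: inca; lra.
  have hp : a t' / 2 + b t' < a t / 2 + b t by apply: incp; lra.
  have hm : a t' / 2 - b t' < a t / 2 - b t by apply: incm; lra.
  rewrite [`|a t - a t'|]gtr0_norm ?subr_gt0 // ler_norml.
  by apply/andP; split; lra.
have ap : 0 < a (t0 + e) by rewrite -a0; apply: inca; lra.
have an : a (t0 - e) < 0 by rewrite -a0; apply: inca; lra.
pose d := Num.min (a (t0 + e)) (- a (t0 - e)).
have dp : 0 < d by rewrite lt_min ap oppr_gt0.
have cov x : `|x| < d -> exists t, `|t - t0| < e /\ a t = x.
  rewrite lt_min => /andP[h1 h2].
  have h3 : a (t0 - e) < x < a (t0 + e).
    by move: h1 h2; rewrite !ltr_norml => /andP[? ?] /andP[? ?]; apply/andP; split; lra.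
  have [|||t ht e'] := @IVT R a (t0 - e) (t0 + e) x.
  - lra.
  - apply: continuous_subspaceT => z; apply: differentiable_continuous.
    by apply/derivable1_diffP; have [] := da z.
  - by rewrite min_l ?max_r; lra.
  exists t; split=> //; move: ht; rewrite in_itv /= => /andP[h4 h5].
  rewrite ltr_norml; apply/andP; split.
    have : t != t0 - e by apply/eqP => e2; move: h3; rewrite -e' e2 ltxx.
    move=> ne; have : t0 - e < t by rewrite lt_neqAle eq_sym ne.
    by lra.
  have : t != t0 + e by apply/eqP => e2; move: h3; rewrite -e' e2 ltxx andbF.
  move=> ne; have : t < t0 + e by rewrite lt_neqAle ne.
  by lra.
(* An arbitrary parameter over [x]; the Lipschitz bound shows that [b] does not depend on the
   choice. *)
pose T x := xget t0 [set t | `|t - t0| < e /\ a t = x].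
pose F x := b (T x).
have Fb t : `|t - t0| < e -> b t = F (a t).
  move=> ht; rewrite /F /T; case: xgetP => [t' _ [ht' e']|/(_ t)]; last by case.
  have := lip t t' (ltW ht) (ltW ht').
  by rewrite -e' subrr normr0 mul0r normr_le0 subr_eq0 => /eqP.
exists F, e, d; split=> //.
- by rewrite e_gt0.
- by have := Fb t0; rewrite a0 b0 subrr normr0 => /(_ e_gt0) <-.
- move=> x x' /cov [t [ht <-]] /cov [t' [ht' <-]].
  by rewrite -!Fb //; apply: lip; exact: ltW.
Qed.

Lemma cross_derive (R : realType) (g : R -> R * R) (w : R * R) (t : R) : derivable g t 1 ->
  is_derive (t : R) (1 : R) (fun t => cross w (g t)) (cross w (derive1 g t)).
Proof.
move=> /derivable1_diffP dg.
have H1 := @is_diff_comp _ _ _ _ _ _ _ _ _ (differentiableP dg) (is_diff_fst (g t)).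
have H2 := @is_diff_comp _ _ _ _ _ _ _ _ _ (differentiableP dg) (is_diff_snd (g t)).
have D1 : is_derive t 1 (fst \o g) (derive1 g t).1.
  have [d e] := H1; apply: DeriveDef; first exact/derivable1_diffP.
  by rewrite -derive1E derive1E' // e derive1E'.
have D2 : is_derive t 1 (snd \o g) (derive1 g t).2.
  have [d e] := H2; apply: DeriveDef; first exact/derivable1_diffP.
  by rewrite -derive1E derive1E' // e derive1E'.
have -> : (fun t => cross w (g t)) = cst w.1 * (snd \o g) - cst w.2 * (fst \o g) by [].
by apply: is_derive_eq; rewrite /cross /cst /= /GRing.scale /=; ring.
Qed.

Lemma cross_continuous (R : realType) (w : R * R) : continuous (cross w).
Proof.
move=> q; rewrite /cross; apply: cvgB; apply: cvgMr; [exact: cvg_snd|exact: cvg_fst].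
Qed.

Section Structure.
Variables (R : realType) (D : diagram R).
Implicit Types (p q u v w : R * R) (t s : R).

Local Notation S := (Defs.support D).
Local Notation gam := (curve (d := D)).

Lemma curve_derivable i t : derivable (gam i) t 1.
Proof. by have [+ _] := curve_C1 (d := D) i; apply. Qed.

Lemma curve_continuous i : continuous (gam i).
Proof.
by move=> t; apply: differentiable_continuous; apply/derivable1_diffP; exact: curve_derivable.
Qed.

Lemma periodic_int (T : Type) (g : R -> T) (k : int) t :
  (forall t, g (t + 1) = g t) -> g (t + k%:~R) = g t.
Proof.
move=> per; have nat_per (n : nat) x : g (x + n%:R) = g x.
  elim: n => [|n IHn]; first by rewrite addr0.
  by rewrite -natr1 addrA per.
case: k => n; first exact: nat_per.
by rewrite NegzE mulrNz -pmulrn -[in RHS](subrK (n.+1%:R) t) nat_per.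
Qed.

Lemma curve_shift i t (k : int) : gam i (t + k%:~R) = gam i t.
Proof. by apply: periodic_int => x; exact: curve_periodic. Qed.

Lemma tangent_shift i t (k : int) : derive1 (gam i) (t + k%:~R) = derive1 (gam i) t.
Proof.
apply: (@periodic_int _ (derive1 (gam i)) k t) => x.
have e : (fun h => h^-1 *: (gam i (h + (x + 1)) - gam i (x + 1))) =
    (fun h => h^-1 *: (gam i (h + x) - gam i x)).
  by apply/funext => h; rewrite addrA !curve_periodic.
by rewrite /derive1 e.
Qed.

Lemma frac_itv t : 0 <= t - (Num.floor t)%:~R <= 1.
Proof. by have := floor_itv t; rewrite intrD; lra. Qed.

Lemma support_arcs p : S p <-> exists i t, 0 <= t <= 1 /\ p = gam i t.
Proof.
split=> [[i [t ->]]|[i [t [_ ->]]]]; last by exists i, t.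
exists i, (t - (Num.floor t)%:~R); split; first exact: frac_itv.
by rewrite -mulrNz curve_shift.
Qed.

Lemma arc_compact i : compact (gam i @` `[0, 1]).
Proof.
apply: continuous_compact; last exact: segment_compact.
by apply: continuous_subspaceT; exact: curve_continuous.
Qed.

Lemma support_closed : closed S.
Proof.
have -> : S = ~` (~` S) by rewrite setCK.
apply: open_closedC; rewrite openE => p np.
have H : \forall q \near p, forall i, ~ (gam i @` `[0, 1]) q.
  apply: (@near_forall _ _ (nbhs p) (fun i q => ~ (gam i @` `[0, 1]) q)) => i.
  have cl : closed (gam i @` `[0, 1]) by apply: compact_closed; [exact: norm_hausdorff|exact: arc_compact].
  apply: (@open_nbhs_nbhs _ p (~` (gam i @` `[0, 1]))); split; first exact: closed_openC.
  by move=> [t _ e]; apply: np; exists i, t.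
apply: filterS H => q Hq /support_arcs [i [t [t01 e]]].
by apply: (Hq i); exists t => //; rewrite /= in_itv.
Qed.

Lemma support_compl : exists p, ~ S p.
Proof.
have H : \forall M \near +oo, forall i, forall t, 0 <= t <= 1 -> `|gam i t| <= M.
  apply: (@near_forall _ _ +oo (fun i M => forall t, 0 <= t <= 1 -> `|gam i t| <= M)) => i.
  have /compact_bounded/pinfty_ex_gt0 [M M0 HM] := @arc_compact i.
  near=> N => t t01; apply: (@le_trans _ _ M).
    by apply: HM; exists t => //; rewrite /= in_itv.
  by near: N; by apply: nbhs_pinfty_ge; rewrite num_real.
have [M [M0 HM]] : exists M : R, 0 < M /\ forall i, forall t, 0 <= t <= 1 -> `|gam i t| <= M.
  near (+oo : set_system R) => M; exists M; split; near: M => //.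
  by apply: nbhs_pinfty_gt; rewrite num_real.
exists (M + 1, 0) => /support_arcs [i [t [t01 e]]].
have := HM i t t01; rewrite -e prod_normE /= ge_max => /andP[+ _].
by rewrite gtr0_norm; lra.
Unshelve. all: by end_near. Qed.

(** By compactness: parameters far from the fiber over [p] have a closed image that misses [p]. *)
Lemma near_preimage p (e : R) : 0 < e ->
  \forall q \near p, forall i t, gam i t = q -> exists s, gam i s = p /\ `|t - s| < e.
Proof.
move=> e0.
apply: (@near_forall _ _ (nbhs p) (fun i q => forall t, gam i t = q ->
  exists s, gam i s = p /\ `|t - s| < e)) => i.
(* The fiber is taken in the whole line, so that closeness across the ends of the period counts. *)
pose E := `[0, 1]%classic `&` ~` (\bigcup_(s in [set s | gam i s = p]) ball s e).
have cE : compact E.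
  apply: compact_closedI; first exact: segment_compact.
  by apply: open_closedC; apply: bigcup_open => s _; exact: ball_open.
have cl : closed (gam i @` E).
  apply: compact_closed; first exact: norm_hausdorff.
  by apply: continuous_compact => //; apply: continuous_subspaceT; exact: curve_continuous.
have np : ~ (gam i @` E) p.
  move=> [t [_ nt] e1]; apply: nt; exists t => //.
  exact: ballxx.
have : \forall q \near p, ~ (gam i @` E) q.
  by apply: (@open_nbhs_nbhs _ p (~` (gam i @` E))); split=> //; exact: closed_openC.
apply: filterS => q nq t et.
pose t' := t - (Num.floor t)%:~R.
have t'01 : 0 <= t' <= 1 by exact: frac_itv.
have et' : gam i t' = q by rewrite /t' -mulrNz curve_shift.
have nE : ~ E t' by move=> Et; apply: nq; exists t'.
have [s sp bs] : (\bigcup_(s in [set s | gam i s = p]) ball s e) t'.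
  by apply: contrapT => nb; apply: nE; split=> //; rewrite /= in_itv.
exists (s + (Num.floor t)%:~R); split; first by rewrite curve_shift.
move: bs; rewrite /ball /= distrC /t'; congr (_ < _); congr (`|_|).
by rewrite opprD addrA addrAC.
Qed.

Section Basis.
Variables (p u v : R * R).
Hypothesis uv0 : cross u v != 0.

Definition at_coord (x y : R) : R * R := p + (x *: u + y *: v).
(** Cramer's rule. *)
Definition xcoord q : R := - cross v (q - p) / cross u v.
Definition ycoord q : R := cross u (q - p) / cross u v.

Lemma at_coordK x y : xcoord (at_coord x y) = x /\ ycoord (at_coord x y) = y.
Proof.
rewrite /xcoord /ycoord /at_coord addrAC subrr add0r !crossDr !crossZr !crossvv.
by rewrite (crossC v u) !mulr0 !addr0 !add0r mulrN opprK !mulfK.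
Qed.

Lemma at_coord_inj x y x' y' : at_coord x y = at_coord x' y' -> x = x' /\ y = y'.
Proof.
move=> e; have [x1 y1] := at_coordK x y; have [x2 y2] := at_coordK x' y'.
by split; [rewrite -x1 e x2|rewrite -y1 e y2].
Qed.

Lemma coordK q : at_coord (xcoord q) (ycoord q) = q.
Proof.
rewrite /at_coord /xcoord /ycoord; set z := q - p.
have -> : q = p + z by rewrite /z addrC subrK.
congr (p + _); move: uv0; rewrite /cross; case: z u v => [z1 z2] [u1 u2] [v1 v2] /= n0.
by apply: injective_projections => /=; rewrite /GRing.scale /=; field.
Qed.

Lemma xcoord_continuous : continuous xcoord.
Proof.
move=> q; apply: cvgMl; apply: cvgN.
apply: (@cvg_comp _ _ _ (fun q => q - p) (cross v) _ (nbhs (q - p))).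
  by apply: cvgB; [exact: cvg_id|exact: cvg_cst].
exact: cross_continuous.
Qed.

Lemma ycoord_continuous : continuous ycoord.
Proof.
move=> q; apply: cvgMl.
apply: (@cvg_comp _ _ _ (fun q => q - p) (cross u) _ (nbhs (q - p))).
  by apply: cvgB; [exact: cvg_id|exact: cvg_cst].
exact: cross_continuous.
Qed.

Lemma coord0 : xcoord p = 0 /\ ycoord p = 0.
Proof.
have -> : p = at_coord 0 0 by rewrite /at_coord !scale0r !addr0.
exact: at_coordK.
Qed.

Lemma near_coord (d : R) : 0 < d -> \forall q \near p, `|xcoord q| < d /\ `|ycoord q| < d.
Proof.
move=> d0; have [x0 y0] := coord0.
have H1 : \forall q \near p, `|xcoord q| < d.
  have c : (fun q => `|xcoord q|) @ p --> `|xcoord p| by apply: cvg_norm; exact: xcoord_continuous.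
  by apply: (cvgr_lt _ c); rewrite x0 normr0.
have H2 : \forall q \near p, `|ycoord q| < d.
  have c : (fun q => `|ycoord q|) @ p --> `|ycoord p| by apply: cvg_norm; exact: ycoord_continuous.
  by apply: (cvgr_lt _ c); rewrite y0 normr0.
by apply: filterS2 H1 H2.
Qed.

Lemma coord_near (N : set (R * R)) : nbhs p N ->
  exists2 d : R, 0 < d & forall x y, `|x| < d -> `|y| < d -> N (at_coord x y).
Proof.
move=> Np.
have c : (fun z : R * R => at_coord z.1 z.2) @ ((0, 0) : R * R) --> p.
  have e : p = p + ((0 : R) *: u + (0 : R) *: v) by rewrite !scale0r !addr0.
  rewrite [X in _ --> X]e; apply: cvgD; first exact: cvg_cst.
  by apply: cvgD; apply: cvgZr_tmp; [exact: cvg_fst|exact: cvg_snd].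
have /nbhs_ballP [d /= d0 H] := c _ Np; exists d => // x y hx hy.
by apply: (H (x, y)); split; rewrite /ball /= sub0r normrN.
Qed.

End Basis.

Lemma strand_graph p u v i t0 (a e0 : R) : cross u v != 0 -> p = gam i t0 -> 0 < a ->
  u = a *: derive1 (gam i) t0 -> 0 < e0 ->
  exists (F : R -> R) (e d : R), [/\ 0 < e <= e0, 0 < d, F 0 = 0,
    forall x x', `|x| < d -> `|x'| < d -> `|F x - F x'| <= `|x - x'| / 2 &
    (forall t, `|t - t0| < e -> exists x, gam i t = at_coord p u v x (F x)) /\
    (forall x, `|x| < d -> exists t, `|t - t0| < e /\ gam i t = at_coord p u v x (F x))].
Proof.
move=> uv0 ep a0 eu e00.
pose A t := xcoord p u v (gam i t); pose B t := ycoord p u v (gam i t).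
pose A' t := - cross v (derive1 (gam i) t) / cross u v.
pose B' t := cross u (derive1 (gam i) t) / cross u v.
have dA (t : R) : is_derive t (1 : R) A (A' t).
  have H := cross_derive v (@curve_derivable i t).
  have -> : A = ((fun t => cross v (gam i t)) - cst (cross v p)) * cst (- (cross u v)^-1).
    apply/funext => z; rewrite /A /xcoord crossDr crossNr /=.
    by change (- (cross v (gam i z) - cross v p) / cross u v =
      (cross v (gam i z) - cross v p) * (- (cross u v)^-1)); rewrite mulNr mulrN.
  by apply: is_derive_eq; rewrite /A' /cst /= /GRing.scale /=; ring.
have dB (t : R) : is_derive t (1 : R) B (B' t).
  have H := cross_derive u (@curve_derivable i t).
  have -> : B = ((fun t => cross u (gam i t)) - cst (cross u p)) * cst ((cross u v)^-1).
    by apply/funext => z; rewrite /B /ycoord crossDr crossNr.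
  by apply: is_derive_eq; rewrite /B' /cst /= /GRing.scale /=; ring.
have cg : continuous (derive1 (gam i)) by have [] := curve_C1 (d := D) i.
have cA : {for t0, continuous A'}.
  apply: cvgMl; apply: cvgN.
  by apply: (@cvg_comp _ _ _ (derive1 (gam i)) (cross v) _ (nbhs (derive1 (gam i) t0)));
    [exact: cg|exact: cross_continuous].
have cB : {for t0, continuous B'}.
  apply: cvgMl.
  by apply: (@cvg_comp _ _ _ (derive1 (gam i)) (cross u) _ (nbhs (derive1 (gam i) t0)));
    [exact: cg|exact: cross_continuous].
have [x0 y0] := coord0 p uv0.
have eg : derive1 (gam i) t0 = a^-1 *: u by rewrite eu scalerA mulVf ?gt_eqF // scale1r.
have A0 : A t0 = 0 by rewrite /A -ep.
have B0 : B t0 = 0 by rewrite /B -ep.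
have pA : 0 < A' t0.
  by rewrite /A' eg crossZr (crossC v u) mulrN opprK mulfK // invr_gt0.
have zB : B' t0 = 0 by rewrite /B' eg crossZr crossvv mulr0 mul0r.
have [F [e [d [e_gt d0 F0 lip [H1 H2]]]]] := local_graph dA dB cA cB A0 B0 pA zB e00.
exists F, e, d; split=> //; split.
  by move=> t ht; exists (A t); rewrite -H1 // coordK.
move=> x /H2 [t [ht e1]]; exists t; split=> //.
by rewrite -e1 -H1 // coordK.
Qed.

Lemma near_two_strands p x y (e : R) : 0 < e ->
  p = gam x.1 x.2 -> p = gam y.1 y.2 ->
  (forall z : 'I_(ncomp D) * R, gam z.1 z.2 = p -> same_point x z \/ same_point y z) ->
  \forall q \near p, S q -> (exists t, `|t - x.2| < e /\ gam x.1 t = q) \/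
    (exists t, `|t - y.2| < e /\ gam y.1 t = q).
Proof.
move=> e0 ex ey H; apply: filterS (near_preimage p e0) => q Hq [i [t eq]].
have [s [es ts]] := Hq i t (esym eq).
have shift z : same_point z (i, s) -> exists t, `|t - z.2| < e /\ gam z.1 t = q.
  move=> [/= e1 [k ek]]; exists (t + k%:~R); split; last by rewrite curve_shift e1.
  by rewrite -ek; move: ts; congr (`|_| < _); ring.
by case: (H (i, s) es) => /shift; [left|right].
Qed.

Lemma crossing_structure p u v x y (a b : R) :
  double_point gam x y -> p = gam x.1 x.2 -> 0 < a -> 0 < b ->
  u = a *: derive1 (gam x.1) x.2 -> v = b *: derive1 (gam y.1) y.2 ->
  cross u v != 0 /\ exists (F G : R -> R) (d : R), [/\ 0 < d, F 0 = 0 /\ G 0 = 0,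
    forall x x', `|x| < d -> `|x'| < d -> `|F x - F x'| <= `|x - x'| / 2,
    forall x x', `|x| < d -> `|x'| < d -> `|G x - G x'| <= `|x - x'| / 2 &
    forall x y, `|x| < d -> `|y| < d ->
      (S (at_coord p u v x y) <-> y = F x \/ x = G y)].
Proof.
move=> dxy ex a0 b0 eu ev.
have ey : p = gam y.1 y.2 by rewrite ex; case: dxy.
have uv0 : cross u v != 0.
  by rewrite eu ev crossZl crossZr !mulf_eq0 (gt_eqF a0) (gt_eqF b0) /=; exact: curve_transverse dxy.
have vu0 : cross v u != 0 by rewrite crossC oppr_eq0.
split=> //.
have [F [e1 [d1 [/andP[e10 _] d10 F0 lipF [F1 F2]]]]] := strand_graph uv0 ex a0 eu ltr01.
(* The second parameter radius is bounded by the first, so that [e2] serves both strands. *)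
have [G [e2 [d2 [/andP[e20 e21] d20 G0 lipG [G1 G2]]]]] := strand_graph vu0 ey b0 ev e10.
have swap s t : at_coord p v u s t = at_coord p u v t s by rewrite /at_coord addrC [X in X + _]addrC addrC.
have two z : gam z.1 z.2 = p -> same_point x z \/ same_point y z.
  move=> ez; have [h|h] := pselect (same_point x z); [by left|right].
  apply: (curve_no_triple dxy); split=> //.
  by rewrite ez -ex.
have [d3 d30 H3] := coord_near u v (near_two_strands e20 ex ey two).
exists F, G, (Num.min (Num.min d1 d2) d3); split=> //.
- by rewrite !lt_min d10 d20 d30.
- by move=> s t; rewrite !lt_min => /andP[/andP[? ?] ?] /andP[/andP[? ?] ?]; apply: lipF.
- by move=> s t; rewrite !lt_min => /andP[/andP[? ?] ?] /andP[/andP[? ?] ?]; apply: lipG.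
move=> s t; rewrite !lt_min => /andP[/andP[s1 s2] s3] /andP[/andP[t1 t2] t3]; split.
  move=> /(H3 _ _ s3 t3) [[z [hz ez]]|[z [hz ez]]].
    have [s' es'] := F1 z (lt_le_trans hz e21).
    by left; have [-> ->] := at_coord_inj uv0 (etrans (esym ez) es').
  have [s' es'] := G1 z hz.
  rewrite swap in es'.
  by right; have [-> ->] := at_coord_inj uv0 (etrans (esym ez) es').
move=> [->|->].
  by have [z [_ <-]] := F2 s s1; exists x.1, z.
by have [z [_ e]] := G2 t t2; exists y.1, z; rewrite e swap.
Qed.

Lemma plain_structure p x : p = gam x.1 x.2 ->
  (forall z : 'I_(ncomp D) * R, gam z.1 z.2 = p -> same_point x z) ->
  exists u v, cross u v != 0 /\ exists (F : R -> R) (d : R), [/\ 0 < d, F 0 = 0,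
    forall x x', `|x| < d -> `|x'| < d -> `|F x - F x'| <= `|x - x'| / 2 &
    forall x y, `|x| < d -> `|y| < d -> (S (at_coord p u v x y) <-> y = F x)].
Proof.
move=> ex one; pose u := derive1 (gam x.1) x.2; pose v := (- u.2, u.1).
have uv0 : cross u v != 0.
  have : u != 0 by exact: curve_immersion.
  apply: contra => /eqP; rewrite /cross /v /= => h.
  have h1 : u.1 ^+ 2 + u.2 ^+ 2 = 0 by rewrite -h; ring.
  have := sqr_ge0 u.1; have := sqr_ge0 u.2 => h2 h3.
  have /eqP : u.1 ^+ 2 = 0 by lra.
  have /eqP : u.2 ^+ 2 = 0 by lra.
  rewrite !sqrf_eq0 => /eqP z2 /eqP z1.
  by apply/eqP; apply: injective_projections.
exists u, v; split=> //.
have eu : u = 1 *: derive1 (gam x.1) x.2 by rewrite scale1r.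
have [F [e1 [d1 [/andP[e10 _] d10 F0 lipF [F1 F2]]]]] := strand_graph uv0 ex ltr01 eu ltr01.
have [d3 d30 H3] := coord_near u v (near_two_strands e10 ex ex (fun z ez => or_introl (one z ez))).
exists F, (Num.min d1 d3); split=> //.
- by rewrite lt_min d10 d30.
- by move=> s t; rewrite !lt_min => /andP[? ?] /andP[? ?]; apply: lipF.
move=> s t; rewrite !lt_min => /andP[s1 s3] /andP[t1 t3]; split; last first.
  by move=> ->; have [z [_ <-]] := F2 s s1; exists x.1, z.
have main z : `|z - x.2| < e1 -> gam x.1 z = at_coord p u v s t -> t = F s.
  move=> hz ez; have [s' es'] := F1 z hz.
  by have [-> ->] := at_coord_inj uv0 (etrans (esym ez) es').
by move=> /(H3 _ _ s3 t3) [[z [hz ez]]|[z [hz ez]]]; exact: main ez.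
Qed.

End Structure.

(** * Colorings of regions and colorings of the plane *)

Section Regions.
Variables (R : realType) (D : diagram R).
Implicit Types (p q u v w : R * R) (t s : R).

Local Notation S := (Defs.support D).
Local Notation gam := (curve (d := D)).

Definition linked p q : Prop := connected_component (~` S) p q.

Lemma linked_trans q p r : linked p q -> linked q r -> linked p r.
Proof. exact: connected_component_trans. Qed.

Lemma linked_sym p q : linked p q -> linked q p.
Proof. exact: connected_component_sym. Qed.

Lemma segment_linked p q :
  (forall t, 0 <= t <= 1 -> ~ S (p + t *: (q - p))) -> linked p q.
Proof.
move=> H; pose g t := p + t *: (q - p).
have cg : continuous g.
  move=> t; apply: cvgD; first exact: cvg_cst.
  by apply: cvgZr_tmp; exact: cvg_id.
apply: (@connected_component_max _ (~` S) (g @` `[0, 1]) p).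
- by exists 0; rewrite /= ?in_itv /= ?lexx ?ler01 // /g scale0r addr0.
- by move=> _ [t t01 <-]; apply: H; move: t01; rewrite /= in_itv.
- apply: connected_continuous_connected; first exact: segment_connected.
  exact: continuous_subspaceT.
- by exists 1; rewrite /= ?in_itv /= ?lexx ?ler01 // /g scale1r addrC subrK.
Qed.

Lemma near_off_support p : ~ S p -> \forall q \near p, ~ S q.
Proof.
move=> np; apply: (@open_nbhs_nbhs _ p (~` S)); split=> //.
exact/closed_openC/support_closed.
Qed.

Lemma near_linked p : ~ S p -> \forall q \near p, linked p q.
Proof.
move=> /near_off_support /nbhs_normP [e /= e0 H].
apply/nbhs_normP; exists e => // q /= pq; apply: segment_linked => t /andP[t0 t1].
apply: H; rewrite /= opprD addrA subrr sub0r normrN normrZ ger0_norm // distrC.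
by apply: le_lt_trans pq; rewrite ler_piMl.
Qed.

(** Any point of the cone is joined to a base point on the axis, by a segment along the axis
    followed by one across the slice at fixed [e]. *)
Lemma cone_linked p w : (\forall q \near dir p w, ~ S q) ->
  exists b, \forall q \near dir p w, linked b q.
Proof.
move=> [[B C] [/= B0 /nbhs_normP [d' /= d'0 Cw]] BCS].
have [d /= d0 Hd] : exists2 d : R, 0 < d & forall e, 0 < e < d -> B e.
  have {}B0 : nbhs (0 : R) [set e | 0 < e -> B e] by exact: B0.
  move: B0 => /nbhs_ballP [d /= d0 H]; exists d => // e /andP[e0 ed].
  by apply: H => //=; rewrite /ball /= sub0r normrN gtr0_norm.
have off (e : R) w' : 0 < e < d -> `|w - w'| < d' -> ~ S (p + e *: w').
  by move=> he hw; apply: (BCS (e, w')); split; [exact: Hd|exact: Cw].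
exists (p + (d / 2) *: w).
have Nw : \forall w' \near w, `|w - w'| < d'.
  have cn : (fun w' => `|w - w'|) @ w --> `|w - w|.
    by apply: cvg_norm; apply: cvgB; [exact: cvg_cst|exact: cvg_id].
  by apply: (cvgr_lt _ cn); rewrite subrr normr0.
exists ([set e | 0 < e < d], [set w' | `|w - w'| < d']).
  split; last exact: Nw.
  have h1 : \forall e \near (0 : R)^'+, 0 < e by exact: nbhs_right_gt.
  have h2 : \forall e \near (0 : R)^'+, e < d by exact: nbhs_right_lt.
  by apply: filterS2 h1 h2 => e h3 h4; rewrite /= h3 h4.
move=> [e w'] [/= he hw].
have d2 : 0 < d / 2 < d by lra.
apply: (@linked_trans (p + e *: w)); apply: segment_linked => t /andP[t0 t1].
  have -> : p + (d / 2) *: w + t *: (p + e *: w - (p + (d / 2) *: w)) =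
      p + ((1 - t) * (d / 2) + t * e) *: w.
    apply: injective_projections => /=; rewrite /GRing.scale /=; ring.
  apply: off; last by rewrite subrr normr0.
  case/andP: he => e0 ed; apply/andP; split; nra.
have -> : p + e *: w + t *: (p + e *: w' - (p + e *: w)) = p + e *: (w + t *: (w' - w)).
  apply: injective_projections => /=; rewrite /GRing.scale /=; ring.
apply: off => //.
rewrite opprD addrA subrr sub0r normrN normrZ ger0_norm // distrC.
by apply: le_lt_trans hw; rewrite ler_piMl.
Qed.

(** Half of 5/4 is 5/8, less than 3/4. *)
Lemma not_in_cone (e a b : R) : 0 < e -> `|a| < 5 / 4 -> 3 / 4 < `|b| ->
  ~ `|e * b| <= `|e * a| / 2.
Proof. by move=> e0 ha hb; rewrite !normrM (gtr0_norm e0) -mulrA ler_pM2l //; lra. Qed.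

Lemma scaled_lt (e a d : R) : 0 < e -> e < d / 2 -> `|a| < 5 / 4 -> `|e * a| < d.
Proof. by move=> e0 ed ha; rewrite normrM gtr0_norm //; nra. Qed.

(** In the basis of the tangents the quadrant directions have coordinates 1 or -1. On a cone whose
    coordinates keep absolute values between 3/4 and 5/4, neither Lipschitz graph can be met. *)
Lemma sector p u v (x y : 'I_(ncomp D) * R) (a b : R) (l m : R) :
  double_point gam x y -> p = gam x.1 x.2 -> 0 < a -> 0 < b ->
  u = a *: derive1 (gam x.1) x.2 -> v = b *: derive1 (gam y.1) y.2 ->
  `|l| = 1 -> `|m| = 1 -> \forall q \near dir p (l *: u + m *: v), ~ S q.
Proof.
move=> dxy ex a0 b0 eu ev hl hm.
have [uv0 [F [G [d [d0 [F0 G0] lipF lipG H]]]]] := crossing_structure dxy ex a0 b0 eu ev.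
set w := l *: u + m *: v.
pose X w' := xcoord 0 u v w'; pose Y w' := ycoord 0 u v w'.
have [Xw Yw] : X w = l /\ Y w = m.
  have -> : w = at_coord 0 u v l m by rewrite /at_coord add0r.
  exact: at_coordK.
have cX : continuous X by exact: xcoord_continuous.
have cY : continuous Y by exact: ycoord_continuous.
have nX : \forall w' \near w, `|X w'| < 5 / 4 /\ 3 / 4 < `|X w'|.
  have c : (fun w => `|X w|) @ w --> `|X w| by apply: cvg_norm; exact: cX.
  have h1 : \forall w' \near w, `|X w'| < 5 / 4 by apply: (cvgr_lt _ c); rewrite Xw hl; lra.
  have h2 : \forall w' \near w, 3 / 4 < `|X w'| by apply: (cvgr_gt _ c); rewrite Xw hl; lra.
  by apply: filterS2 h1 h2.
have nY : \forall w' \near w, `|Y w'| < 5 / 4 /\ 3 / 4 < `|Y w'|.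
  have c : (fun w => `|Y w|) @ w --> `|Y w| by apply: cvg_norm; exact: cY.
  have h1 : \forall w' \near w, `|Y w'| < 5 / 4 by apply: (cvgr_lt _ c); rewrite Yw hm; lra.
  have h2 : \forall w' \near w, 3 / 4 < `|Y w'| by apply: (cvgr_gt _ c); rewrite Yw hm; lra.
  by apply: filterS2 h1 h2.
exists ([set e | 0 < e < d / 2], [set w' | (`|X w'| < 5 / 4 /\ 3 / 4 < `|X w'|) /\
    (`|Y w'| < 5 / 4 /\ 3 / 4 < `|Y w'|)]).
  split; last exact: (filterI nX nY).
  have h1 : \forall e \near (0 : R)^'+, 0 < e by exact: nbhs_right_gt.
  have h2 : \forall e \near (0 : R)^'+, e < d / 2 by apply: nbhs_right_lt; rewrite divr_gt0.
  by apply: filterS2 h1 h2 => e h3 h4; rewrite /= h3 h4.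
move=> [e w'] [/= /andP[e0 ed] [[x1 x2] [y1 y2]]].
have -> : p + e *: w' = at_coord p u v (e * X w') (e * Y w').
  rewrite -[in LHS](coordK 0 uv0 w') -/(X w') -/(Y w') /at_coord add0r.
  by rewrite scalerDr !scalerA.
have nx : `|e * X w'| < d by exact: scaled_lt.
have ny : `|e * Y w'| < d by exact: scaled_lt.
have n0 : `|0 : R| < d by rewrite normr0.
move=> /(H _ _ nx ny) [e1|e1].
  have := lipF _ _ nx n0; rewrite F0 !subr0 -e1; exact: not_in_cone.
have := lipG _ _ ny n0; rewrite G0 !subr0 -e1; exact: not_in_cone.
Qed.

Lemma picture_crossing p u v m m' : picture_of D p u m -> picture_of D p v m' ->
  cross u v != 0 -> exists x y a b, [/\ double_point gam x y, p = gam x.1 x.2, 0 < a /\ 0 < b,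
    u = a *: derive1 (gam x.1) x.2 & v = b *: derive1 (gam y.1) y.2].
Proof.
move=> [i [t [a [a0 ep eu _]]]] [j [t' [b [b0 ep' ev _]]]] uv.
exists (i, t), (j, t'), a, b; split=> //=; split; last by rewrite /= -ep.
move=> [/= ij [k ek]]; move: uv; rewrite eu ev -ij.
have -> : t = t' + k%:~R by rewrite -ek; ring.
by rewrite tangent_shift crossZl crossZr crossvv !mulr0 eqxx.
Qed.

Lemma picture_sectors p u v m m' : picture_of D p u m -> picture_of D p v m' ->
  0 < cross u v -> [/\ \forall q \near dir p (v - u), ~ S q,
    \forall q \near dir p (u - v), ~ S q,
    \forall q \near dir p (- (u + v)), ~ S q & \forall q \near dir p (u + v), ~ S q].
Proof.
move=> Pu Pv uv.
have uv0 : cross u v != 0 by rewrite gt_eqF.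
have [x [y [a [b [dxy ex [a0 b0] eu ev]]]]] := picture_crossing Pu Pv uv0.
have sec l m1 hl hm := @sector p u v x y a b l m1 dxy ex a0 b0 eu ev hl hm.
split.
- have := sec (-1) 1; rewrite scaleN1r scale1r addrC normrN normr1; exact.
- have := sec 1 (-1); rewrite scaleN1r scale1r normrN normr1; exact.
- have := sec (-1) (-1); rewrite !scaleN1r -opprD normrN normr1; exact.
- have := sec 1 1; rewrite !scale1r normr1; exact.
Qed.

Lemma region_ex (A : regions D) : exists p, ~ S p /\ val A = [set q | linked p q].
Proof. by case: A => A /= /set_mem [p np <-]; exists p. Qed.

Definition region_of p (np : ~ S p) : regions D :=
  exist _ [set q | linked p q] (mem_set (ex_intro2 _ _ p np erefl)).

Lemma region_eq (A B : regions D) q : val A q -> val B q -> A = B.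
Proof.
have [a [na eA]] := region_ex A; have [b [nb eB]] := region_ex B.
rewrite eA eB /= => aq bq; apply: val_inj; rewrite eA eB.
apply: (same_connected_component (x := a) (y := b)).
exact: connected_component_trans aq (connected_component_sym bq).
Qed.

Lemma region_off (A : regions D) q : val A q -> ~ S q.
Proof. by have [a [na ->]] := region_ex A; exact: connected_component_sub. Qed.

Lemma dir_germ p w (A : set (R * R)) : (\forall q \near dir p w, A q) -> contains_germ A p w.
Proof.
move=> [[B C] [/= B0 Cw] BCA]; rewrite /contains_germ.
apply: filterS B0 => e Be; apply: (BCA (e, w)); split=> //=.
exact: nbhs_singleton.
Qed.

Lemma cone_region p w : (\forall q \near dir p w, ~ S q) ->
  exists A : regions D, \forall q \near dir p w, val A q.
Proof.
move=> H; have [b Hb] := cone_linked H.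
have nb : ~ S b.
  have [q] := filter_ex Hb => bq.
  exact: (@connected_component_sub _ (~` S) q b (linked_sym bq)).
by exists (region_of nb).
Qed.

(** Reconciles rays with cones: a cone off the curves lies in a single region, which the ray
    identifies. *)
Lemma germ_region p w (A : regions D) : (\forall q \near dir p w, ~ S q) ->
  contains_germ (val A) p w -> \forall q \near dir p w, val A q.
Proof.
move=> /cone_region [B HB] gA.
have [e [Ae Be]] := filter_ex (filterI gA (dir_germ HB)).
by rewrite (region_eq Ae Be).
Qed.

Section Colorings.
Variables (X : Type) (br vb : X -> X -> X -> X) (x0 : X).
Implicit Types (c : R * R -> X) (k : regions D -> X).

Definition plane_of k : R * R -> X := fun p =>
  if pselect (~ S p) is left np then k (region_of np) else x0.

Lemma plane_of_region k (A : regions D) p : val A p -> plane_of k p = k A.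
Proof.
move=> Ap; rewrite /plane_of; case: pselect => [np|]; last by move/(_ (region_off Ap)).
congr k; apply: (@region_eq _ _ p) => //=.
exact: connected_component_refl.
Qed.

Lemma plane_of_support k p : S p -> plane_of k p = x0.
Proof. by move=> Sp; rewrite /plane_of; case: pselect. Qed.

Lemma plane_of_coloring k : is_coloring br vb D k ->
  plane_coloring br vb (picture_of D) (plane_of k).
Proof.
move=> hk; split=> p.
  rewrite carrier_picture_of => np; apply: filterS (near_linked np) => q pq.
  rewrite (@plane_of_region _ (region_of np) q pq) (@plane_of_region _ (region_of np) p) //=.
  exact: connected_component_refl.
move=> u v m l r i o Pu Pv uv.
have get w x : color_along (picture_of D) (plane_of k) p w x ->
    exists A : regions D, contains_germ (val A) p w /\ k A = x.
  rewrite /color_along carrier_picture_of => H.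
  have H1 : \forall q \near dir p w, ~ S q by apply: filterS H => q [].
  have [A HA] := cone_region H1; exists A; split; first exact: dir_germ.
  by have [q [[_ <-] Aq]] := filter_ex (filterI H HA); rewrite (plane_of_region _ Aq).
move=> /get [L [gL <-]] /get [T [gT <-]] /get [I [gI <-]] /get [Q [gQ <-]].
exact: (hk p u v m).
Qed.

Lemma coloring_constant c p q : locally_constant (picture_of D) c -> linked p q -> c p = c q.
Proof.
move=> lc [A [Ap AS cA] Aq].
apply: (@connected_constant _ _ A c) => // z /AS nz.
by have := lc z; rewrite carrier_picture_of => /(_ nz); apply: filterS.
Qed.

Definition base (A : regions D) : R * R := xget (0, 0) (val A).

Lemma base_in (A : regions D) : val A (base A).
Proof.
have [p [np e]] := region_ex A; rewrite /base; apply: (@xgetPex _ (0, 0) (val A)).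
by exists p; rewrite e; exact: connected_component_refl.
Qed.

Lemma linked_base (A : regions D) q : val A q -> linked (base A) q.
Proof.
have := base_in A; have [p [np ->]] := region_ex A => /= pb pq.
exact: connected_component_trans (connected_component_sym pb) pq.
Qed.

Lemma coloring_of_plane c : plane_coloring br vb (picture_of D) c ->
  is_coloring br vb D (fun A => c (base A)).
Proof.
move=> [lc ok] p u v m l r i o Pu Pv uv gl gr gi go.
have [s1 s2 s3 s4] := picture_sectors Pu Pv uv.
have along w A : (\forall q \near dir p w, ~ S q) -> contains_germ (val A) p w ->
    color_along (picture_of D) c p w (c (base A)).
  move=> H g; have HA := germ_region H g.
  rewrite /color_along carrier_picture_of; apply: filterS2 H HA => q nq Aq; split=> //.
  by symmetry; apply: coloring_constant => //; exact: linked_base.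
by apply: (ok p u v m _ _ _ _ Pu Pv uv); exact: along.
Qed.

Lemma card_colorings :
  (colorings br vb D #= colorings_off br vb (picture_of D) x0)%card.
Proof.
apply: (@card_eq_cancel _ _ _ _ plane_of (fun c A => c (base A))).
- move=> k hk; split; first exact: plane_of_coloring.
  by rewrite carrier_picture_of => p Sp; exact: plane_of_support.
- by move=> c [pc _]; exact: coloring_of_plane.
- by move=> k _; apply/funext => A; exact: plane_of_region (base_in A).
- move=> c [[lc _] c0]; apply/funext => p; have [Sp|np] := pselect (S p).
    by rewrite plane_of_support // c0 // carrier_picture_of.
  have h : val (region_of np) p by exact: connected_component_refl.
  rewrite (plane_of_region _ h); apply: coloring_constant => //.
  exact: linked_base.
Qed.

End Colorings.

End Regions.

(** * Finiteness of the set of regions *)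

Section Finiteness.
Variables (R : realType) (D : diagram R).
Implicit Types (p q u v w : R * R) (s t : R).

Local Notation S := (Defs.support D).
Local Notation gam := (curve (d := D)).
Local Notation linked := (linked D).

(* The segment has slope at least 3/5, more than the Lipschitz constant 1/2. *)
Lemma steep_segment (F : R -> R) (d x y x' y' sg tau : R) : 0 < d -> 0 <= tau <= 1 ->
  (forall x x', `|x| < d -> `|x'| < d -> `|F x - F x'| <= `|x - x'| / 2) ->
  `|x| < d / 8 -> `|y| < d / 8 -> `|x'| <= d / 2 -> sg = 1 \/ sg = -1 -> y' = sg * (d / 2) ->
  0 < sg * (y - F x) ->
  [/\ `|x + tau * (x' - x)| < d, `|y + tau * (y' - y)| < d &
    y + tau * (y' - y) != F (x + tau * (x' - x))].
Proof.
move=> d0 /andP[t0 t1] lip hx hy hx' hsg ey' side.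
have hxx : `|x' - x| <= 5 * d / 8 by have := ler_normB x' x; lra.
have hxt : `|tau * (x' - x)| <= tau * (5 * d / 8) by rewrite normrM ger0_norm // ler_wpM2l.
have htd : tau * (5 * d / 8) <= 5 * d / 8 by rewrite ler_piMl //; lra.
have bx : `|x + tau * (x' - x)| < d by have := ler_normD x (tau * (x' - x)); lra.
have hy' : `|y'| <= d / 2.
  by rewrite ey'; case: hsg => ->; rewrite ?mul1r ?mulN1r ?normrN gtr0_norm; lra.
have hyy : `|y' - y| <= 5 * d / 8 by have := ler_normB y' y; lra.
have hyt : `|tau * (y' - y)| <= tau * (5 * d / 8) by rewrite normrM ger0_norm // ler_wpM2l.
split=> //; first by have := ler_normD y (tau * (y' - y)); lra.
apply/eqP => e.
have bx0 : `|x| < d by lra.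
have := lip _ _ bx bx0; rewrite -e.
have -> : x + tau * (x' - x) - x = tau * (x' - x) by ring.
move: hy; rewrite ltr_norml => /andP[y1 y2].
have h1 : tau * (- (d / 8)) <= tau * y by rewrite ler_wpM2l // ltW.
have h2 : tau * y <= tau * (d / 8) by rewrite ler_wpM2l // ltW.
have e2 : tau * (5 * d / 8) = 5 / 8 * (tau * d) by ring.
have e3 : tau * (- (d / 8)) = - (1 / 8 * (tau * d)) by ring.
have e4 : tau * (d / 8) = 1 / 8 * (tau * d) by ring.
have td : 0 <= tau * d by rewrite mulr_ge0 // ltW.
rewrite ler_norml => /andP[h3 h4].
have e5 : tau * (y' - y) = sg * (1 / 2 * (tau * d)) - tau * y by rewrite ey'; ring.
rewrite e5 in h3 h4; rewrite e2 in hxt; rewrite e3 in h1; rewrite e4 in h2.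
clear lip e e2 e3 e4 e5 hyt htd hyy hy' bx hxx ey'.
by case: hsg => esg; rewrite esg in side h3 h4; lra.
Qed.

Lemma coord_segment p u v x y x' y' :
  (forall tau, 0 <= tau <= 1 ->
     ~ S (at_coord p u v (x + tau * (x' - x)) (y + tau * (y' - y)))) ->
  linked (at_coord p u v x y) (at_coord p u v x' y').
Proof.
move=> H; apply: segment_linked => tau /H.
congr (~ S _); rewrite /at_coord.
apply: injective_projections => /=; rewrite /GRing.scale /=; ring.
Qed.

(** At a double point the sides of the two graphs on which [q] lies give two signs, and a steep
    segment joins [q] to the corner of a coordinate square with these signs. At a simple point one
    sign suffices. *)
Lemma finitely_many_near p : S p -> exists B : seq (R * R), \forall q \near p,
  ~ S q -> exists2 b, b \in B & linked b q.
Proof.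
move=> [i [t ep]]; pose x : 'I_(ncomp D) * R := (i, t).
have sgnP (z : R) : z != 0 -> exists sg : R, (sg = 1 \/ sg = -1) /\ 0 < sg * z.
  move=> z0; have [h|h|h] := ltgtP z 0; last by rewrite h eqxx in z0.
    by exists (-1); split; [right|rewrite mulN1r oppr_gt0].
  by exists 1; split; [left|rewrite mul1r].
have sgn_norm (sg d : R) : 0 < d -> sg = 1 \/ sg = -1 -> `|sg * (d / 2)| <= d / 2.
  by move=> d0 [->|->]; rewrite ?mul1r ?mulN1r ?normrN gtr0_norm //; lra.
have [[y dxy]|nd] := pselect (exists y, double_point gam x y).
  have e1 T : T = 1 *: T :> R * R by rewrite scale1r.
  have [uv0 [F [G [d [d0 [F0 G0] lipF lipG H]]]]] :=
    crossing_structure dxy ep ltr01 ltr01 (e1 _) (e1 _).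
  set u := derive1 (gam x.1) x.2 in uv0 H; set v := derive1 (gam y.1) y.2 in uv0 H.
  pose b (s1 s2 : R) := at_coord p u v (s1 * (d / 2)) (s2 * (d / 2)).
  exists [:: b 1 1; b 1 (-1); b (-1) 1; b (-1) (-1)].
  have d8 : 0 < d / 8 by rewrite divr_gt0.
  apply: filterS (near_coord p uv0 d8) => q [hx hy] nq.
  set X := xcoord p u v q in hx; set Y := ycoord p u v q in hy.
  have eq : q = at_coord p u v X Y by rewrite coordK.
  have dd : d / 8 < d by lra.
  have nFG : ~ (Y = F X \/ X = G Y).
    by move/(H _ _ (lt_trans hx dd) (lt_trans hy dd)); rewrite -eq.
  have YF : Y - F X != 0 by rewrite subr_eq0; apply/eqP => h; apply: nFG; left.
  have XG : X - G Y != 0 by rewrite subr_eq0; apply/eqP => h; apply: nFG; right.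
  have [s2 [hs2 p2]] := sgnP _ YF; have [s1 [hs1 p1]] := sgnP _ XG.
  exists (b s1 s2).
    by case: hs1 => ->; case: hs2 => ->; rewrite !inE eqxx ?orbT.
  apply: linked_sym; rewrite {1}eq; apply: coord_segment => tau ht.
  have [bx by_ n1] := steep_segment d0 ht lipF hx hy (sgn_norm _ _ d0 hs1) hs2 erefl p2.
  have [_ _ n2] := steep_segment d0 ht lipG hy hx (sgn_norm _ _ d0 hs2) hs1 erefl p1.
  by move=> /(H _ _ bx by_) [/eqP|/eqP]; rewrite ?(negPf n1) ?(negPf n2).
have one (z : 'I_(ncomp D) * R) : gam z.1 z.2 = p -> same_point x z.
  move=> ez; apply: contrapT => nz; apply: nd; exists z; split=> //.
  by rewrite ez -ep.
have [u [v [uv0 [F [d [d0 F0 lipF H]]]]]] := plain_structure (x := x) ep one.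
pose b (s2 : R) := at_coord p u v 0 (s2 * (d / 2)).
exists [:: b 1; b (-1)].
have d8 : 0 < d / 8 by rewrite divr_gt0.
apply: filterS (near_coord p uv0 d8) => q [hx hy] nq.
set X := xcoord p u v q in hx; set Y := ycoord p u v q in hy.
have eq : q = at_coord p u v X Y by rewrite coordK.
have dd : d / 8 < d by lra.
have YF : Y - F X != 0.
  rewrite subr_eq0; apply/eqP => h; apply: nq; rewrite eq.
  exact/(H _ _ (lt_trans hx dd) (lt_trans hy dd)).
have [s2 [hs2 p2]] := sgnP _ YF.
exists (b s2); first by case: hs2 => ->; rewrite !inE eqxx ?orbT.
apply: linked_sym; rewrite {1}eq; apply: coord_segment => tau ht.
have d2 : `|0 : R| <= d / 2 by rewrite normr0 divr_ge0 // ltW.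
have [bx by_ n1] := steep_segment d0 ht lipF hx hy d2 hs2 erefl p2.
by move=> /(H _ _ bx by_) /eqP; rewrite (negPf n1).
Qed.

(** Compactness of a period: the finite lists of a finite subcover are concatenated. *)
Lemma arcs_near_cover (P : seq (R * R) -> R * R -> Prop) (i : 'I_(ncomp D)) :
  (forall B B' q, {subset B <= B'} -> P B q -> P B' q) ->
  (forall p, S p -> exists B, \forall q \near p, P B q) ->
  exists B, forall t, 0 <= t <= 1 -> P B (gam i t).
Proof.
move=> mono loc.
have /choice [B HB] : forall t, exists B, \forall q \near gam i t, P B q.
  by move=> t; apply: loc; exists i, t.
have cov : cover_compact (`[0, 1]%classic : set R).
  by rewrite -compact_cover; exact: segment_compact.
have [|t _|D' _ HD'] := cov R setT (fun t => interior [set t' | P (B t) (gam i t')]).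
- by move=> t _; exact: open_interior.
- exists t => //; have := HB t; exact: curve_continuous.
exists (flatten [seq B t | t <- finmap.enum_fset D']) => t t01.
have /HD' [t' /= t'D /interior_subset Pt] : `[0, 1]%classic t by rewrite /= in_itv.
apply: mono Pt => b bB; apply/flattenP; exists (B t') => //.
exact: map_f.
Qed.

Lemma finitely_many_bases : exists B : seq (R * R), forall q, ~ S q ->
  exists2 b, b \in B & linked b q.
Proof.
pose P (B : seq (R * R)) p := \forall q \near p, ~ S q -> exists2 b, b \in B & linked b q.
have mono B B' p : {subset B <= B'} -> P B p -> P B' p.
  by move=> BB'; apply: filterS => q H /H [b /BB' bB lb]; exists b.
have loc p : S p -> exists B, \forall q \near p, P B q.
  move=> /finitely_many_near [B HB]; exists B.
  by have /nbhs_interior := HB; apply: filterS.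
have /choice [B HB] : forall i, exists B, forall t, 0 <= t <= 1 -> P B (gam i t).
  by move=> i; exact: arcs_near_cover.
pose B' := flatten [seq B i | i <- enum 'I_(ncomp D)].
have HB' p : S p -> P B' p.
  move=> /support_arcs [i [t [t01 ->]]].
  apply: mono (HB i t t01) => b bB; apply/flattenP; exists (B i) => //.
  by apply: map_f; rewrite mem_enum.
exists ((0, 0) :: B') => q nq.
have [[z [qz [b bB lb]]]|no] := pselect (exists z, linked q z /\ exists2 b, b \in B' & linked b z).
  exists b; first by rewrite inE bB orbT.
  exact: linked_trans lb (linked_sym qz).
(* A region that contains no point linked to the listed ones stays away from the curves, so it has
   no frontier and is the whole plane; the extra base point (0, 0) is there for this case. *)
have all z : linked q z.
  have c : (linked q q) = (linked q z).
    apply: (@connected_constant _ _ [set q + t *: (z - q) | t in `[0, 1]] (linked q)).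
    - apply: connected_continuous_connected; first exact: segment_connected.
      apply: continuous_subspaceT => t; apply: cvgD; first exact: cvg_cst.
      by apply: cvgZr_tmp; exact: cvg_id.
    - move=> y _; have [Sy|ny] := pselect (S y).
        have ly y' : linked q y' -> ~ S y' by apply: connected_component_sub.
        have nly : ~ linked q y by move=> /ly.
        apply: filterS (HB' y Sy) => y' Hy' _; apply/propext; split=> [lq|/nly//].
        by case: no; exists y'; split=> //; apply: Hy'; exact: ly.
      apply: filterS (near_linked ny) => y' yy' _; apply/propext; split=> h.
        exact: linked_trans h (linked_sym yy').
      exact: linked_trans h yy'.
    - by exists 0; rewrite /= ?in_itv /= ?lexx ?ler01 // scale0r addr0.
    - by exists 1; rewrite /= ?in_itv /= ?lexx ?ler01 // scale1r addrC subrK.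
  by rewrite -c; exact: connected_component_refl.
by exists (0, 0); [rewrite inE eqxx|exact/linked_sym/all].
Qed.

Lemma finite_regions : finite_set (regions D).
Proof.
have [B HB] := finitely_many_bases.
apply: (@sub_finite_set _ _ ((fun b => connected_component (~` S) b) @` [set` B])).
  move=> A [q nq <-]; have [b bB lb] := HB q nq.
  by exists b => //; exact: same_connected_component.
by apply: finite_image; exact: finite_seq.
Qed.

Lemma finite_colorings (X : finType) (br vb : X -> X -> X -> X) :
  finite_set (colorings br vb D).
Proof.
have [n /card_esym/card_set_bijP [r [r1 r2 r3]]] := finite_regions.
have /choice [A HA] : forall k : 'I_n, exists A : regions D, val A = r k.
  by move=> k; have rk : regions D (r k) := r1 k (ltn_ord k); exists (exist _ (r k) (mem_set rk)).
apply: (@card_le_finite _ _ _ [set: {ffun 'I_n -> X}]); last exact: finite_finset.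
apply: (@card_le_inj _ _ _ _ (fun c => [ffun k => c (A k)])) => // c c' _ _ e.
apply/funext => B; have [k kn ek] := r3 (val B) (set_valP B).
have -> : B = A (Ordinal kn) by apply: val_inj; rewrite HA.
by have := congr1 (fun g : {ffun 'I_n -> X} => g (Ordinal kn)) e; rewrite !ffunE.
Qed.

Lemma regions_nonempty : exists A : regions D, True.
Proof. by have [p np] := support_compl D; exists (region_of np). Qed.

End Finiteness.

(** * Invariance under the moves *)

Section Invariance.
Variable R : realType.
Implicit Types (D : diagram R) (P M : picture R) (p q u v w : R * R).

Local Notation obox := (@open_box R).
Local Notation cbox := (@closed_box R).

Definition transverse_on (A : set (R * R)) P : Prop := forall p u m, A p -> P p u m ->
  m <> Plain -> exists v, P p v (flip m) /\ cross u v != 0.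

Lemma picture_transverse D : transverse_on setT (picture_of D).
Proof.
move=> p u m _ [i [t [a [a0 ep eu em]]]] m0.
have [y dxy] : exists y, double_point (curve (d := D)) (i, t) y.
  apply: contrapT => nd; apply: m0; rewrite em.
  by apply/(@marking_plain _ D (i, t)).
exists (derive1 (curve (d := D) y.1) y.2); split.
  exists y.1, y.2, 1; split; first exact: ltr01.
  - by case: dxy => _ <-.
  - by rewrite scale1r.
  - by rewrite em (marking_flip dxy).
by rewrite eu crossZl mulf_eq0 (gt_eqF a0); exact: (curve_transverse dxy).
Qed.

Lemma pull_transverse D (psi : R * R -> R * R) : diffeo psi ->
  transverse_on setT (pull psi (picture_of D)).
Proof.
move=> [[dh _] [g [[dg _] hK gK]]] p u m _ Pu m0.
have [v [Pv uv]] := picture_transverse I Pu m0.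
have ev : differential psi p (differential g (psi p) v) = v.
  by have := @diff_cancel _ g psi (psi p) v dg dh gK; rewrite hK.
exists (differential g (psi p) v); split; first by rewrite /pull ev.
apply: contraNneq uv => h0; rewrite -[X in cross _ X]ev cross_differential h0 mulr0 //.
Qed.

Lemma closed_pull D (psi : R * R -> R * R) : diffeo psi ->
  closed (carrier (pull psi (picture_of D))).
Proof.
move=> [[dh _] [g [[dg _] hK gK]]].
have -> : carrier (pull psi (picture_of D)) = psi @^-1` Defs.support D.
  rewrite -carrier_picture_of; apply/seteqP; split=> p /=.
    by move/(carrier_pull _ _ dh dg hK gK).
  by move=> h; apply/(carrier_pull _ _ dh dg hK gK).
apply: closed_comp; last exact: support_closed.
by move=> p _; apply: differentiable_continuous.
Qed.

(** At a fixed point the Jacobian determinant is continuous in time, starts at 1 and never vanishes,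
    since each stage is a diffeomorphism. *)
Lemma isotopy_orientation (H : R -> R * R -> R * R) :
  H 0 = id -> (forall t : R, 0 <= t <= 1 -> diffeo (H t)) ->
  (forall v, {within `[0, 1] `*` setT,
     continuous (fun z : R * (R * R) => differential (H z.1) z.2 v)}) ->
  orientation_preserving (H 1).
Proof.
move=> H0 dH cH p.
pose f t := cross (differential (H t) p (1, 0)) (differential (H t) p (0, 1)).
have f0 : f 0 = 1.
  have e w : differential (H 0) p w = w.
    by rewrite /differential H0; exact: (congr1 (fun F => F w) (diff_idE p)).
  by rewrite /f !e /cross /= mulr1 mulr0 subr0.
have fn t : 0 <= t <= 1 -> f t != 0.
  move=> /dH [[dh _] [g [[dg _] hK gK]]].
  have dK w : differential (H t) p (differential g (H t p) w) = w.
    by have := @diff_cancel _ g (H t) (H t p) w dg dh gK; rewrite hK.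
  have e := cross_differential (H t) p (differential g (H t p) (1, 0)) (differential g (H t p) (0, 1)).
  rewrite (dK (1, 0)) (dK (0, 1)) in e.
  apply/eqP => h.
  have {}e : cross ((1, 0) : R * R) (0, 1) = 0 by rewrite e -[X in X * _]/(f t) h mul0r.
  by move: e; rewrite /cross /= mulr1 mulr0 subr0 => /eqP; rewrite oner_eq0.
have cf : {within `[0, 1], continuous f}.
  apply/subspace_continuousP => t t01.
  have c v : (fun t => differential (H t) p v) @ within `[0, 1] (nbhs t) --> differential (H t) p v.
    have /subspace_continuousP /(_ (t, p)) := cH v.
    have : (`[0, 1] `*` setT) (t, p) by split.
    move=> + h => /h {}h; apply: cvg_trans h.
    move=> A [[B C] [/= Bt Cp] BCA].
    apply: filterS Bt => t' Bt' t'01; apply: (BCA (t', p)); split=> //=.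
    exact: nbhs_singleton.
  have c1 v : (fun t => (differential (H t) p v).1) @ within `[0, 1] (nbhs t) -->
      (differential (H t) p v).1.
    by apply: (@cvg_comp _ _ _ _ fst _ (nbhs (differential (H t) p v))); [exact: c|exact: cvg_fst].
  have c2 v : (fun t => (differential (H t) p v).2) @ within `[0, 1] (nbhs t) -->
      (differential (H t) p v).2.
    by apply: (@cvg_comp _ _ _ _ snd _ (nbhs (differential (H t) p v))); [exact: c|exact: cvg_snd].
  by apply: cvgB; apply: cvgM.
have [//|lt|/eqP] := ltgtP 0 (f 1); last by rewrite eq_sym (negPf (fn _ _)) // ler01 lexx.
have f11 : f 1 <= 1 by exact: le_trans (ltW lt) ler01.
have [|c c01 fc] := @IVT R f 0 1 0 ler01 cf.
  by rewrite f0 min_r // max_l // (ltW lt) ler01.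
by move: (fn c c01); rewrite fc eqxx.
Qed.

Section Colorings.
Variables (X : finType) (br vb : X -> X -> X -> X) (x0 : X).
Hypothesis hX : virtual_tribracket br vb.

Local Notation equinumerous D D' := (colorings br vb D #= colorings br vb D')%card.

Lemma isotopy_card D D' : planar_isotopic D D' -> equinumerous D D'.
Proof.
move=> [H [H0 dH _ cH same]].
have e : picture_of D = pull (H 1) (picture_of D').
  by apply/funext => p; apply/funext => v; apply/funext => m; apply/propext; exact: same.
apply: card_eq_trans (card_colorings D br vb x0) _; rewrite e.
apply: card_eq_trans (card_esym (card_colorings D' br vb x0)).
apply: card_esym; apply: card_pull; last exact: isotopy_orientation.
by apply: dH; rewrite ler01 lexx.
Qed.

Definition exchangeable M M' : Prop :=
  [/\ box_transfer br vb M M', box_transfer br vb M' M, box_rigid br vb M, box_rigid br vb M'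
    & crossings_inside M /\ crossings_inside M'].

(** Agreement of the models on the frame and transversality inside them are deduced from the
    diagrams and handed to each move. *)
Lemma local_move_card D D' M M' : local_move M M' D D' ->
  (same_picture_on (cbox `\` obox) M M' -> transverse_on cbox M -> transverse_on cbox M' ->
     exchangeable M M') ->
  equinumerous D D'.
Proof.
move=> [psi [dpsi opsi out inM inM']] ex.
have tr (E : diagram R) N : same_picture_on cbox (pull psi (picture_of E)) N -> transverse_on cbox N.
  move=> e p u m pb /(e _ _ _ pb) Pu m0.
  by have [v [/(e _ _ _ pb) Pv uv]] := pull_transverse dpsi I Pu m0; exists v.
have same : same_picture_on (cbox `\` obox) M M'.
  move=> p v m [pb po].
  by split=> [/(inM _ _ _ pb) /(out _ _ _ po) /(inM' _ _ _ pb)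
    |/(inM' _ _ _ pb) /(out _ _ _ po) /(inM _ _ _ pb)].
have [t1 t2 r1 r2 [i1 i2]] := ex same (tr _ _ inM) (tr _ _ inM').
apply: card_eq_trans (card_colorings D br vb x0) _.
apply: card_eq_trans (card_pull _ _ _ x0 dpsi opsi) _.
apply: card_eq_trans _ (card_esym (card_colorings D' br vb x0)).
apply: card_eq_trans _ (card_esym (card_pull _ _ _ x0 dpsi opsi)).
rewrite card_eq_le; apply/andP; split.
- exact: (local_card_le x0 (@closed_pull D psi dpsi) (@closed_pull D' psi dpsi) out inM inM' t1 r1 i2).
- exact: (local_card_le x0 (@closed_pull D' psi dpsi) (@closed_pull D psi dpsi) (same_pictureC out) inM' inM t2 r2 i1).
Qed.

Lemma move1_card k D D' : k <> Plain -> move1 k D D' -> equinumerous D D'.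
Proof.
move=> hk [s [f [hf mv]]]; apply: local_move_card mv _ => same _ _; split.
- exact: kink_transfer.
- exact: strand_transfer.
- exact: kink_rigid.
- exact: strand_rigid.
- by split; [exact: kink_inside|exact: strand_inside].
Qed.

Lemma move2_card k D D' : k <> Plain -> move2 k D D' -> equinumerous D D'.
Proof.
move=> hk [s [f [f' [x1 [x2 [hff [x1m [x12 x2M]] f01 hsg mv]]]]]].
have hf i := proj1 (hff i); have hf' i := proj2 (hff i).
set lab := (fun i j : 'I_2 => _) in mv.
have labP (i j : 'I_2) : i != j -> lab i j <> Plain /\ lab j i = flip (lab i j).
  rewrite /lab; case: (ord2P i) => ->; case: (ord2P j) => -> // _ /=; case: (k) hk => //.
apply: local_move_card mv _ => same _ tr; split.
- exact: (apart_transfer hX labP hf hf' f01 x1m x12 x2M hsg same).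
- exact: (bigon_transfer hX labP hf hf' f01 x1m x12 x2M hsg same tr).
- exact: apart_rigid.
- exact: (bigon_rigid hX labP hf' x1m x12 x2M hsg tr).
- by split; [exact: apart_inside|exact: (bigon_inside hf' x1m x12 x2M hsg)].
Qed.

Lemma move3_card (lab : 'I_3 -> 'I_3 -> mark) D D' :
  (forall i j, i != j -> lab i j <> Plain /\ lab j i = flip (lab i j)) ->
  (forall i j k, i != j -> i != k -> j != k -> consistent br vb (lab i j) (lab i k) (lab j k)) ->
  move3 lab D D' -> equinumerous D D'.
Proof.
move=> labP cons [s [f [f' [x [x' [hff [px px'] ord ord' mv]]]]]].
have hf i := proj1 (hff i); have hf' i := proj2 (hff i).
have [n01 n02 n12] := ord3_neq.
have c := cons _ _ _ n01 n02 n12.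
have T : triangle s lab f false by apply: (triangle_cross s lab hf px); apply/andP; exact: ord.
have T' : triangle s lab f' true by apply: (triangle_cross s lab hf' px'); apply/andP; exact: ord'.
apply: local_move_card mv _ => same tr tr'; split.
- exact: (tri_transfer hX labP c T T' tr same).
- exact: (tri_transfer hX labP c T' T tr' (same_pictureC same)).
- exact: (tri_rigid hX labP T tr).
- exact: (tri_rigid hX labP T' tr').
- by split; [exact: tri_inside T|exact: tri_inside T'].
Qed.

Lemma elementary_card D D' : elementary D D' -> equinumerous D D'.
Proof.
have cl k : classical k -> k <> Plain by move=> [->|->].
case=> [|k /cl hk|k /cl hk|lab hl|||lab hl|lab hl].
- exact: isotopy_card.
- exact: move1_card.
- exact: move2_card.
- apply: move3_card => [i j ij|i j k ij ik jk]; last exact: consistent_layered.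
  have [h hinj hlab] := hl; rewrite !hlab //; last by rewrite eq_sym.
  have := negbT (introF eqP (fun e => negP ij (introT eqP (hinj i j e)))).
  by case: ltngtP.
- exact: move1_card.
- exact: move2_card.
- apply: move3_card => [i j ij|i j k ij ik jk]; last exact: consistent_all_virtual.
  by rewrite !hl // eq_sym.
- apply: move3_card => [i j ij|i j k ij ik jk]; last exact: consistent_one_virtual.
  have [l hlab] := hl; have := hlab _ _ ij; have := hlab j i; rewrite eq_sym => /(_ ij).
  by rewrite orbC; case: ifP => [_ -> ->|_ [_ ->] [[] ->]].
Qed.

End Colorings.
End Invariance.

Local Open Scope card_scope.

Theorem corollary3 (R : realType) (X : finType) (br vb : X -> X -> X -> X)
    (hX : virtual_tribracket br vb) (D D' : diagram R)
    (hDD' : same_virtual_link D D') :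
  exists n : nat, colorings br vb D #= `I_n /\ colorings br vb D' #= `I_n.
Proof.
have [n Dn] := finite_colorings D br vb; exists n; split=> //.
suff : (colorings br vb D' #= colorings br vb D)%card by move=> /card_eq_trans; apply.
(* The value on the curves needs a point of [X]. If [X] is empty, neither diagram has a coloring,
   since each has a region. *)
have [x0|noX] := pselect (exists x0 : X, True); last first.
  have [A _] := regions_nonempty D; have [A' _] := regions_nonempty D'.
  have e (E : diagram R) (B : regions E) : colorings br vb E = set0.
    by rewrite -subset0 => c _; apply: noX; exists (c B).
  by rewrite (e D A) (e D' A') card_eq00.
case: x0 => x0 _; apply: card_esym; elim: hDD' => {D D' n Dn}.
- by move=> D D'; exact: elementary_card.
- by move=> D; exact: card_eqxx.
- by move=> D D' _; exact: card_esym.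
- by move=> D D' D'' _ h _; exact: card_eq_trans h.
Qed.
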